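(* Let $n\ge1$ and let $h(z,\xi)$ be an irreducible polynomial on $\mathbb{C}^n\times\mathbb{C}^n$ with $h(z,\bar z)>0$ for all $z\in\mathbb{C}^n$. Let $B$ be a small ball centered at $0\in\mathbb{C}^n$ and let $F_l:B\to\mathbb{C}^{N_l}$ ($1\le l\le m$) and $G_j:B\to\mathbb{C}^{N'_j}$ ($1\le j\le v$) be non-constant holomorphic algebraic maps satisfying $$h(z,\bar z)^r=\prod_{l=1}^m\big(1+|F_l(z)|^2\big)^{\mu_l}\prod_{j=1}^v\big(1+|G_j(z)|^2\big)^{-\lambda_j}\quad\text{on }B$$ (equivalently, $h(z,\xi)^r=\prod_l(1+F_l(z)\cdot\bar F_l(\xi))^{\mu_l}\prod_j(1+G_j(z)\cdot\bar G_j(\xi))^{-\lambda_j}$ on $B\times B$), where $r\in\mathbb{R}\setminus\{0\}$ and $\mu_l,\lambda_j>0$ satisfy $$\mathrm{span}_{\mathbb{Q}_0^+}\{\lambda_j\}_{j=1}^v\cap\mathrm{span}_{\mathbb{Q}_0^+}\{\mu_l\}_{l=1}^m=\{0\}.$$ Then all $F_l$ and $G_j$ are holomorphic polynomial maps. More precisely, there exist $m_l,n_j\in\mathbb{N}$ and $A_l,B_j>0$ with $$1+F_l(z)\cdot\bar F_l(\xi)=A_lh(z,\xi)^{m_l},\qquad 1+G_j(z)\cdot\bar G_j(\xi)=B_jh(z,\xi)^{n_j},$$ and $r=\sum_{l=1}^m m_l\mu_l-\sum_{j=1}^v\lambda_jn_j$.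
   Context: $\bar F(\xi):=\overline{F(\bar\xi)}$ and $a\cdot b=\sum_ia_ib_i$, so $F(z)\cdot\bar F(\bar z)=|F(z)|^2$. $\mathbb{Q}_0^+$ is the set of nonnegative rationals and $\mathrm{span}_{\mathbb{Q}_0^+}S$ the set of finite nonnegative rational linear combinations of elements of $S$ (the span of the empty set is $\{0\}$). A holomorphic map is algebraic if each component satisfies a nontrivial polynomial equation with polynomial coefficients in $z$. $\mathbb{N}$ denotes the positive integers. *)

(* Defs.v *)
(* multinomials' mpoly is Required but
   not Imported (notation clash with analysis), so it is used qualified. *)
From HB Require Import structures.
From mathcomp Require Import all_boot all_order all_algebra.
From mathcomp Require Import complex.
From mathcomp Require Import all_classical all_reals topology normedtype derive exp.
From mathcomp Require mpoly.
Import (canonicals) mpoly.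
Set Implicit Arguments.
Unset Strict Implicit.
Unset Printing Implicit Defensive.
Import Order.TTheory GRing.Theory Num.Theory.
Local Open Scope ring_scope.

(* Complex numbers are R[i] for R : realType; C^n is 'rV[R[i]]_n. *)

(* A (multivariate) polynomial over a field is irreducible if it is not a
   constant and every factorization has a constant factor.
   (mconst p: p is a constant polynomial, possibly 0.) *)
Definition mconst (K : fieldType) (k : nat) (p : mpoly.mpoly k K) : Prop :=
  exists c : K, p = mpoly.mpolyC k c.

Definition mirreducible (K : fieldType) (k : nat) (p : mpoly.mpoly k K) : Prop :=
  ~ mconst p /\
  forall q s : mpoly.mpoly k K, p = q * s -> mconst q \/ mconst s.

(* Evaluation of h(z, xi) for a polynomial h in the 2n variables (z, xi). *)
Definition eval2 (K : fieldType) (n : nat) (h : mpoly.mpoly (n + n) K)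
  (z xi : 'rV[K]_n) : K :=
  mpoly.meval (fun i : 'I_(n + n) =>
    match fintype.split i with inl a => z ord0 a | inr b => xi ord0 b end) h.

(* Evaluation of a polynomial in n variables at z in C^n. *)
Definition evaln (K : fieldType) (n : nat) (p : mpoly.mpoly n K) (z : 'rV[K]_n) : K :=
  mpoly.meval (fun i : 'I_n => z ord0 i) p.

(* Evaluation of P(z, w) for P in n+1 variables (z_1..z_n, w). *)
Definition evalzw (K : fieldType) (n : nat) (P : mpoly.mpoly n.+1 K)
  (z : 'rV[K]_n) (w : K) : K :=
  mpoly.meval (fun i : 'I_n.+1 =>
    match unlift ord_max i with Some a => z ord0 a | None => w end) P.

(* Componentwise complex conjugation of a vector. *)
Definition vconj (R : realType) (n : nat) (z : 'rV[R[i]]_n) : 'rV[R[i]]_n :=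
  map_mx (fun x => x^*) z.

(* (cball, the Euclidean ball of radius rho at 0, is defined below sqnorm.) *)
(* |v|^2 = sum_k |v_k|^2, as a real number (the real part of the
   nonnegative real complex number sum_k |v_k|^2). *)
Definition sqnorm (R : realType) (N : nat) (v : 'rV[R[i]]_N) : R :=
  complex.Re (\sum_(k < N) `|v ord0 k| ^+ 2).

Definition cball (R : realType) (n : nat) (rho : R) : set 'rV[R[i]]_n :=
  [set z | sqnorm z < rho ^+ 2].

(* F(z) . \bar F(xi) = sum_k F_k(z) * conj(F_k(conj xi)). *)
Definition polar (R : realType) (n N : nat) (F : 'rV[R[i]]_n -> 'rV[R[i]]_N)
  (z xi : 'rV[R[i]]_n) : R[i] :=
  \sum_(k < N) F z ord0 k * (F (vconj xi) ord0 k)^*.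

(* Holomorphic on U: complex (Frechet) differentiable at every point of U,
   the derivative being R[i]-linear. *)
Definition holomorphic_on (R : realType) (n N : nat) (U : set 'rV[R[i]]_n)
  (F : 'rV[R[i]]_n -> 'rV[R[i]]_N) : Prop :=
  forall z : ('rV[R[i]]_n : normedModType R[i]), U z -> differentiable F z.

(* Algebraic on U: each component satisfies a nontrivial polynomial equation
   P(z, F_k(z)) = 0 on U, with P a nonzero polynomial in (z, w). *)
Definition algebraic_on (R : realType) (n N : nat) (U : set 'rV[R[i]]_n)
  (F : 'rV[R[i]]_n -> 'rV[R[i]]_N) : Prop :=
  forall k : 'I_N, exists P : mpoly.mpoly n.+1 R[i],
    P != 0 /\ forall z, U z -> evalzw P z (F z ord0 k) = 0.

(* Non-constant on U. *)
Definition nonconstant_on (R : realType) (n N : nat) (U : set 'rV[R[i]]_n)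
  (F : 'rV[R[i]]_n -> 'rV[R[i]]_N) : Prop :=
  exists z1 z2, U z1 /\ U z2 /\ F z1 <> F z2.

(* F is (the restriction to U of) a holomorphic polynomial map. *)
Definition polynomial_map_on (R : realType) (n N : nat) (U : set 'rV[R[i]]_n)
  (F : 'rV[R[i]]_n -> 'rV[R[i]]_N) : Prop :=
  forall k : 'I_N, exists p : mpoly.mpoly n R[i],
    forall z, U z -> F z ord0 k = evaln p z.

Arguments cball {R} n rho _.

(* Main.v *)
(* Write f_l = 1 + |F_l|^2 and g_j = 1 + |G_j|^2.  Along a real line through 0 all these functions
   and h(z, conj z) are positive and algebraic.  If u is a product of integer powers of algebraic
   germs a_i and u' <> 0, then in a finite extension of the field of rational functions of u the
   operator D = (1/u') d/dx satisfies D u = 1, so the trace of (D u)/u has residue at u = 0 the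
   degree of the extension; on the other hand the trace of (D a_i)/a_i is the logarithmic derivative
   of a norm, and has an integer residue x_i.  If the a_i satisfy a real multiplicative relation with
   exponents c_i, the x_i satisfy sum c_i x_i = 0.  The condition on the spans provides, by Gordan's
   theorem over Q, integer weights positive on the f_l and g_j that vanish on all such integer
   relations, whence u' = 0: prod f_l^p_l prod g_j^q_j = d h^s with d > 0, p_l, q_j > 0 and s integer.

   After polarization the left hand side is K(z, xi) = sum_a phi_a(z) conj(phi_a(conj xi)) for a
   finite family containing 1 and all components of the F_l and G_j.  By inverting a Gram matrix,
   each phi_a is a combination of functions K(., conj xi_i).  If s >= 0, these are polynomials.
   If s < 0, the phi_a are rational, the identity extends to C^n and bounds h(z, conj z), so that h
   is constant, which is impossible.  Hence 1 + F_l . conj F_l and 1 + G_j . conj G_j are polynomials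
   dividing a power of h, and unique factorization makes them multiples of powers of h. *)
Require Import Defs.
From HB Require Import structures.
From mathcomp Require Import all_boot all_order all_algebra.
From mathcomp Require Import ring lra polyXY complex polyrcf.
From mathcomp Require Import all_classical all_reals topology normedtype derive realfun exp.
From mathcomp Require mpoly.
Import (canonicals) mpoly.
Set Implicit Arguments.
Unset Strict Implicit.
Unset Printing Implicit Defensive.
Import Order.TTheory GRing.Theory Num.Theory.
Import numFieldNormedType.Exports.
Local Open Scope ring_scope.

(** * Positive integer exponents *)

(** Analytic continuation and power series are replaced by continuity and algebraicity along real
    lines. An algebraic relation, freed of powers of the unknown, has a nonzero constant term; hence
    a continuous algebraic germ on the right of a point is either zero throughout or zero nowhere.
    This dichotomy lets right-hand germs be handled like elements of a field, while the finite
    extension itself becomes a finite family of functions whose span is preserved by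
    multiplications. Two towers occur. The first, over the line parameter x, shows that u'/u is
    identically zero or vanishes nowhere. In the second case u is transcendental and x is algebraic
    over it, so a second tower can be built over u, and it is there that D acts. The residue
    argument reaches the real exponents only through integer solutions of their relation. This is
    why the weights must annihilate all such solutions at once and why they come from a functional
    on a rational vector space. Polarization has the same flavour: z and conj xi are the values at i
    and -i of one complex affine line, whose real parameters give diagonal points. *)

(** Induction on [k]: the other vectors are projected along [w = v ord0]. If the projections admit
    no nontrivial nonnegative relation, a functional positive on them is corrected to vanish on [w],
    and a large multiple of it outweighs a form that is positive on [w]. Otherwise a relation
    between the projections puts a positive multiple of [w] into the cone of the others, and a
    functional positive on them is positive on [w]. *)
Lemma gordan_rat (D k : nat) (v : 'I_k -> 'rV[rat]_D) :
  (forall b : 'I_k -> rat, (forall i, 0 <= b i) ->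
     \sum_i b i *: v i = 0 -> forall i, b i = 0) ->
  exists phi : 'cV[rat]_D, forall i, 0 < (v i *m phi) 0 0.
Proof.
elim: k v => [|k IH] v vP; first by exists 0 => -[].
set w := v ord0; set v' := fun i => v (lift ord0 i).
pose ext (b0 : rat) (b : 'I_k -> rat) i :=
  if unlift ord0 i is Some j then b j else b0.
have extE b0 b : \sum_i ext b0 b i *: v i = b0 *: w + \sum_i b i *: v' i.
  rewrite big_ord_recl {1}/ext unlift_none; congr (_ + _).
  by apply: eq_bigr => i _; rewrite /ext liftK.
have extP b0 b : 0 <= b0 -> (forall i, 0 <= b i) ->
    b0 *: w + \sum_i b i *: v' i = 0 -> b0 = 0 /\ forall i, b i = 0.
  move=> b00 bi0; rewrite -extE => /vP h.
  have {}h : forall i, ext b0 b i = 0.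
    by apply: h => i; rewrite /ext; case: unlift.
  split; first by have := h ord0; rewrite /ext unlift_none.
  by move=> i; have := h (lift ord0 i); rewrite /ext liftK.
have w0 : w != 0.
  apply/eqP => w0; have [] := extP 1 (fun=> 0) ler01 (fun=> lexx _).
    by rewrite w0 scaler0 add0r big1 // => i _; rewrite scale0r.
  by move/eqP; rewrite oner_eq0.
have /rV0Pn[j wj] := w0.
pose v'' i := v' i - (v' i 0 j / w 0 j) *: w.
have [indep|] := pselect (forall b : 'I_k -> rat, (forall i, 0 <= b i) ->
     \sum_i b i *: v'' i = 0 -> forall i, b i = 0).
  have [phi phiP] := IH _ indep.
  pose ej : 'cV[rat]_D := delta_mx j 0.
  have ejE (x : 'rV[rat]_D) : (x *m ej) 0 0 = x 0 j.
    by rewrite -colE mxE.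
  (* [psi] is [phi] composed with the projection: it is zero on [w] and takes on [v' i] the value of
     [phi] on [v'' i]. *)
  pose psi := phi - ((w *m phi) 0 0 / w 0 j) *: ej.
  have psiE (x : 'rV[rat]_D) :
      (x *m psi) 0 0 = (x *m phi) 0 0 - x 0 j * ((w *m phi) 0 0 / w 0 j).
    by rewrite mulmxBr -scalemxAr [LHS]mxE [X in _ + X]mxE [X in - X]mxE ejE mulrC.
  have psiw : (w *m psi) 0 0 = 0 by rewrite psiE mulrCA divff // mulr1 subrr.
  have psiv i : 0 < (v' i *m psi) 0 0.
    have := phiP i; rewrite /v'' mulmxBl -scalemxAl psiE.
    rewrite [X in 0 < X -> _]mxE [X in _ + X]mxE [X in - X]mxE.
    by rewrite mulrAC mulrA.
  pose chi := (w 0 j)^-1 *: ej.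
  have chiw : (w *m chi) 0 0 = 1.
    by rewrite -scalemxAr mxE ejE mulVf.
  pose M := \sum_i `|(v' i *m chi) 0 0| / (v' i *m psi) 0 0 + 1.
  exists (M *: psi + chi) => i.
  rewrite mulmxDr -scalemxAr mxE [X in X + _]mxE.
  have [{}i ->|->] := unliftP ord0 i; last first.
    by rewrite -/w chiw psiw mulr0 add0r.
  rewrite -/(v' i).
  have : `|(v' i *m chi) 0 0| < M * (v' i *m psi) 0 0.
    rewrite -ltr_pdivrMr // /M ltr_pwDr // (bigD1 i) //= lerDl sumr_ge0 // => l _.
    by rewrite divr_ge0 // ltW.
  set X := M * _; set Y := (_ *m chi) 0 0 => h.
  by have := ler_norm (- Y); rewrite normrN; lra.
move/existsNP => [b /not_implyP[b0 /not_implyP[bs /existsNP[i0 /eqP bi0]]]].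
pose beta := \sum_i b i * (v' i 0 j / w 0 j).
have bE : \sum_i b i *: v' i = beta *: w.
  apply/eqP; rewrite -subr_eq0; apply/eqP; rewrite -[RHS]bs scaler_suml -sumrB.
  by apply: eq_bigr => i _; rewrite scalerBr scalerA.
(* If [beta <= 0], then [- beta] and [b] form a nonnegative relation between [w] and the [v' i],
   forcing [b i0 = 0]. *)
have beta0 : 0 < beta.
  rewrite ltNge; apply/negP => le0.
  have [||_ h] := extP (- beta) b _ b0; first by rewrite oppr_ge0.
    by rewrite bE -scalerDl addNr scale0r.
  by rewrite h eqxx in bi0.
have [|phi phiP] := IH v'.
  move=> a a0 aE; have [|//] := extP 0 a (lexx _) a0.
  by rewrite scale0r add0r.
exists phi => i; have [i' ->|->] := unliftP ord0 i; first exact: phiP.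
rewrite -/w -(pmulr_rgt0 _ beta0).
have -> : beta * (w *m phi) 0 0 = \sum_i b i * (v' i *m phi) 0 0.
  have := congr1 (fun x => (x *m phi) 0 0) bE.
  rewrite -scalemxAl [RHS]mxE => <-; rewrite mulmx_suml summxE.
  by apply: eq_bigr => l _; rewrite -scalemxAl [LHS]mxE.
rewrite (bigD1 i0) //= ltr_pwDl //.
  by rewrite mulr_gt0 ?phiP // lt_def bi0 b0.
by apply: sumr_ge0 => l _; rewrite mulr_ge0 // ltW // phiP.
Qed.

(** A basis over the rationals is grown one generator at a time. Its coordinates turn one real
    relation with integer coefficients into a relation between rational vectors. *)
Lemma rat_basis (R : numFieldType) (k : nat) (c : 'I_k -> R) :
  exists (D : nat) (e : 'I_D -> R) (q : 'I_k -> 'rV[rat]_D),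
    (forall i, c i = \sum_d ratr (q i 0 d) * e d) /\
    (forall x : 'rV[rat]_D, \sum_d ratr (x 0 d) * e d = 0 -> x = 0).
Proof.
elim: k c => [|k IH] c.
  exists 0%N, (fun=> 0), (fun=> 0); split; first by case.
  by move=> x _; apply/rowP => -[].
have [D [e [q [cE eP]]]] := IH (fun i => c (lift ord0 i)).
have [[x xE]|nE] := pselect (exists x : 'rV[rat]_D, c ord0 = \sum_d ratr (x 0 d) * e d).
  exists D, e, (fun i => if unlift ord0 i is Some j then q j else x); split => // i.
  by have [j ->|->] := unliftP ord0 i; rewrite ?liftK ?unlift_none.
pose e' (d : 'I_(1 + D)) := match fintype.split d with inl _ => c ord0 | inr d => e d end.
have e'E (x : 'rV[rat]_(1 + D)) : \sum_d ratr (x 0 d) * e' d =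
    ratr (x 0 (lshift D 0)) * c ord0 + \sum_d ratr (x 0 (rshift 1 d)) * e d.
  rewrite big_split_ord /= big_ord1 /e' (unsplitK (inl _)); congr (_ + _).
  by apply: eq_bigr => d _; rewrite (unsplitK (inr _)).
exists (1 + D)%N, e', (fun i => if unlift ord0 i is Some j then row_mx 0 (q j) else row_mx 1 0).
split => [i|x].
  have [j ->|->] := unliftP ord0 i; rewrite ?liftK ?unlift_none e'E row_mxEl; last first.
    rewrite mxE eqxx rmorph1 mul1r big1 ?addr0 // => d _.
    by rewrite row_mxEr mxE rmorph0 mul0r.
  rewrite mxE rmorph0 mul0r add0r cE.
  by apply: eq_bigr => d _; rewrite row_mxEr.
rewrite e'E => xE.
have [x0|x0] := eqVneq (x 0 (lshift D 0)) 0.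
  move: xE; rewrite x0 rmorph0 mul0r add0r => xE.
  have h : rsubmx x = 0.
    by apply: eP; rewrite -[RHS]xE; apply: eq_bigr => d _; rewrite mxE.
  apply/rowP => i; rewrite mxE -(splitK i); case: (fintype.split i) => d /=.
    by rewrite ord1 x0.
  by move/rowP/(_ d): h; rewrite !mxE.
case: nE; exists (- (x 0 (lshift D 0))^-1 *: rsubmx x).
have r0 : ratr (x 0 (lshift D 0)) != 0 :> R by rewrite fmorph_eq0.
apply: (mulfI r0); rewrite (eqP (_ : ratr _ * c ord0 == - (\sum_d ratr (x 0 (rshift 1 d)) * e d))).
  rewrite mulr_sumr -sumrN; apply: eq_bigr => d _.
  by rewrite !mxE mulrA -rmorphM mulrA mulrN divff // mulN1r rmorphN mulNr.
by rewrite -subr_eq0 opprK xE.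
Qed.

(* Choosing a Q-linear functional positive on the c_i turns real exponents into positive integers. *)
Lemma positive_integer_functional (R : numFieldType) (k : nat) (c : 'I_k -> R) (c0 : R) :
  (forall b : 'I_k -> rat, (forall i, 0 <= b i) ->
     \sum_i ratr (b i) * c i = 0 -> forall i, b i = 0) ->
  exists (p : 'I_k -> nat) (s : int), (forall i, (0 < p i)%N) /\
    forall (x : 'I_k -> int) (x0 : int),
      \sum_i (x i)%:~R * c i + x0%:~R * c0 = 0 ->
      \sum_i x i * (p i)%:Z + x0 * s = 0.
Proof.
move=> cP.
have [D [e [q [cE eP]]]] :=
  rat_basis (fun i : 'I_k.+1 => if unlift ord0 i is Some j then c j else c0).
pose v (i : 'I_k) := q (lift ord0 i).
have vE i : c i = \sum_d ratr (v i 0 d) * e d by have := cE (lift ord0 i); rewrite liftK.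
have c0E : c0 = \sum_d ratr (q ord0 0 d) * e d by have := cE ord0; rewrite unlift_none.
have [|phi phiP] := gordan_rat (v := v).
  move=> b b0 bE; apply: cP => //.
  under eq_bigr => i _ do rewrite vE mulr_sumr.
  rewrite exchange_big big1 //= => d _.
  have /rowP/(_ d) := bE; rewrite summxE mxE => bd.
  transitivity (ratr (\sum_i (b i *: v i) 0 d) * e d); last by rewrite bd rmorph0 mul0r.
  by rewrite rmorph_sum mulr_suml; apply: eq_bigr => i _; rewrite mxE rmorphM mulrA.
pose y (i : 'I_k) : rat := (v i *m phi) 0 0; pose y0 : rat := (q ord0 *m phi) 0 0.
(* [N] is a common denominator of the values of [phi]; [p] and [s] are these values multiplied by
   [N]. *)
pose N : int := denq y0 * \prod_i denq (y i).
have N0 : 0 < N by rewrite mulr_gt0 ?denq_gt0 // prodr_gt0 // => i _; exact: denq_gt0.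
pose p (i : 'I_k) : int := numq (y i) * (denq y0 * \prod_(j | j != i) denq (y j)).
pose s : int := numq y0 * \prod_j denq (y j).
have pE i : (p i)%:Q = N%:Q * y i.
  have <- : (numq (y i))%:Q / (denq (y i))%:Q * N%:Q = N%:Q * y i.
    by rewrite divq_num_den mulrC.
  rewrite /N /p [in RHS](bigD1 i) //= !intrM.
  have : (denq (y i))%:~R != 0 :> rat by rewrite intr_eq0 denq_neq0.
  by move=> d0; field.
have sE : s%:Q = N%:Q * y0.
  have <- : (numq y0)%:Q / (denq y0)%:Q * N%:Q = N%:Q * y0.
    by rewrite divq_num_den mulrC.
  rewrite /N /s !intrM.
  have : (denq y0)%:~R != 0 :> rat by rewrite intr_eq0 denq_neq0.
  by move=> d0; field.
have p0 i : 0 < p i.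
  by rewrite -(ltr_int rat) pE mulr_gt0 ?phiP // ltr0z.
exists (fun i => `|p i|%N), s; split => [i|x x0 xE]; first by rewrite absz_gt0 gt_eqF.
(* Independence of [e] lifts the real relation to the coordinate vectors, to which [phi] can then be
   applied. *)
have xE' : \sum_i (x i)%:~R *: v i + x0%:~R *: q ord0 = 0.
  apply: eP; rewrite -[RHS]xE c0E mulr_sumr.
  under [X in _ = X + _]eq_bigr => i _ do rewrite vE mulr_sumr.
  rewrite exchange_big -big_split /=; apply: eq_bigr => d _.
  have rI (z : int) (a : rat) : ratr (z%:~R * a) = z%:~R * ratr a :> R.
    by rewrite rmorphM /= ratr_int.
  rewrite mxE summxE rmorphD rmorph_sum /= mulrDl mulr_suml mxE rI -mulrA; congr (_ + _).
  by apply: eq_bigr => i _; rewrite mxE rI -mulrA.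
apply: (@intr_inj rat); rewrite intrD intrM sE rmorph_sum /=.
have /(congr1 (fun u => (u *m phi) 0 0)) := xE'.
rewrite mulmxDl mul0mx -scalemxAl mulmx_suml mxE summxE [X in _ + X]mxE [RHS]mxE => h.
transitivity (N%:Q * (\sum_i (x i)%:~R * y i + x0%:~R * y0)).
  rewrite mulrDr mulr_sumr; congr (_ + _); last by ring.
  apply: eq_bigr => i _; rewrite intrM gtz0_abs // pE; ring.
suff -> : \sum_i (x i)%:~R * y i + x0%:~R * y0 = 0 :> rat by rewrite mulr0.
rewrite -[RHS]h; congr (_ + _).
by apply: eq_bigr => i _; rewrite -scalemxAl [RHS]mxE.
Qed.

(** * Unique factorization *)

Section Factorial.
Implicit Types R A B : idomainType.

Definition divides R (a b : R) : Prop := exists c, b = c * a.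

Definition prime_elt R (p : R) : Prop :=
  [/\ p != 0, p \isn't a GRing.unit &
      forall a b, divides p (a * b) -> divides p a \/ divides p b].

Definition factored R (x : R) : Prop :=
  exists (u : R) (s : seq R),
    [/\ u \is a GRing.unit, forall p, p \in s -> prime_elt p & x = u * \prod_(p <- s) p].

(** Since the factors are prime and not merely irreducible, existence of a factorization already
    contains its uniqueness. *)
Definition factorial R : Prop := forall x : R, x != 0 -> factored x.

Lemma dividesMl R (a b c : R) : divides a b -> divides a (c * b).
Proof. by move=> [d ->]; exists (c * d); rewrite mulrA. Qed.

Lemma prime_divides_unit R (p u : R) : prime_elt p -> u \is a GRing.unit -> ~ divides p u.
Proof.
move=> [_ /negP pu _] uu [c uE]; apply: pu.
by move: uu; rewrite uE unitrM => /andP[].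
Qed.

Lemma prime_divides_prod R (p u : R) (s : seq R) : prime_elt p -> u \is a GRing.unit ->
  divides p (u * \prod_(q <- s) q) -> exists2 q, q \in s & divides p q.
Proof.
move=> pp uu; elim: s => [|q s IH].
  by rewrite big_nil mulr1 => /(prime_divides_unit pp uu).
have [_ _ pM] := pp.
rewrite big_cons mulrCA => /pM[pq|/IH[r rs pr]]; first by exists q; rewrite ?mem_head.
by exists r => //; rewrite inE rs orbT.
Qed.

Lemma factoredM R (x y : R) : factored x -> factored y -> factored (x * y).
Proof.
move=> [u [s [uu sp ->]]] [v [t [vu tp ->]]]; exists (u * v), (s ++ t).
rewrite unitrM uu vu; split => // [p|]; last by rewrite big_cat mulrACA.
by rewrite mem_cat => /orP[/sp|/tp].
Qed.

(** The prime [p] divides some prime [q] of the list and is therefore associated to it; [q] is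
    deleted and the quotient unit joins [u]. The strict decrease in size drives the induction of
    [poly_primitive_part]. *)
Lemma factored_cancel R (p x u : R) (s : seq R) : prime_elt p ->
  u \is a GRing.unit -> (forall q, q \in s -> prime_elt q) ->
  x * p = u * \prod_(q <- s) q ->
  exists (v : R) (t : seq R), [/\ v \is a GRing.unit, (forall q, q \in t -> prime_elt q),
    (size t < size s)%N & x = v * \prod_(q <- t) q].
Proof.
move=> pp uu sp E.
have [q qs [c qE]] : exists2 q, q \in s & divides p q.
  by apply: (prime_divides_prod pp uu); exists x.
have [p0 pu pM] := pp; have [q0 qu qM] := sp q qs.
have cu : c \is a GRing.unit.
  have : divides q (c * p) by exists 1; rewrite mul1r.
  case/qM => -[d dE].
    case/negP: pu; apply/unitrP; exists d.
    have dp : d * p = 1.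
      have c0 : c != 0 by apply: contraNneq q0 => c0; rewrite qE c0 mul0r.
      by apply: (mulfI c0); rewrite mulr1 {2}dE qE; ring.
    by split; rewrite // mulrC.
  have : c * d = 1.
    by apply: (mulIf p0); rewrite mul1r {2}dE qE; ring.
  by move=> cd; apply/unitrP; exists d; split; rewrite // mulrC.
exists (u * c), (rem q s); split.
- by rewrite unitrM uu.
- by move=> r /mem_rem; exact: sp.
- by rewrite size_rem // ltn_predL; case: (s) qs.
- apply: (mulIf p0); rewrite E (perm_big _ (perm_to_rem qs)) big_cons /= qE; ring.
Qed.

Lemma dividesC R (p : R) (f : {poly R}) :
  divides p%:P f <-> forall i, divides p f`_i.
Proof.
split=> [[g ->] i|h]; first by exists g`_i; rewrite coefMC.
have /choice[c cE] : forall i, exists c, f`_i = c * p by [].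
exists (\poly_(i < size f) c i); apply/polyP => i.
rewrite coefMC coef_poly; case: ltnP => [_|/leq_sizeP/(_ i (leqnn i)) ->]; first exact: cE.
by rewrite mul0r.
Qed.

Lemma dividesD R (p a b : R) : divides p a -> divides p b -> divides p (a + b).
Proof. by move=> [c ->] [d ->]; exists (c + d); rewrite mulrDl. Qed.

Lemma divides_sum R (p : R) (I : Type) (r : seq I) (P : pred I) (f : I -> R) :
  (forall i, P i -> divides p (f i)) -> divides p (\sum_(i <- r | P i) f i).
Proof.
move=> fP; apply: (big_ind (divides p)) => //; last exact: dividesD.
by exists 0; rewrite mul0r.
Qed.

(** Gauss: let [f_i] and [g_j] be the lowest coefficients that [p] does not divide. In the
    coefficient of index [i + j] of [f * g], every term but [f_i * g_j] is divisible by [p]. *)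
Lemma prime_eltC R (p : R) : prime_elt p -> prime_elt p%:P.
Proof.
move=> [p0 pu pM]; split; first by rewrite polyC_eq0.
  by rewrite poly_unitE coefC eqxx (negPf pu) andbF.
move=> f g fg; apply: contrapT => /not_orP[pf pg].
have low h : ~ divides p%:P h -> exists2 i, ~ divides p h`_i & forall j, (j < i)%N -> divides p h`_j.
  move=> /dividesC/existsNP[i0 hi0].
  have ex : exists i, ~~ `[< divides p h`_i >] by exists i0; apply/asboolPn.
  exists (ex_minn ex); case: ex_minnP => i /asboolPn ni imin //.
  move=> j ji; apply: contrapT => /asboolPn /imin.
  by rewrite leqNgt ji.
have [i fi fl] := low f pf; have [j gj gl] := low g pg.
have : divides p (f`_i * g`_j).
  have /dividesC/(_ (i + j)%N) := fg.
  have ilt : (i < (i + j).+1)%N by rewrite ltnS leq_addr.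
  rewrite coefM (bigD1 (Ordinal ilt)) //= addKn => h.
  have -> : f`_i * g`_j = (f`_i * g`_j + \sum_(k < (i + j).+1 | k != Ordinal ilt) f`_k * g`_(i + j - k))
     + (-1) * \sum_(k < (i + j).+1 | k != Ordinal ilt) f`_k * g`_(i + j - k) by ring.
  apply: dividesD => //; apply: dividesMl; apply: divides_sum => k.
  rewrite -val_eqE /= => ki; have [kl|] := ltnP k i.
    by rewrite mulrC; apply: dividesMl; exact: fl.
  rewrite leq_eqVlt eq_sym (negPf ki) /= => ik; apply: dividesMl; apply: gl.
  by rewrite ltn_subLR ?(ltnW ik) ?ltn_add2r // -ltnS ltn_ord.
by case/pM.
Qed.

(** Content 1, expressed without gcds in [R]. *)
Definition primitive R (f : {poly R}) : Prop :=
  forall p : R, prime_elt p -> ~ divides p%:P f.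

(** Each prime constant taken out of [f] is cancelled from the leading coefficient as well, whose
    list of primes becomes shorter; this bounds the number of extractions. *)
Lemma poly_primitive_part R (f : {poly R}) : factorial R -> f != 0 ->
  exists (c g : {poly R}), [/\ factored c, primitive g, f = c * g & size g = size f].
Proof.
move=> facR f0.
have := facR (lead_coef f); rewrite lead_coef_eq0 => /(_ f0) [u [s [uu sp]]].
have [n] := ubnP (size s); elim: n s u f f0 uu sp => // n IH s u f f0 uu sp sn lf.
have [fP|] := pselect (primitive f).
  exists 1, f; split => //; last by rewrite mul1r.
  exists 1, [::]; split => //; first exact: unitr1.
  by rewrite big_nil mulr1.
move=> /existsNP[p /not_implyP[pp /contrapT[g fE]]].
have g0 : g != 0 by apply: contraNneq f0 => g0; rewrite fE g0 mul0r.
have [p0 _ _] := pp.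
have lE : lead_coef g * p = u * \prod_(q <- s) q by rewrite -lf fE lead_coefM lead_coefC.
have [v [t [vu tp ts lg]]] := factored_cancel pp uu sp lE.
have [c [h [cf hP gE hs]]] := IH t v g g0 vu tp (leq_trans ts sn) lg.
exists (p%:P * c), h; split => //.
- apply: factoredM => //; exists 1, [:: p%:P]; split; rewrite ?unitr1 ?big_seq1 ?mul1r //.
  by move=> q; rewrite inE => /eqP ->; exact: prime_eltC.
- by rewrite fE gE; ring.
- by rewrite hs fE mulrC mul_polyC size_scale.
Qed.

(* Gauss: denominators can be cleared against a primitive polynomial. *)
Lemma primitive_clear R (c : R) (f q d : {poly R}) : factorial R -> c != 0 ->
  primitive f -> c *: f = q * d ->
  exists q' d', [/\ f = q' * d', size q' = size q & size d' = size d].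
Proof.
move=> facR /facR[u [s [uu sp ->]]] {c} fP.
elim: s q d sp => [|p s IH] q d sp.
  rewrite big_nil mulr1 => E; exists (u^-1 *: q), d; split => //.
    by rewrite -scalerAl -E scalerA mulVr // scale1r.
  by rewrite size_scale // invr_eq0; apply: contraTneq uu => ->; rewrite unitr0.
rewrite big_cons => E.
have pp := sp p (mem_head _ _); have [p0 _ _] := pp.
have [_ _ pM] := prime_eltC pp.
have sp' r : r \in s -> prime_elt r by move=> rs; apply: sp; rewrite inE rs orbT.
have : divides p%:P (q * d).
  by exists ((u * \prod_(j <- s) j) *: f); rewrite -E [RHS]mulrC mul_polyC scalerA; congr (_ *: _); ring.
have pP0 : p%:P != 0 :> {poly R} by rewrite polyC_eq0.
case/pM => -[g gE].
  have [|q' [d' [fE qs ds]]] := IH g d sp'.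
    apply: (mulfI pP0); rewrite mulrA [p%:P * g]mulrC -gE -E mul_polyC scalerA.
    by congr (_ *: _); ring.
  by exists q', d'; split; rewrite // qs gE mulrC mul_polyC size_scale.
have [|q' [d' [fE qs ds]]] := IH q g sp'.
  apply: (mulfI pP0); rewrite mulrCA [p%:P * g]mulrC -gE -E mul_polyC scalerA.
  by congr (_ *: _); ring.
by exists q', d'; split; rewrite // ds gE mulrC mul_polyC size_scale.
Qed.

(** Each prime of [c] divides [q * f], hence divides [q] because [f] is primitive, and can be
    cancelled. *)
Lemma primitive_divides R (c : R) (f b q : {poly R}) : factorial R -> c != 0 ->
  primitive f -> c *: b = q * f -> divides f b.
Proof.
move=> facR /facR[u [s [uu sp ->]]] {c} fP.
elim: s q sp => [|p s IH] q sp.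
  rewrite big_nil mulr1 => E; exists (u^-1 *: q).
  by rewrite -scalerAl -E scalerA mulVr // scale1r.
rewrite big_cons => E.
have pp := sp p (mem_head _ _); have [p0 _ _] := pp.
have [_ _ pM] := prime_eltC pp.
have sp' r : r \in s -> prime_elt r by move=> rs; apply: sp; rewrite inE rs orbT.
have : divides p%:P (q * f).
  by exists ((u * \prod_(j <- s) j) *: b); rewrite -E [RHS]mulrC mul_polyC scalerA; congr (_ *: _); ring.
have pP0 : p%:P != 0 :> {poly R} by rewrite polyC_eq0.
case/pM => [[g gE]|/(fP _ pp) //].
apply: (IH g sp'); apply: (mulfI pP0).
rewrite mulrA [p%:P * g]mulrC -gE -E mul_polyC scalerA.
by congr (_ *: _); ring.
Qed.

Lemma factorial_poly R : factorial R -> factorial {poly R}.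
Proof.
move=> facR f; have [n] := ubnP (size f); elim: n f => // n IH f fn f0.
have [c [g [cf gP fE gs]]] := poly_primitive_part facR f0.
rewrite fE; apply: factoredM => //.
have g0 : g != 0 by apply: contraNneq f0 => g0; rewrite fE g0 mulr0.
(* A primitive constant has no prime factor, so it is a unit. *)
have [g1|g1] := leqP (size g) 1.
  move: gP; rewrite (size1_polyC g1) => gP.
  have c0 : g`_0 != 0 by rewrite -polyC_eq0 -(size1_polyC g1).
  have [u [[|p s] [uu sp E]]] := facR _ c0.
    exists (g`_0)%:P, [::]; rewrite big_nil mulr1; split => //.
    by rewrite poly_unitE size_polyC c0 coefC eqxx E big_nil mulr1.
  exfalso; apply: (gP p (sp p (mem_head _ _))); exists (u * \prod_(j <- s) j)%:P.
  by rewrite -polyCM E big_cons; congr _%:P; ring.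
have [[q [d [gE [qs ds]]]]|irr] := pselect (exists q d : {poly R},
    g = q * d /\ (1 < size q)%N /\ (1 < size d)%N).
  have q0 : q != 0 by rewrite -size_poly_gt0 (ltn_trans _ qs).
  have d0 : d != 0 by rewrite -size_poly_gt0 (ltn_trans _ ds).
  have sE : size g = (size q + size d).-1 by rewrite gE size_mul.
  rewrite gE; apply: factoredM; apply: IH => //.
  - rewrite -ltnS (leq_trans _ fn) // ltnS -gs sE.
    by move: qs ds; case: (size q) (size d) => [|a] [|[|b]] //= _ _; rewrite !addnS !ltnS leq_addr.
  - rewrite -ltnS (leq_trans _ fn) // ltnS -gs sE.
    by move: qs ds; case: (size q) (size d) => [|[|a]] [|b] //= _ _; rewrite !addSn !ltnS leq_addl.
exists 1, [:: g]; rewrite unitr1 big_seq1 mul1r; split => // p; rewrite inE => /eqP -> {p}.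
split => //; first by rewrite poly_unitE gtn_eqF.
move=> a b [k abE].
(* The gcd over the fraction field divides [g] up to a constant, and clearing denominators gives a
   true factorization [g = q' * d'], one factor of which is constant by [irr]. If [d'] is constant,
   [g] and [a] are coprime and [g] divides [b] up to a constant; otherwise [g] is associated to the
   gcd and divides [a] up to a constant. [primitive_divides] removes the constants. *)
pose d := gcdp g a.
have /Pdiv.WeakIdomain.dvdpP[[c1 q] /= c10 E] := dvdp_gcdl g a.
have [q' [d' [gE qs ds]]] := primitive_clear facR c10 gP E.
have d'0 : d' != 0 by apply: contraNneq g0 => d0; rewrite gE d0 mulr0.
have q'0 : q' != 0 by apply: contraNneq g0 => d0; rewrite gE d0 mul0r.
have [d1|d1] := leqP (size d') 1.
  right; have cop : coprimep g a.
    by rewrite coprimep_def -ds eqn_leq d1 size_poly_gt0.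
  have : (g %| a * b)%R by rewrite abE dvdp_mulIr.
  rewrite Gauss_dvdpr // => /Pdiv.WeakIdomain.dvdpP[[c2 r] /= c20 E2].
  exact: primitive_divides E2.
left; have q1 : (size q' <= 1)%N by rewrite leqNgt; apply/negP => q1; apply: irr; exists q', d'.
have sd : size (gcdp g a) == size g.
  rewrite -ds gE size_mul //; move: q1; have := q'0; rewrite -size_poly_gt0.
  by case: (size q') => [|[|]].
move: sd; rewrite (dvdp_size_eqp (dvdp_gcdl g a)) => /andP[_ gd].
have /Pdiv.WeakIdomain.dvdpP[[c2 r] /= c20 E2] := dvdp_trans gd (dvdp_gcdr g a).
exact: primitive_divides E2.
Qed.

Lemma factorial_iso A B (f : {rmorphism A -> B}) (g : {rmorphism B -> A}) :
  cancel f g -> cancel g f -> factorial A -> factorial B.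
Proof.
move=> fK gK facA y y0.
have [|u [s [uu sp E]]] := facA (g y); first by rewrite fmorph_eq0 || (apply: contraNneq y0 => h; rewrite -(gK y) h rmorph0).
exists (f u), [seq f p | p <- s]; split; first exact: rmorph_unit.
- move=> _ /mapP[p ps ->]; have [p0 pu pM] := sp p ps; split.
  + by apply: contraNneq p0 => h; rewrite -(fK p) h rmorph0.
  + by apply: contraNN pu => /(rmorph_unit g); rewrite fK.
  + move=> a b [c cE]; have [] := pM (g a) (g b).
    * by exists (g c); rewrite -rmorphM cE rmorphM fK.
    * by move=> [d dE]; left; exists (f d); rewrite -rmorphM -dE gK.
    * by move=> [d dE]; right; exists (f d); rewrite -rmorphM -dE gK.
- by rewrite -(gK y) E rmorphM rmorph_prod big_map.
Qed.

(** In a prime factorization of the irreducible [h] all factors but one form a unit, so [h] is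
    prime. Each of the [s] factors [h] of the product then divides [f] or [g] and is cancelled
    there; those cancelled from [f] are counted by [m]. *)
Lemma irreducible_power_divisor R (h f g : R) (s : nat) : factorial R ->
  h != 0 -> h \isn't a GRing.unit ->
  (forall a b, h = a * b -> a \is a GRing.unit \/ b \is a GRing.unit) ->
  f * g = h ^+ s -> exists (u : R) (m : nat), u \is a GRing.unit /\ f = u * h ^+ m.
Proof.
move=> facR h0 hu hirr.
have hp : prime_elt h.
  have [u [[|p t] [uu tp E]]] := facR h h0.
    by rewrite big_nil mulr1 in E; rewrite E uu in hu.
  have pp := tp p (mem_head _ _); have [p0 pu pM] := pp.
  have wu : u * \prod_(j <- t) j \is a GRing.unit.
    have [] := hirr (u * \prod_(j <- t) j) p; rewrite ?(negPf pu) //.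
    by rewrite E big_cons; ring.
  set w := u * _ in wu; have hE : h = w * p by rewrite E big_cons /w; ring.
  split => // a b [c abE].
  have [|[d ->]|[d ->]] := pM a b.
  - by exists (c * w); rewrite abE hE mulrA.
  - by left; exists (d * w^-1); rewrite hE; rewrite mulrA mulrVK.
  - by right; exists (d * w^-1); rewrite hE; rewrite mulrA mulrVK.
have [_ _ hM] := hp.
elim: s f g => [|s IH] f g.
  rewrite expr0 => fg; exists f, 0%N; rewrite expr0 mulr1; split => //.
  by apply/unitrP; exists g; rewrite mulrC fg; split => //; rewrite -fg mulrC.
rewrite exprS => fg.
have : divides h (f * g) by exists (h ^+ s); rewrite fg mulrC.
case/hM => -[k kE].
  have [|u [m [uu E]]] := IH k g.
    by apply: (mulfI h0); rewrite -fg kE; ring.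
  by exists u, m.+1; split => //; rewrite kE E exprS; ring.
by apply: (IH f k); apply: (mulfI h0); rewrite -fg kE; ring.
Qed.

End Factorial.

(** * Factoriality of polynomial rings in several variables *)

Local Notation mX i := (mpoly.mpolyX _ (mpoly.mnm1 i)).

Section Mpoly.
Variable K : fieldType.

Lemma mpoly_ring_ind (n : nat) (P : mpoly.mpoly n K -> Prop) :
  (forall c, P (mpoly.mpolyC n c)) -> (forall i, P (mX i)) ->
  (forall p q, P p -> P q -> P (p + q)) -> (forall p q, P p -> P q -> P (p * q)) ->
  forall p, P p.
Proof.
move=> PC PX PD PM; apply: mpoly.mpolyind => [|c m p _ _ IH].
  by rewrite -(mpoly.mpolyC0 n K).
apply: PD => //; rewrite -mpoly.mul_mpolyC; apply: (PM) => //.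
rewrite mpoly.mpolyXE_id; apply: (big_ind P) => [|p' q'|i _]; [exact: (PC 1)|exact: PM|].
move: (mpoly.fun_of_multinom m i) => j; elim: j => [|j IHj]; first exact: (PC 1).
by rewrite exprS; exact: PM.
Qed.

(** The inverse of [muni], which views a polynomial as univariate in its last variable; factoriality
    is transported along this isomorphism by induction on [n]. *)
Let toX n : {poly mpoly.mpoly n K} -> mpoly.mpoly n.+1 K :=
  horner_morph (fun x => mulrC (mX (@ord_max n)) (@mpoly.mwiden n K x)).

Let toXD n (p q : {poly mpoly.mpoly n K}) : toX (p + q) = toX p + toX q.
Proof. exact: rmorphD. Qed.

Let toXM n (p q : {poly mpoly.mpoly n K}) : toX (p * q) = toX p * toX q.
Proof. exact: rmorphM. Qed.

Let toXX n : toX 'X = mX (@ord_max n).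
Proof. exact: horner_morphX. Qed.

Let toXC n (p : mpoly.mpoly n K) : toX p%:P = mpoly.mwiden p.
Proof. exact: horner_morphC. Qed.

Lemma muni_max n : mpoly.muni (mX (@ord_max n)) = 'X :> {poly mpoly.mpoly n K}.
Proof.
rewrite /mpoly.muni mpoly.mmapX mpoly.mmap1U.
by case: splitP => // -[j jn] /= E; exfalso; move: jn; rewrite -E ltnn.
Qed.

Lemma muni_widen n (p : mpoly.mpoly n K) : mpoly.muni (mpoly.mwiden p) = p%:P.
Proof.
elim/mpoly_ring_ind: p => [c|i|p q IHp IHq|p q IHp IHq].
- by rewrite mpoly.mwidenC mpoly.muniC.
- rewrite mpoly.mwidenX mpoly.mnmwiden1 /mpoly.muni mpoly.mmapX mpoly.mmap1U.
  case: splitP => [j /= E|j /= E].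
    by congr (polyC (mX _)); apply/val_inj; rewrite /= -E.
  by have := ltn_ord i; rewrite E ltnNge leq_addr.
- by rewrite mpoly.mwidenD mpoly.muniD IHp IHq polyCD.
- by rewrite mpoly.mwidenM mpoly.muniM IHp IHq polyCM.
Qed.

Lemma toXK n : cancel (@toX n) (@mpoly.muni n K).
Proof.
move=> p; elim/poly_ind: p => [|p c IH]; first by rewrite -polyC0 toXC mpoly.mwiden0 mpoly.muni0.
by rewrite toXD toXM mpoly.muniD mpoly.muniM IH toXX toXC muni_max muni_widen.
Qed.

Lemma muniK n : cancel (@mpoly.muni n K) (@toX n).
Proof.
move=> p; elim/mpoly_ring_ind: p => [c|i|p q IHp IHq|p q IHp IHq].
- by rewrite mpoly.muniC toXC mpoly.mwidenC.
- have [j ->|->] := unliftP ord_max i; last by rewrite muni_max; exact: toXX.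
  have -> : lift ord_max j = widen_ord (leqnSn n) j.
    by apply/val_inj; rewrite /= /bump leqNgt ltn_ord.
  rewrite -mpoly.mnmwiden1 -mpoly.mwidenX muni_widen; exact: toXC.
- by rewrite mpoly.muniD toXD; congr (_ + _).
- by rewrite mpoly.muniM toXM; congr (_ * _).
Qed.

Lemma unit_mpolyC n (c : K) : c != 0 -> mpoly.mpolyC n c \is a GRing.unit.
Proof.
by move=> c0; apply/unitrP; exists (mpoly.mpolyC n c^-1); rewrite -!mpoly.mpolyCM mulVf // mulfV.
Qed.

Lemma factorial_mpoly n : factorial (mpoly.mpoly n K).
Proof.
elim: n => [|n IH].
  move=> p p0; exists p, [::]; rewrite big_nil mulr1; split => //.
  move: p0; rewrite (mpoly.nvar0_mpolyC p); set c := mpoly.mcoeff _ _ => p0.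
  by apply: unit_mpolyC; apply: contraNneq p0 => ->; rewrite mpoly.mpolyC0.
exact: (@factorial_iso _ _ _ _ (@toXK n) (@muniK n) (factorial_poly IH)).
Qed.

End Mpoly.

(** * Residues of logarithmic derivatives *)

(** The derivative appears as a replaced factor, so that each summand is a product in the
    determinant of a matrix with one differentiated row. *)
Lemma deriv_prod (K : comNzRingType) (I : eqType) (r : seq I) (f : I -> {poly K}) :
  uniq r ->
  (\prod_(i <- r) f i)^`() = \sum_(i <- r) \prod_(j <- r) (if j == i then (f j)^`() else f j).
Proof.
elim: r => [_|i r IH /= /andP[ir ur]]; first by rewrite !big_nil derivC.
rewrite !big_cons derivM IH // eqxx; congr (_ * _ + _).
  apply: eq_big_seq => j jr.
  by case: eqP => // ji; rewrite -ji jr in ir.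
rewrite mulr_sumr; apply: eq_big_seq => j jr.
by rewrite big_cons; case: eqP => // ij; rewrite ij jr in ir.
Qed.

(* Jacobi's formula *)
Lemma deriv_det (K : comNzRingType) (d : nat) (A : 'M[{poly K}]_d) :
  (\det A)^`() = \tr (\adj A *m map_mx deriv A).
Proof.
pose B i := \matrix_(k, l) if k == i then (A k l)^`() else A k l.
transitivity (\sum_i \det (B i)).
  rewrite /determinant raddf_sum exchange_big /=; apply: eq_bigr => s _.
  rewrite -mulr_sumr derivM.
  have -> : ((-1) ^+ perm.odd_perm s : {poly K})^`() = 0.
    by case: (perm.odd_perm s); rewrite ?expr0 ?expr1 ?derivN derivC ?oppr0.
  rewrite mul0r add0r deriv_prod ?index_enum_uniq //; congr (_ * _).
  by apply: eq_bigr => i _; apply: eq_bigr => j _; rewrite mxE.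
rewrite mxtrace_mulC; apply: eq_bigr => i _.
rewrite (expand_det_row _ i) mxE; apply: eq_bigr => j _.
rewrite !mxE eqxx; congr (_ * _); rewrite /cofactor; congr (_ * \det _).
apply/matrixP => k l; rewrite !mxE eq_sym.
by have /negPf -> := neq_lift i k.
Qed.

(** Read [A/q], [V/r] and [Gm/s] as the matrices, in a basis, of multiplication by [a], of
    multiplication by [D a / a] and of [D]. The hypothesis is the Leibniz rule for [D (a w)],
    cleared of denominators. After multiplication by the adjugate of [A], the two terms in [Gm] have
    equal traces, and Jacobi's formula leaves the logarithmic derivative of the norm
    [det A / q^d]. *)
Lemma trace_log_deriv (K : fieldType) (d : nat) (A Gm V : 'M[{poly K}]_d)
  (q r s : {poly K}) : s != 0 ->
  (q^`() * s * r) *: A + (q * s) *: (A *m V) + (q * r) *: (Gm *m A) =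
    (q * s * r) *: map_mx deriv A + (q * r) *: (A *m Gm) ->
  \tr V * (\det A * q) = r * ((\det A)^`() * q - (\det A * q^`()) *+ d).
Proof.
move=> s0 /(congr1 (fun M => \tr (\adj A *m M))).
rewrite !mulmxDr !mxtraceD -!scalemxAr !mxtraceZ -deriv_det !mulmxA mul_adj_mx.
rewrite mxtrace_scalar mul_scalar_mx mxtraceZ -mulmxA mxtrace_mulC -mulmxA mul_mx_adj.
rewrite mul_mx_scalar mul_scalar_mx !mxtraceZ => /addIr.
rewrite -(mulr_natr (\det A)) -(mulr_natr (\det A * q^`())).
move: (\det A) (\tr V) (\tr Gm) (\det A)^`() q^`() (d%:R) => D tV tG D' q' dR h.
apply: (mulfI s0); apply: (addrI (q' * s * r * (D * dR))).
have -> : q' * s * r * (D * dR) + s * (tV * (D * q)) =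
  q' * s * r * (D * dR) + q * s * (D * tV) by ring.
by rewrite h; ring.
Qed.

Lemma poly_order0 (K : fieldType) (p : {poly K}) : p != 0 ->
  exists (n : nat) (g : {poly K}), g.[0] != 0 /\ p = g * 'X^n.
Proof.
move=> p0; have [n [g g0 ->]] := multiplicity_XsubC p 0.
exists n, g; rewrite subr0; split => //.
by move: g0; rewrite p0.
Qed.

Lemma mulX_deriv (K : fieldType) (g : {poly K}) n :
  'X * (g * 'X^n)^`() = ('X * g^`() + n%:R * g) * 'X^n.
Proof.
rewrite derivM derivXn; case: n => [|n].
  by rewrite mulr0n mulr0 mul0r !addr0 mulrA.
rewrite /= exprS -(mulr_natr 'X^n).
by move: (n.+1%:R) 'X^n g^`() => a b c; ring.
Qed.

(** The conclusion says that ['X * T / r] equals [x + 'X * H / G] with [G] nonzero at 0, that is,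
    that [T / r] has at most a simple pole at 0, with residue [x]. It holds because [T / r] is the
    logarithmic derivative of [D / q^d]. *)
Lemma residue_log_deriv (K : fieldType) (d : nat) (D q T r : {poly K}) :
  D != 0 -> q != 0 ->
  T * (D * q) = r * (D^`() * q - (D * q^`()) *+ d) ->
  exists (x : int) (G H : {poly K}), G.[0] != 0 /\
    'X * T * G = r * (x%:~R * G + 'X * H).
Proof.
move=> /poly_order0[m [g [g0 DE]]] /poly_order0[n [l [l0 qE]]] TE.
(* The residue is the order at 0 of [D / q^d]: [m] and [n] are the orders of [D] and [q], and [g],
   [l] their cofactors nonzero at 0. *)
exists (m%:Z - (n * d)%:Z), (g * l), (g^`() * l - g * l^`() * d%:R).
split; first by rewrite hornerM mulf_neq0.
have X0 : 'X^m * 'X^n != 0 :> {poly K} by rewrite mulf_neq0 // monic_neq0 ?monicXn.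
apply: (mulIf X0).
have mD : 'X * D^`() = ('X * g^`() + m%:R * g) * 'X^m by rewrite DE mulX_deriv.
have mq : 'X * q^`() = ('X * l^`() + n%:R * l) * 'X^n by rewrite qE mulX_deriv.
rewrite -(mulr_natr (D * q^`())) in TE.
rewrite intrB -!pmulrn natrM.
move: DE qE TE mD mq {g0 l0 X0}.
move: (D^`()) (q^`()) => D' q'.
move: (g^`()) (l^`()) => g' l'.
move: (m%:R) (n%:R) (d%:R) => m' n' d'. move: ('X^m) ('X^n) => Xm Xn. move: 'X => X DE qE TE mD mq.
transitivity (X * (T * (D * q))); first by rewrite DE qE; ring.
rewrite TE; transitivity (r * ((X * D') * q - D * (X * q') * d')); first by ring.
by rewrite mD mq DE qE; ring.
Qed.

(* T_i / r is the logarithmic derivative of D_i / q_i^d, with residue the integer x_i at 0. *)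
Lemma residue_sum (K : fieldType) (k d : nat) (D q T : 'I_k -> {poly K}) (r : {poly K}) :
  r != 0 -> (forall i, D i != 0) -> (forall i, q i != 0) ->
  (forall i, T i * (D i * q i) = r * ((D i)^`() * q i - (D i * (q i)^`()) *+ d)) ->
  exists x : 'I_k -> int, forall (e : 'I_k -> K) (kappa : K),
    'X * \sum_i e i *: T i = kappa *: r -> \sum_i e i * (x i)%:~R = kappa.
Proof.
move=> r0 D0 q0 TE.
have /fin_all_exists[x /fin_all_exists[G /fin_all_exists[H GH]]] :=
  fun i => residue_log_deriv (D0 i) (q0 i) (TE i).
exists x => e kappa TP.
(* Over the common denominator [P], which is nonzero at 0, evaluation at 0 discards the multiples of
   ['X] and leaves the residues. *)
pose P := \prod_i G i; pose Pi i := \prod_(j | j != i) G j.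
have PE i : P = G i * Pi i by rewrite /P (bigD1 i).
have P0 : P.[0] != 0 by rewrite horner_prod; apply/prodf_neq0 => i _; have [] := GH i.
have E : \sum_i e i *: ((x i)%:~R * P + 'X * (H i * Pi i)) = kappa *: P.
  apply: (mulfI r0); rewrite -scalerAr scalerAl -TP -mulrA mulr_suml !mulr_sumr.
  apply: eq_bigr => i _; have [_ wi] := GH i.
  rewrite -scalerAr -scalerAl -scalerAr; congr (_ *: _).
  rewrite (PE i); move: wi; move: (Pi i) (G i) (H i) (T i) ((x i)%:~R) => Pj g h y z wi.
  transitivity (r * (z * g + 'X * h) * Pj); first by ring.
  by rewrite -wi; ring.
apply: (mulIf P0); have /(congr1 (fun p => p.[0])) := E.
rewrite hornerZ => <-; rewrite horner_sum mulr_suml; apply: eq_bigr => i _.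
rewrite hornerZ hornerD !hornerM hornerX mul0r addr0 -mulrA; congr (_ * (_ * _)).
by rewrite -[in RHS](rmorph_int (@polyC K)) hornerC.
Qed.

(** * Algebraic functions as endomorphisms of finite modules *)

Section FiniteModules.
Context {K : fieldType} {T : Type} {F : set_system T} {FF : Filter F} {b : T -> K}.

(* Near F, multiplication by f preserves the K(b)-span of the family G. *)
Definition stab (I : finType) (G : I -> T -> K) (f : T -> K) : Prop :=
  exists2 q : {poly K}, q != 0 & exists A : I -> I -> {poly K},
    \forall x \near F, forall i,
      q.[b x] * f x * G i x = \sum_j (A i j).[b x] * G j x.

Context {I : finType} {G : I -> T -> K}.

Lemma stab_near (f g : T -> K) : (\forall x \near F, f x = g x) -> stab G f -> stab G g.
Proof.
move=> fg [q q0 [A AP]]; exists q => //; exists A.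
by apply: filterS2 fg AP => x <-.
Qed.

Lemma stab_poly (p : {poly K}) : stab G (fun x => p.[b x]).
Proof.
exists 1; first exact: oner_neq0; exists (fun i j => if i == j then p else 0).
near=> x => i; rewrite hornerC mul1r (bigD1 i) //= eqxx big1 ?addr0 // => j ji.
by rewrite eq_sym (negPf ji) horner0 mul0r.
Unshelve. all: by end_near. Qed.

Lemma stabC (c : K) : stab G (fun=> c).
Proof.
by apply: stab_near (stab_poly c%:P); apply: nearW => x; rewrite hornerC.
Qed.

Lemma stabD (f g : T -> K) : stab G f -> stab G g -> stab G (fun x => f x + g x).
Proof.
move=> [q q0 [A AP]] [r r0 [B BP]]; exists (q * r); first by rewrite mulf_neq0.
exists (fun i j => r * A i j + q * B i j); apply: filterS2 AP BP => x AP BP i.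
transitivity (r.[b x] * (q.[b x] * f x * G i x) + q.[b x] * (r.[b x] * g x * G i x)).
  by rewrite hornerM; ring.
rewrite AP BP !mulr_sumr -big_split; apply: eq_bigr => j _ /=.
by rewrite hornerD !hornerM; ring.
Qed.

Lemma stabM (f g : T -> K) : stab G f -> stab G g -> stab G (fun x => f x * g x).
Proof.
move=> [q q0 [A AP]] [r r0 [B BP]]; exists (q * r); first by rewrite mulf_neq0.
exists (fun i k => \sum_j B i j * A j k); apply: filterS2 AP BP => x AP BP i.
transitivity (q.[b x] * f x * (r.[b x] * g x * G i x)).
  by rewrite hornerM; ring.
rewrite BP mulr_sumr.
under eq_bigr => j _ do rewrite mulrCA AP mulr_sumr.
rewrite exchange_big; apply: eq_bigr => k _ /=.
rewrite horner_sum mulr_suml; apply: eq_bigr => j _.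
by rewrite hornerM mulrA.
Qed.

Lemma stabN (f : T -> K) : stab G f -> stab G (fun x => - f x).
Proof.
move=> /(stabM (stabC (-1))); apply: stab_near.
by apply: nearW => x; rewrite mulN1r.
Qed.

Lemma stabX (f : T -> K) n : stab G f -> stab G (fun x => f x ^+ n).
Proof.
move=> fP; elim: n => [|n IH]; first exact: stabC.
by apply: stab_near (stabM fP IH); apply: nearW => x; rewrite exprS.
Qed.

Lemma stab_sum (J : Type) (r : seq J) (P : pred J) (f : J -> T -> K) :
  (forall j, P j -> stab G (f j)) -> stab G (fun x => \sum_(j <- r | P j) f j x).
Proof.
move=> fP; elim: r => [|j r IH].
  by apply: stab_near (stabC 0); apply: nearW => x; rewrite big_nil.
have [Pj|nPj] := boolP (P j); last first.
  by apply: stab_near IH; apply: nearW => x; rewrite big_cons (negPf nPj).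
apply: stab_near (stabD (fP j Pj) IH).
by apply: nearW => x; rewrite big_cons Pj.
Qed.

Lemma stab_prod (J : Type) (r : seq J) (P : pred J) (f : J -> T -> K) :
  (forall j, P j -> stab G (f j)) -> stab G (fun x => \prod_(j <- r | P j) f j x).
Proof.
move=> fP; elim: r => [|j r IH].
  by apply: stab_near (stabC 1); apply: nearW => x; rewrite big_nil.
have [Pj|nPj] := boolP (P j); last first.
  by apply: stab_near IH; apply: nearW => x; rewrite big_cons (negPf nPj).
apply: stab_near (stabM (fP j Pj) IH).
by apply: nearW => x; rewrite big_cons Pj.
Qed.

Lemma stab_biv (P : {poly {poly K}}) (s f : T -> K) :
  stab G s -> stab G f -> stab G (fun x => P.[(f x)%:P].[s x]).
Proof.
move=> sP fP; elim/poly_ind: P => [|P c IH].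
  by apply: stab_near (stabC 0); apply: nearW => x; rewrite !horner0.
apply: stab_near (_ : stab G (fun x => P.[(f x)%:P].[s x] * f x + c.[s x])).
  by apply: nearW => x; rewrite hornerMXaddC hornerD hornerM hornerC.
apply: stabD; first exact: stabM.
elim/poly_ind: c => [|c a IHc].
  by apply: stab_near (stabC 0); apply: nearW => x; rewrite !horner0.
apply: stab_near (stabD (stabM IHc sP) (stabC a)).
by apply: nearW => x; rewrite hornerMXaddC.
Qed.

Lemma stab_common (J : finType) (f : J -> T -> K) : (forall j, stab G (f j)) ->
  exists2 q : {poly K}, q != 0 & exists A : J -> I -> I -> {poly K},
    \forall x \near F, forall j i,
      q.[b x] * f j x * G i x = \sum_k (A j i k).[b x] * G k x.
Proof.
move=> fP.
have /choice[q qP] : forall j, exists q : {poly K}, q != 0 /\ exists A : I -> I -> {poly K},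
    \forall x \near F, forall i, q.[b x] * f j x * G i x = \sum_k (A i k).[b x] * G k x.
  by move=> j; have [q q0 qP] := fP j; exists q.
have /choice[A AP] := fun j => (qP j).2.
exists (\prod_j q j); first by apply/prodf_neq0 => j _; have [] := qP j.
exists (fun j i k => (\prod_(l | l != j) q l) * A j i k).
near=> x => j i.
have -> : (\prod_j q j).[b x] * f j x * G i x =
    (\prod_(l | l != j) q l).[b x] * ((q j).[b x] * f j x * G i x).
  by rewrite (bigD1 j) //= hornerM; ring.
have -> : (q j).[b x] * f j x * G i x = \sum_k (A j i k).[b x] * G k x.
  by move: j i; near: x; apply: filter_forall => j; exact: AP.
by rewrite mulr_sumr; apply: eq_bigr => k _; rewrite hornerM mulrA.
Unshelve. all: by end_near. Qed.

(* Cayley-Hamilton *)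
Lemma stab_algebraic (f : T -> K) : stab G f ->
  (\forall x \near F, exists i, G i x != 0) ->
  exists2 Q : {poly {poly K}}, Q != 0 & \forall x \near F, Q.[(f x)%:P].[b x] = 0.
Proof.
move=> [q q0 [A AP]] G0.
pose M : 'M[{poly K}]_#|I| := \matrix_(i, j) A (enum_val j) (enum_val i).
(* At each point [q * f] is an eigenvalue of the evaluated matrix, with the values of [G] as
   eigenvector (hence the transposed indices in [M]); the substitution turns its equation into one
   for [f]. *)
exists (char_poly M \Po (q *: 'X)).
  rewrite comp_poly_eq0 ?monic_neq0 ?char_poly_monic //.
  by rewrite size_scale // size_polyX.
apply: filterS2 AP G0 => x AP [i Gi].
rewrite horner_comp hornerZ hornerX.
pose ev := horner_eval (b x).
have -> : (char_poly M).[q * (f x)%:P].[b x] = (map_poly ev (char_poly M)).[ev (q * (f x)%:P)].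
  by rewrite horner_map.
rewrite map_char_poly; apply/eqP; rewrite -/(root _ _) -eigenvalue_root_char.
apply/eigenvalueP; exists (\row_j G (enum_val j) x); last first.
  apply/eqP => /rowP/(_ (enum_rank i)); rewrite !mxE enum_rankK.
  by move/eqP; rewrite (negPf Gi).
apply/rowP => j; rewrite !mxE /ev horner_evalE hornerM hornerC AP.
rewrite (reindex (@enum_val I I)) /=; last exact: onW_bij (enum_val_bij I).
by apply: eq_bigr => k _; rewrite !mxE mulrC.
Qed.

(** A relation of [f], divided by the powers of the unknown, reads [S(f) * f + Q'_0 = 0] with [Q'_0]
    a nonzero polynomial in [b]. Hence the inverse of [f] is [- S(f) / Q'_0]. *)
Lemma stabV (f : T -> K) : ProperFilter F -> stab G f ->
  (\forall x \near F, exists i, G i x != 0) ->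
  (\forall x \near F, f x != 0) ->
  (forall q : {poly K}, q != 0 -> \forall x \near F, q.[b x] != 0) ->
  stab G (fun x => (f x)^-1).
Proof.
move=> PF fP G0 f0 bP; have [Q Q0 QP] := stab_algebraic fP G0.
have [m [Q' Q'0 QE]] := multiplicity_XsubC Q 0.
have {}Q'0 : Q'`_0 != 0 by rewrite -horner_coef0; move: Q'0; rewrite Q0.
pose S := drop_poly 1 Q'.
have SE : Q' = S * 'X + (Q'`_0)%:P.
  rewrite -{1}(poly_take_drop 1 Q') addrC expr1; congr (_ + _).
  apply/polyP => -[|i]; rewrite coef_take_poly coefC //=.
have SP : stab G (fun x => S.[(f x)%:P].[b x]).
  by apply: stab_biv fP; have := stab_poly 'X; apply: stab_near; apply: nearW => x; rewrite hornerX.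
have [q q0 [A AP]] := stabN SP.
exists (q * Q'`_0); first by rewrite mulf_neq0.
exists A; near=> x => i.
have fx0 : f x != 0 by near: x.
have E : S.[(f x)%:P].[b x] * f x + (Q'`_0).[b x] = 0.
  have /eqP : Q.[(f x)%:P].[b x] = 0 by near: x.
  rewrite QE polyC0 subr0 hornerM hornerXn -polyC_exp hornerM hornerC mulf_eq0 expf_eq0.
  by rewrite (negPf fx0) andbF orbF {1}SE hornerMXaddC hornerD hornerM hornerC => /eqP.
have <- : q.[b x] * - S.[(f x)%:P].[b x] * G i x = \sum_j (A i j).[b x] * G j x.
  by move: i; near: x.
congr (_ * _); rewrite hornerM -!mulrA; congr (_ * _).
apply: (mulIf fx0); rewrite divfK // mulNr; apply/eqP.
by rewrite -addr_eq0 addrC E.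
Unshelve. all: by end_near. Qed.

End FiniteModules.
Arguments stab {K T} F b {I} G f.

(** The family is enlarged by the powers of [y] up to the exponent [e]. Multiplication by [y] shifts
    them, and the overflowing power [e.+1] is rewritten with coefficients that already preserve the
    span of [G]. *)
Lemma stab_adjoin (K : fieldType) (T : Type) {F : set_system T} {FF : Filter F}
  (b : T -> K) (I : finType) (G : I -> T -> K) (e : nat) (y : T -> K)
  (q : {poly K}) (r : 'I_e.+1 -> T -> K) :
  q != 0 -> (forall j, stab F b G (r j)) ->
  (\forall x \near F, q.[b x] * y x ^+ e.+1 = \sum_j r j x * y x ^+ j) ->
  let G' := fun (ij : I * 'I_e.+1) x => G ij.1 x * y x ^+ ij.2 in
  stab F b G' y /\ forall f, stab F b G f -> stab F b G' f.
Proof.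
move=> q0 rP yP G'.
have GP f : stab F b G f -> stab F b G' f.
  move=> [p p0 [A AP]]; exists p => //.
  exists (fun i j => if i.2 == j.2 then A i.1 j.1 else 0).
  apply: filterS AP => x AP [i j]; rewrite /G' /= mulrA AP mulr_suml.
  rewrite -(pair_bigA _ (fun k l => (if j == l then A i k else 0).[b x] * (G k x * y x ^+ l))) /=.
  apply: eq_bigr => k _; rewrite (bigD1 j) //= eqxx big1 ?addr0 ?mulrA // => l lj.
  by rewrite eq_sym (negPf lj) horner0 mul0r.
split => //.
have [p p0 [A AP]] := stab_common rP.
exists (p * q); first by rewrite mulf_neq0.
exists (fun i k => if i.2 == ord_max then A k.2 i.1 k.1
          else if (i.1 == k.1) && (i.2.+1 == k.2 :> nat) then p * q else 0).
apply: filterS2 AP yP => x AP yP [i j]; rewrite /G' /=.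
rewrite -(pair_bigA _ (fun k l => (if j == ord_max then A l i k
          else if (i == k) && (j.+1 == l :> nat) then p * q else 0).[b x] * (G k x * y x ^+ l))) /=.
have [->|jm] := eqVneq j ord_max.
  transitivity (p.[b x] * G i x * (q.[b x] * y x ^+ e.+1)).
    by rewrite hornerM exprS /=; ring.
  rewrite yP mulr_sumr exchange_big; apply: eq_bigr => l _.
  transitivity (p.[b x] * r l x * G i x * y x ^+ l); first by ring.
  by rewrite AP mulr_suml; apply: eq_bigr => k _; rewrite mulrA.
have je : (j.+1 < e.+1)%N.
  by rewrite ltn_neqAle ltn_ord andbT eqSS; apply: contra jm => /eqP h; apply/eqP/val_inj.
rewrite (bigD1 i) //= (bigD1 (Ordinal je)) //= !eqxx /= big1 ?addr0; last first.
  move=> l; rewrite -val_eqE /= eq_sym => /negPf ->.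
  by rewrite horner0 mul0r.
rewrite big1 ?addr0; last first.
  move=> k; rewrite eq_sym => /negPf ->; apply: big1 => l _.
  by rewrite horner0 mul0r.
by rewrite exprS; ring.
Qed.

Lemma near_ex (T : Type) (F : set_system T) (PF : ProperFilter F) (P : T -> Prop) :
  (\forall x \near F, P x) -> exists x, P x.
Proof. exact: filter_ex. Qed.
Arguments near_ex {T F PF P}.

(** The coefficients are polynomials in [s] rather than in [b], because over the base [u] the
    relations are still written in the line parameter; [stabV] makes the relation monic. The last
    clause records that the new generators are products of old ones and of [a], so that a
    multiplicative property such as differentiability is inherited. *)
Lemma stab_adjoin_relation (K : fieldType) (T : Type) (F : set_system T)
  (PF : ProperFilter F) (b : T -> K)
  (bP : forall q : {poly K}, q != 0 -> \forall x \near F, q.[b x] != 0)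
  (I : finType) (G : I -> T -> K) (G1 : exists i, \forall x \near F, G i x = 1)
  (s a : T -> K) (P : {poly {poly K}}) :
  stab F b G s -> (\forall x \near F, (lead_coef P).[s x] != 0) ->
  (\forall x \near F, P.[(a x)%:P].[s x] = 0) ->
  exists (I' : finType) (G' : I' -> T -> K),
    [/\ exists i, \forall x \near F, G' i x = 1,
        stab F b G' a, (forall f, stab F b G f -> stab F b G' f) &
        forall C : (T -> K) -> Prop, (forall f g, C f -> C g -> C (fun x => f x * g x)) ->
          C (fun=> 1) -> (forall i, C (G i)) -> C a -> forall i, C (G' i)].
Proof.
move=> sP lP PP.
have [e sz] : exists e, size P = e.+2.
  have [x [lx Px]] := near_ex (filterI lP PP).
  case E : (size P) => [|[|e]]; last by exists e.
    by move/eqP: E; rewrite size_poly_eq0 => /eqP P0; rewrite P0 lead_coef0 horner0 eqxx in lx.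
  have PC : P = (lead_coef P)%:P by rewrite [LHS]size1_polyC ?E // lead_coefE E.
  by move: Px lx; rewrite PC lead_coefC hornerC => ->; rewrite eqxx.
pose r (j : 'I_e.+1) x := - (P`_j).[s x] * (lead_coef P).[s x]^-1.
have cP (c : {poly K}) : stab F b G (fun x => c.[s x]).
  have : stab F b G (fun x => (c%:P).[(s x)%:P].[s x]) by exact: stab_biv.
  by apply: stab_near; apply: nearW => x; rewrite hornerC.
have G0 : \forall x \near F, exists i, G i x != 0.
  by have [j] := G1; apply: filterS => x Gj; exists j; rewrite Gj oner_neq0.
have rP j : stab F b G (r j).
  by apply: stabM; [exact: stabN | apply: stabV].
have yP : \forall x \near F, (1 : {poly K}).[b x] * a x ^+ e.+1 = \sum_j r j x * a x ^+ j.
  apply: filterS2 lP PP => x lx.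
  rewrite hornerC mul1r (horner_coef P) sz horner_sum big_ord_recr /=.
  rewrite -polyC_exp hornerM hornerC => /eqP; rewrite addrC addr_eq0 => /eqP E.
  have lE : P`_e.+1 = lead_coef P by rewrite lead_coefE sz.
  rewrite lE in E.
  apply: (mulfI lx); rewrite E -sumrN mulr_sumr; apply: eq_bigr => j _.
  by rewrite -polyC_exp hornerM hornerC /r; field.
have [aS GS] := stab_adjoin (oner_neq0 _) rP yP.
eexists; eexists; split; [| exact: aS | exact: GS |].
  have [i Gi] := G1; exists (i, ord0).
  by apply: filterS Gi => x /= ->; rewrite expr0 mulr1.
move=> C CM C1 CG Ca [i j] /=.
apply: (CM); first exact: CG.
elim: (nat_of_ord j) => [|k IH].
  by rewrite (_ : (fun x => _) = (fun=> 1)) //; apply/funext => x; rewrite expr0.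
rewrite (_ : (fun x => _) = (fun x => a x * a x ^+ k)); first exact: CM.
by apply/funext => x; rewrite exprS.
Qed.

Lemma stab_adjoin_relations (K : fieldType) (T : Type) (F : set_system T)
  (PF : ProperFilter F) (b : T -> K)
  (bP : forall q : {poly K}, q != 0 -> \forall x \near F, q.[b x] != 0)
  (I : finType) (G : I -> T -> K) (G1 : exists i, \forall x \near F, G i x = 1)
  (s : T -> K) (k : nat) (a : 'I_k -> T -> K) (P : 'I_k -> {poly {poly K}}) :
  stab F b G s -> (forall i, \forall x \near F, (lead_coef (P i)).[s x] != 0) ->
  (forall i, \forall x \near F, (P i).[(a i x)%:P].[s x] = 0) ->
  exists (I' : finType) (G' : I' -> T -> K),
    [/\ exists i, \forall x \near F, G' i x = 1,
        forall i, stab F b G' (a i), (forall f, stab F b G f -> stab F b G' f) &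
        forall C : (T -> K) -> Prop, (forall f g, C f -> C g -> C (fun x => f x * g x)) ->
          C (fun=> 1) -> (forall i, C (G i)) -> (forall i, C (a i)) -> forall i, C (G' i)].
Proof.
elim: k I G G1 a P => [|k IH] I G G1 a P sP lP PP.
  by exists I, G; split => // -[].
have [I' [G' [G'1 a0 GG' G'C]]] :=
  stab_adjoin_relation PF bP G1 sP (lP ord0) (PP ord0).
have [I2 [G2 [G21 a2 G'G2 G2C]]] :=
  IH I' G' G'1 (fun i => a (lift ord0 i)) (fun i => P (lift ord0 i)) (GG' _ sP)
    (fun i => lP _) (fun i => PP _).
exists I2, G2; split => //.
- by move=> i; have [j ->|->] := unliftP ord0 i; [exact: a2 | exact: G'G2].
- by move=> f fP; apply: G'G2; exact: GG'.
- move=> C CM C1 CG Ca; apply: G2C => // i; exact: G'C.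
Qed.

Definition independent (K : fieldType) (T : Type) (F : set_system T) (b : T -> K)
  (d : nat) (w : 'I_d -> T -> K) : Prop :=
  forall c : 'I_d -> {poly K},
    (\forall x \near F, \sum_j (c j).[b x] * w j x = 0) -> forall j, c j = 0.

(** A maximal independent subfamily of [G] is a basis of its span over the rational functions of
    [b]; independence makes the matrices of multiplications unique. Since each [w j] is some [G i],
    what is known of derivatives of generators applies to [w]. *)
Lemma stab_basis (K : fieldType) (T : Type) (F : set_system T)
  (PF : ProperFilter F) (b : T -> K)
  (bP : forall q : {poly K}, q != 0 -> \forall x \near F, q.[b x] != 0)
  (I : finType) (G : I -> T -> K) (G1 : exists i, \forall x \near F, G i x = 1) :
  exists (d : nat) (w : 'I_d -> T -> K),
    [/\ (0 < d)%N, independent F b w, (forall j, exists i, w j = G i),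
      (forall f, stab F b G f -> stab F b w f) &
      (forall f, stab F b G f -> exists2 s : {poly K}, s != 0 &
        exists c : 'I_d -> {poly K}, \forall x \near F,
          s.[b x] * f x = \sum_j (c j).[b x] * w j x)].
Proof.
pose Q (S : {set I}) := forall c : I -> {poly K},
   (\forall x \near F, \sum_(j in S) (c j).[b x] * G j x = 0) ->
   forall j, j \in S -> c j = 0.
pose P (S : {set I}) := `[< Q S >].
have [S /maxsetP[/asboolP SP Smax]] : {S | maxset P S}.
  by apply: ex_maxset; exists finset.set0; apply/asboolP => c _ j; rewrite inE.
have /fin_all_exists2[s s0 /fin_all_exists[C CP]] : forall i, exists2 s : {poly K}, s != 0 &
    exists c : I -> {poly K}, \forall x \near F,
      s.[b x] * G i x = \sum_(j in S) (c j).[b x] * G j x.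
  move=> i; have [iS|iS] := boolP (i \in S).
    exists 1; first exact: oner_neq0; exists (fun j => if j == i then 1 else 0).
    near=> x; rewrite (bigD1 i) //= eqxx hornerC big1 ?addr0 // => j /andP[_ /negPf ->].
    by rewrite horner0 mul0r.
  have : ~ Q (i |: S)%SET.
    move=> /asboolT Pi; have := Smax _ Pi (finset.subsetUr _ _) => E.
    by move: iS; rewrite -E !inE eqxx.
  move/existsNP => [c /not_implyP[cP /existsNP[j /not_implyP[jS /eqP cj]]]].
  have {}cP : \forall x \near F, (c i).[b x] * G i x = \sum_(j in S) (- c j).[b x] * G j x.
    apply: filterS cP => x; rewrite big_setU1 //= => /eqP; rewrite addr_eq0 => /eqP ->.
    by rewrite -sumrN; apply: eq_bigr => l _; rewrite hornerN mulNr.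
  exists (c i); last by exists (fun j => - c j).
  apply/eqP => ci0; move/negP: cj; apply; apply/eqP.
  move: jS; rewrite !inE => /orP[/eqP -> //|jS].
  apply: SP j jS; apply: filterS cP => x; rewrite ci0 horner0 mul0r => E.
  apply/oppr_inj; rewrite oppr0 [RHS]E -sumrN.
  by apply: eq_bigr => l _; rewrite hornerN mulNr.
pose w (j : 'I_#|S|) := G (enum_val j).
have wE (c : I -> {poly K}) x :
    \sum_(j in S) (c j).[b x] * G j x = \sum_j (c (enum_val j)).[b x] * w j x.
  by rewrite big_enum_val.
have wI : independent F b w.
  move=> c cP j.
  pose c' i := if i \in S =P true is ReflectT iS then c (enum_rank_in iS i) else 0.
  have c'E l : c' (enum_val l) = c l.
    rewrite /c'; case: eqP => [iS|]; last by rewrite enum_valP.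
    by rewrite enum_valK_in.
  rewrite -c'E; apply: SP; last exact: enum_valP.
  apply: filterS cP => x E; rewrite wE -[RHS]E.
  by apply: eq_bigr => l _; rewrite c'E.
have span f : stab F b G f -> forall i, exists2 s : {poly K}, s != 0 &
    exists c : 'I_#|S| -> {poly K}, \forall x \near F,
      s.[b x] * (f x * G i x) = \sum_j (c j).[b x] * w j x.
  move=> [q q0 [A AP]] i; exists (q * \prod_j s j).
    by rewrite mulf_neq0 //; apply/prodf_neq0.
  exists (fun j => \sum_k A i k * (\prod_(l | l != k) s l) * C k (enum_val j)).
  near=> x; rewrite hornerM.
  transitivity ((\prod_j s j).[b x] * (q.[b x] * f x * G i x)); first by ring.
  have -> : q.[b x] * f x * G i x = \sum_j (A i j).[b x] * G j x.
    by move: i; near: x; exact: AP.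
  rewrite mulr_sumr.
  transitivity (\sum_k (A i k).[b x] * (\prod_(l | l != k) s l).[b x] *
     \sum_j (C k (enum_val j)).[b x] * w j x).
    apply: eq_bigr => k _.
    have <- : (s k).[b x] * G k x = \sum_j (C k (enum_val j)).[b x] * w j x.
      by rewrite -wE; move: k; near: x; apply: filter_forall => k; exact: CP.
    by rewrite (bigD1 k) //= hornerM; ring.
  under eq_bigr => k _ do rewrite mulr_sumr.
  rewrite exchange_big; apply: eq_bigr => j _.
  rewrite horner_sum mulr_suml; apply: eq_bigr => k _.
  by rewrite !hornerM; ring.
have [i1 i1P] := G1.
exists #|S|, w; split => //.
- rewrite lt0n; apply/eqP => S0.
  have [s1 s10 [c cP]] := span _ (stabC 1) i1.
  have [x [[E1 E2] E3]] := near_ex (filterI (filterI cP i1P) (bP _ s10)).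
  move: E1 E3; rewrite E2 !mulr1 => ->; rewrite big1 ?eqxx // => j.
  by case: (j) => l lS; exfalso; move: lS; rewrite S0.
- by move=> j; exists (enum_val j).
- move=> f fP; have h := fun j : 'I_#|S| => span f fP (enum_val j).
  have /fin_all_exists2[t t0 /fin_all_exists[c cP]] := h.
  exists (\prod_j t j); first exact/prodf_neq0.
  exists (fun i j => (\prod_(l | l != i) t l) * c i j).
  near=> x => i.
  transitivity ((\prod_(l | l != i) t l).[b x] * ((t i).[b x] * (f x * w i x))).
    by rewrite (bigD1 i) //= hornerM; ring.
  have -> : (t i).[b x] * (f x * w i x) = \sum_j (c i j).[b x] * w j x.
    by move: i; near: x; apply: filter_forall => i; exact: cP.
  by rewrite mulr_sumr; apply: eq_bigr => j _; rewrite hornerM mulrA.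
- move=> f fP; have [t t0 [c cP]] := span f fP i1.
  exists t => //; exists c; apply: filterS2 i1P cP => x ->.
  by rewrite mulr1.
Unshelve. all: by end_near. Qed.

(** * Real germs *)

Local Open Scope classical_set_scope.

Section RealGerms.
Context {R : realType}.
Implicit Types (t : R) (f g : R -> R).

Lemma near_rightP t (P : R -> Prop) :
  (\forall x \near t^'+, P x) <-> exists2 e, 0 < e & forall x, t < x < t + e -> P x.
Proof.
split.
  rewrite near_withinE => /nbhs_ballP[e /= e0 eP]; exists e => // x /andP[tx xt].
  apply: eP => //=; rewrite /ball /= distrC gtr0_norm ?subr_gt0 //; lra.
move=> [e e0 eP]; rewrite near_withinE; near=> x => tx.
apply: eP; rewrite tx /=; near: x; apply: lt_nbhsl; lra.
Unshelve. all: by end_near. Qed.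

Lemma near_right_near t (P : R -> Prop) :
  (\forall x \near t^'+, P x) -> \forall x \near t^'+, \forall y \near x, P y.
Proof.
move=> /near_rightP[e e0 eP]; apply/near_rightP; exists e => // x /andP[tx xt].
have yt : \forall y \near x, - y < - t by apply: Nlt_nbhsl; rewrite ltrN2.
apply: filterS2 yt (lt_nbhsl xt) => y; rewrite ltrN2 => ty ye.
by apply: eP; rewrite ty.
Qed.

Lemma near_right_nonroot t (q : {poly R}) : q != 0 ->
  \forall x \near t^'+, q.[x] != 0.
Proof.
move=> q0; have [m [p p0 qE]] := multiplicity_XsubC q t.
have {}p0 : p.[t] != 0 by move: p0; rewrite q0.
have pP : \forall x \near t^'+, p.[x] != 0.
  apply: cvg_within; have := @continuous_horner R p t.
  by move=> /cvgr_neq0; apply.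
near=> x; rewrite qE hornerM horner_exp hornerXsubC mulf_neq0 ?expf_neq0 //.
  by near: x.
by rewrite subr_eq0 gt_eqF //; near: x; exact: nbhs_right_gt.
Unshelve. all: by end_near. Qed.

(* N/(N+M) only takes the values 0 and 1. *)
Lemma segment_alternative (N M : R -> R) (a b : R) : a <= b ->
  (forall x, a <= x <= b -> {for x, continuous N} /\ {for x, continuous M}) ->
  (forall x, a <= x <= b -> N x = 0 \/ M x = 0) ->
  (forall x, a <= x <= b -> N x + M x != 0) ->
  N a = 0 <-> N b = 0.
Proof.
move=> ab NMc NM0 NM.
pose phi x := N x / (N x + M x).
have phi01 x : a <= x <= b -> phi x = 0 /\ N x = 0 \/ phi x = 1 /\ N x != 0.
  move=> xab; rewrite /phi; have [N0|N0] := eqVneq (N x) 0.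
    by left; rewrite N0 mul0r.
  right; split => //; case: (NM0 x xab) => [E|->]; first by rewrite E eqxx in N0.
  by rewrite addr0 divff.
have phic : {within `[a, b], continuous phi}.
  apply: continuous_in_subspaceT => x; rewrite inE /= in_itv /= => xab.
  have [Nc Mc] := NMc x xab.
  apply: cvgM => //; apply: cvgV; first exact: NM.
  exact: cvgD.
have aab : a <= a <= b by rewrite lexx.
have bab : a <= b <= b by rewrite lexx andbT.
have half : Num.min (phi a) (phi b) <= 2^-1 <= Num.max (phi a) (phi b) -> False.
  move=> /(IVT ab phic)[c]; rewrite in_itv /= => cab.
  by case: (phi01 c cab) => -[-> _]; lra.
case: (phi01 a aab) (phi01 b bab) => -[pa Na] [] [pb Nb]; split => // E.
- by exfalso; apply: half; rewrite pa pb minEle maxEle; case: ifP => ?; lra.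
- by exfalso; apply: half; rewrite pa pb minEle maxEle; case: ifP => ?; lra.
- by rewrite E eqxx in Na.
- by rewrite E eqxx in Nb.
Qed.

Lemma continuous_biv (P : {poly {poly R}}) (f s : R -> R) (x : R) :
  {for x, continuous f} -> {for x, continuous s} ->
  {for x, continuous (fun y => P.[(f y)%:P].[s y])}.
Proof.
move=> fc sc; elim/poly_ind: P => [|P c IH].
  rewrite (_ : (fun y => _) = cst 0); last by apply/funext => y; rewrite !horner0.
  exact: cvg_cst.
rewrite (_ : (fun y => _) = (fun y => P.[(f y)%:P].[s y] * f y + c.[s y])); last first.
  by apply/funext => y; rewrite hornerMXaddC hornerD hornerM hornerC.
apply: cvgD; first exact: cvgM.
apply: (continuous_comp sc); exact: continuous_horner.
Qed.

(** Once powers of the unknown are removed from [Q], the constant coefficient of [P] is nonzero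
    close to [t] on its right. There [f] and [P(f)] never vanish together although their product is
    zero, and connectedness decides which of them is zero. *)
Lemma algebraic_germ_alternative t f (Q : {poly {poly R}}) : Q != 0 ->
  (\forall x \near t^'+, {for x, continuous f}) ->
  (\forall x \near t^'+, Q.[(f x)%:P].[x] = 0) ->
  (\forall x \near t^'+, f x = 0) \/ (\forall x \near t^'+, f x != 0).
Proof.
move=> Q0 fc QP; have [m [P P0 QE]] := multiplicity_XsubC Q 0.
have {}P0 : P`_0 != 0 by rewrite -horner_coef0; move: P0; rewrite Q0.
(* Squares, so that the sum vanishes only when both terms do. *)
pose N x := f x ^+ 2; pose M x := P.[(f x)%:P].[x] ^+ 2.
have : \forall x \near t^'+, [/\ {for x, continuous N} /\ {for x, continuous M},
    N x = 0 \/ M x = 0 & N x + M x != 0].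
  near=> x.
  have fx : {for x, continuous f} by near: x.
  have Px : (P`_0).[x] != 0 by near: x; exact: near_right_nonroot.
  have Qx : f x = 0 \/ P.[(f x)%:P].[x] = 0.
    have /eqP : Q.[(f x)%:P].[x] = 0 by near: x.
    rewrite QE polyC0 subr0 hornerM hornerXn -polyC_exp hornerM hornerC mulf_eq0 expf_eq0.
    by move=> /orP[/eqP ->|/andP[_ /eqP ->]]; [right|left].
  split.
  - split; rewrite /N /M.
      rewrite (_ : (fun x => _) = (fun x => f x * f x)); first exact: cvgM.
      by apply/funext => y; rewrite expr2.
    have h : {for x, continuous (fun y => P.[(f y)%:P].[y])}.
      by have := @continuous_biv P f id x fx; apply; exact: cvg_id.
    rewrite (_ : (fun x => _) = (fun x => P.[(f x)%:P].[x] * P.[(f x)%:P].[x])); first exact: cvgM.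
    by apply/funext => y; rewrite expr2.
  - by case: Qx => E; rewrite /N /M E expr0n; [left|right].
  - apply/eqP => /eqP; rewrite paddr_eq0 ?sqr_ge0 // !sqrf_eq0 => /andP[/eqP fx0].
    by rewrite fx0 polyC0 horner_coef0; apply/negP.
move=> /near_rightP[e e0 eP].
have h x y : t < x -> x <= y -> y < t + e -> N x = 0 <-> N y = 0.
  move=> tx xy yt.
  have zP z : x <= z <= y -> t < z < t + e by move=> /andP[xz zy]; apply/andP; split; lra.
  by apply: (segment_alternative (M := M)) => // z /zP/eP[].
pose x0 := t + e / 2.
have tx0 : t < x0 by rewrite ltrDl divr_gt0.
have x0t : x0 < t + e by rewrite /x0 ltrD2l ltr_pdivrMr // ltr_pMr // ltr1n.
have hx x : t < x < t + e -> N x0 = 0 <-> N x = 0.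
  move=> /andP[tx xt]; have [x0x|xx0] := leP x0 x; first exact: h.
  exact: iff_sym (h x x0 tx (ltW xx0) x0t).
have [N0|N0] := eqVneq (N x0) 0; [left|right]; apply/near_rightP; exists e => // x xt.
  by apply/eqP; rewrite -sqrf_eq0; apply/eqP/(hx x xt).1.
by apply: contra_neq N0 => fx; apply/(hx x xt).2; rewrite /N fx expr0n.
Unshelve. all: by end_near. Qed.

Lemma near_derive_eq t f g (df dg : R -> R) :
  (\forall x \near t^'+, f x = g x) ->
  (\forall x \near t^'+, is_derive (x : R) (1 : R) f (df x)) ->
  (\forall x \near t^'+, is_derive (x : R) (1 : R) g (dg x)) ->
  \forall x \near t^'+, df x = dg x.
Proof.
move=> /near_right_near fg fd gd; near=> x.
have fx : is_derive (x : R) (1 : R) f (df x) by near: x.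
have gx : is_derive (x : R) (1 : R) g (dg x) by near: x.
have fgx : \forall y \near x, f y = g y by near: x.
have := near_eq_is_derive fgx fx.
by move=> g'; rewrite -(@derive_val _ _ _ _ _ _ _ gx) -(@derive_val _ _ _ _ _ _ _ g').
Unshelve. all: by end_near. Qed.

(** The outer indeterminate stands for the function and the inner one for the variable;
    [map_poly deriv] and the formal derivative are the two partial derivatives. *)
Lemma is_derive_biv (P : {poly {poly R}}) f (x df : R) : is_derive (x : R) (1 : R) f df ->
  is_derive (x : R) (1 : R) (fun y => P.[(f y)%:P].[y])
    ((map_poly deriv P).[(f x)%:P].[x] + P^`().[(f x)%:P].[x] * df).
Proof.
move=> fd; elim/poly_ind: P => [|P c IH].
  rewrite (_ : (fun y => _) = cst 0); last by apply/funext => y; rewrite !horner0.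
  by rewrite raddf0 deriv0 !horner0 mul0r addr0; exact: is_derive_cst.
rewrite (_ : (fun y => _) = (fun y => P.[(f y)%:P].[y] * f y) + horner c); last first.
  by apply/funext => y; rewrite /= hornerMXaddC hornerD hornerM hornerC.
have cd := is_derive_poly c x.
have -> : map_poly deriv (P * 'X + c%:P) = map_poly deriv P * 'X + (c^`())%:P.
  apply/polyP => i; rewrite coef_map /= !coefD !coefMX !coefC derivD coef_map /=.
  by case: i => [|i] /=; rewrite ?derivC ?deriv0.
rewrite derivD derivC addr0 derivM derivX mulr1.
apply: is_derive_eq; rewrite !hornerE /= /GRing.scale /=.
ring.
Qed.
End RealGerms.

Section RealGerms.
Context {R : realType}.
Implicit Types (t : R) (f g : R -> R).

Lemma is_derive_continuous f (x df : R) :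
  is_derive (x : R) (1 : R) f df -> {for x, continuous f}.
Proof. by move=> [fd _]; apply/differentiable_continuous/derivable1_diffP. Qed.

Lemma is_derive_exprz f (x df : R) (n : int) : f x != 0 ->
  is_derive (x : R) (1 : R) f df ->
  is_derive (x : R) (1 : R) (fun y => f y ^ n) (f x ^ n * (n%:~R * (df / f x))).
Proof.
move=> fx0 fd.
have fX (m : nat) : is_derive (x : R) (1 : R) (fun y => f y ^+ m)
    (f x ^+ m * (m%:R * (df / f x))).
  elim: m => [|m IH].
    rewrite (_ : (fun y => _) = cst 1); last by apply/funext => y; rewrite expr0.
    by rewrite !mul0r mulr0; exact: is_derive_cst.
  rewrite (_ : (fun y => _) = f * (fun y => f y ^+ m)); last first.
    by apply/funext => y; rewrite exprS.
  apply: is_derive_eq; rewrite /GRing.scale /= exprS -natr1.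
  by field.
case: n => m; first exact: fX.
have gx0 : f x ^+ m.+1 != 0 by rewrite expf_neq0.
have := @is_deriveV R (fun y => f y ^+ m.+1) x _ 1 gx0 (fX m.+1).
move=> h; apply: (is_derive_eq h).
rewrite /exprz NegzE mulrNz /GRing.scale /= -pmulrn; field.
by rewrite fx0.
Qed.

Lemma is_derive_prod (I : Type) (r : seq I) (f : I -> R -> R) (w : I -> R) (x : R) :
  (forall i, is_derive (x : R) (1 : R) (f i) (f i x * w i)) ->
  is_derive (x : R) (1 : R) (fun y => \prod_(i <- r) f i y)
    (\prod_(i <- r) f i x * \sum_(i <- r) w i).
Proof.
move=> fd; elim: r => [|i r IH].
  rewrite (_ : (fun y => _) = cst 1); last by apply/funext => y; rewrite big_nil.
  by rewrite !big_nil mulr0; exact: is_derive_cst.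
rewrite (_ : (fun y => _) = f i * (fun y => \prod_(i <- r) f i y)); last first.
  by apply/funext => y; rewrite big_cons.
apply: is_derive_eq.
by rewrite !big_cons /GRing.scale /=; ring.
Qed.

Lemma stab_germ_alternative t (I : finType) (G : I -> R -> R) f :
  (exists i, \forall x \near t^'+, G i x = 1) -> stab t^'+ id G f ->
  (\forall x \near t^'+, {for x, continuous f}) ->
  (\forall x \near t^'+, f x = 0) \/ (\forall x \near t^'+, f x != 0).
Proof.
move=> [i i1] fP fc.
have [|Q Q0 QP] := stab_algebraic fP.
  by apply: filterS i1 => x E; exists i; rewrite E oner_neq0.
exact: algebraic_germ_alternative Q0 fc QP.
Qed.

Lemma stab_id t (I : finType) (G : I -> R -> R) : stab t^'+ id G id.
Proof.
have : stab t^'+ id G (fun x => 'X.[id x]) by exact: stab_poly.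
by apply: stab_near; apply: nearW => x; rewrite hornerX.
Qed.

(** As long as the partial derivative of [Q] in the unknown vanishes along [f], it is a nonzero
    relation of smaller degree and replaces [Q]. With the final relation, implicit differentiation
    writes [df] as a rational expression in [x] and [f]. *)
Lemma separable_relation t f (df : R -> R) (Q : {poly {poly R}}) :
  Q != 0 -> (\forall x \near t^'+, is_derive (x : R) (1 : R) f (df x)) ->
  (\forall x \near t^'+, Q.[(f x)%:P].[x] = 0) ->
  exists P : {poly {poly R}}, [/\ P != 0,
    \forall x \near t^'+, P.[(f x)%:P].[x] = 0 &
    \forall x \near t^'+, (deriv P).[(f x)%:P].[x] != 0].
Proof.
move=> + fd; have [n] := ubnP (size Q); elim: n Q => // n IH Q sQ Q0 QP.
have nz := @near_right_nonroot R t.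
have lQ : forall i : 'I_1, \forall x \near t^'+, (lead_coef Q).[x] != 0.
  by move=> _; apply: nz; rewrite lead_coef_eq0.
have G1 : exists i : unit, \forall x \near t^'+, (fun (_ : unit) (_ : R) => 1 : R) i x = 1.
  by exists tt; apply: nearW.
have [I [G [i1 fG _ _]]] := stab_adjoin_relations _ nz G1 (stab_id _ _) lQ (fun=> QP).
have fc : \forall x \near t^'+, {for x, continuous (fun y => (deriv Q).[(f y)%:P].[y])}.
  apply: filterS fd => x /is_derive_continuous fx.
  by have := @continuous_biv R (deriv Q) f id x fx; apply; exact: cvg_id.
have [Q'0|Q'0] := stab_germ_alternative i1 (stab_biv _ (stab_id _ _) (fG ord0)) fc.
  have Q'n0 : (deriv Q) != 0.
    apply/eqP => Qd; have QC : Q = (Q`_0)%:P.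
      apply/polyP => -[|i]; rewrite coefC //=; apply/polyP => j.
      have /polyP/(_ i)/polyP/(_ j) := Qd.
      by rewrite coef_deriv coefMn !coef0 => /eqP; rewrite mulrn_eq0 /= => /eqP.
    have Q00 : Q`_0 != 0 by apply: contraNneq Q0 => E; rewrite QC E polyC0.
    have [x [/eqP]] := near_ex (filterI QP (nz _ Q00)).
    by rewrite {1}QC hornerC => ->.
  apply: IH Q'n0 Q'0.
  by rewrite -ltnS (leq_trans _ sQ) // ltnS lt_size_deriv.
by exists Q.
Qed.
End RealGerms.

(** * Logarithmic derivatives of algebraic germs *)

Section LogDerivatives.
Context {R : realType} (t : R).
Notation F := (t^'+).
Notation der f df := (\forall x \near F, is_derive (x : R) (1 : R) f (df x)).

(* Over K(u) with D = (1/u') d/dx one has D u = 1, so Σ n_i v_i = 1/u has residue the dimension d at 0. *)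
Lemma residue_contradiction (u du : R -> R) (I : finType) (G : I -> R -> R)
  (k : nat) (a da : 'I_k -> R -> R) (c : 'I_k -> R) (n : 'I_k -> int) :
  der u du -> (\forall x \near F, du x != 0) -> (\forall x \near F, u x != 0) ->
  (forall q : {poly R}, q != 0 -> \forall x \near F, q.[u x] != 0) ->
  (exists i, \forall x \near F, G i x = 1) ->
  (forall i, exists dG, der (G i) dG /\ stab F u G dG) ->
  stab F u G du ->
  (forall i, der (a i) (da i)) -> (forall i, \forall x \near F, a i x != 0) ->
  (forall i, stab F u G (a i)) -> (forall i, stab F u G (da i)) ->
  (\forall x \near F, \sum_i c i * (da i x / a i x) = 0) ->
  (\forall x \near F, \sum_i (n i)%:~R * (da i x / a i x) = du x / u x) ->
  (forall x : 'I_k -> int, \sum_i c i * (x i)%:~R = 0 -> \sum_i n i * x i = 0) ->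
  False.
Proof.
move=> ud du0 u0 nz G1 Gd duP ad a0 aP daP cP nP cn.
have [d [w [d0 wI wG wS wspan]]] := stab_basis _ nz G1.
have Gex : \forall x \near F, exists i, G i x != 0.
  by have [i i1] := G1; apply: filterS i1 => x E; exists i; rewrite E oner_neq0.
have duV : stab F u G (fun x => (du x)^-1) by exact: stabV.
(* D w = Gm w / s *)
have /fin_all_exists[dw dwP] : forall j, exists dw, der (w j) dw /\ stab F u G dw.
  by move=> j; have [i ->] := wG j.
have DwP j : stab F u G (fun x => dw j x / du x) by apply: stabM duV; exact: (dwP j).2.
have /fin_all_exists2[sj sj0 /fin_all_exists[Gj GjP]] := fun j => wspan _ (DwP j).
pose s := \prod_j sj j.
have s0 : s != 0 by apply/prodf_neq0.
pose Gm : 'M[{poly R}]_d := \matrix_(i, j) ((\prod_(l | l != i) sj l) * Gj i j).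
pose ev x := @map_mx _ _ (horner_eval (u x)) d d.
pose W x : 'cV[R]_d := \col_j w j x; pose dW x : 'cV[R]_d := \col_j dw j x.
have evE x (M : 'M[{poly R}]_d) i : (ev x M *m W x) i 0 = \sum_j (M i j).[u x] * w j x.
  by rewrite mxE; apply: eq_bigr => j _; rewrite !mxE.
have GmP : \forall x \near F, ev x Gm *m W x = (s.[u x] / du x) *: dW x.
  near=> x; apply/colP => i; have dux : du x != 0 by near: x.
  rewrite evE !mxE.
  transitivity ((\prod_(l | l != i) sj l).[u x] * ((sj i).[u x] * (dw i x / du x))).
    have -> : (sj i).[u x] * (dw i x / du x) = \sum_j (Gj i j).[u x] * w j x.
      by move: i; near: x; apply: filter_forall.
    by rewrite mulr_sumr; apply: eq_bigr => j _; rewrite mxE hornerM mulrA.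
  by rewrite /s [in RHS](bigD1 i) //= hornerM; field.
(* multiplication by a_i is A_i / q_i *)
have /fin_all_exists2[q q0 /fin_all_exists[A' AP]] := fun i => wS _ (aP i).
pose A i : 'M[{poly R}]_d := \matrix_(j, l) A' i j l.
have evA i : \forall x \near F, ev x (A i) *m W x = ((q i).[u x] * a i x) *: W x.
  apply: filterS (AP i) => x E; apply/colP => j; rewrite evE !mxE E.
  by apply: eq_bigr => l _; rewrite mxE.
(* multiplication by v_i = D a_i / a_i is V_i / r *)
have vS i : stab F u w (fun x => da i x / (a i x * du x)).
  apply: wS; apply: stabM => //; apply: stabV => //; first exact: stabM.
  near=> x; rewrite mulf_neq0 //; near: x => //; exact: a0.
have [r r0 [V' VP]] := stab_common vS.
pose V i : 'M[{poly R}]_d := \matrix_(j, l) V' i j l.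
have evV : \forall x \near F, forall i,
    ev x (V i) *m W x = (r.[u x] * (da i x / (a i x * du x))) *: W x.
  apply: filterS VP => x E i; apply/colP => j; rewrite evE !mxE E.
  by apply: eq_bigr => l _; rewrite mxE.
(* Since the [w j] are independent over polynomials in [u], an identity of polynomial matrices can
   be verified on the column [W] after evaluation. *)
have wM (M N : 'M[{poly R}]_d) :
    (\forall x \near F, ev x M *m W x = ev x N *m W x) -> M = N.
  move=> MN; apply/matrixP => i j; apply/eqP; rewrite -subr_eq0; apply/eqP.
  move: j; apply: wI (fun j => M i j - N i j) _; apply: filterS MN => x /colP/(_ i)/eqP.
  rewrite !evE -subr_eq0 -sumrB => /eqP E; rewrite -[RHS]E.
  by apply: eq_bigr => j _; rewrite hornerD hornerN mulrBl.
have evM x (M N : 'M[{poly R}]_d) : ev x (M *m N) = ev x M *m ev x N by exact: map_mxM.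
have evD x (M N : 'M[{poly R}]_d) : ev x (M + N) = ev x M + ev x N by exact: map_mxD.
have evZ x (p : {poly R}) (M : 'M[{poly R}]_d) : ev x (p *: M) = p.[u x] *: ev x M.
  exact: map_mxZ.
(* Both sides of the identity defining [A' i], namely [q_i(u) a_i w_j = \sum_l A'_ijl(u) w_l], are
   differentiated. *)
have dA i : \forall x \near F,
    (((deriv (q i)).[u x] * du x) * a i x + (q i).[u x] * da i x) *: W x
      + ((q i).[u x] * a i x) *: dW x =
    du x *: (ev x (map_mx deriv (A i)) *m W x) + ev x (A i) *m dW x.
  suff H j : \forall x \near F,
    (((deriv (q i)).[u x] * du x) * a i x + (q i).[u x] * da i x) * w j x
      + ((q i).[u x] * a i x) * dw j x =
    \sum_l ((deriv (A' i j l)).[u x] * du x * w l x + (A' i j l).[u x] * dw l x).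
    apply: filterS (filter_forall _ H) => x Hx; apply/colP => j.
    rewrite !mxE Hx big_split /= mulr_sumr; congr (_ + _); apply: eq_bigr => l _; rewrite !mxE /horner_eval.
      by ring.
    by [].
  have pd (p : {poly R}) : der (fun x => p.[u x]) (fun x => (deriv p).[u x] * du x).
    apply: filterS ud => x udx.
    have := @is_derive1_comp R (horner p) u x _ _ (is_derive_poly p (u x)) udx.
    by [].
  apply: (@near_derive_eq R t (fun x => (q i).[u x] * a i x * w j x)
    (fun x => \sum_l (A' i j l).[u x] * w l x)).
  - by apply: filterS (AP i) => x; exact.
  - near=> x.
    have d1 : is_derive (x : R) (1 : R) (fun x => (q i).[u x]) ((deriv (q i)).[u x] * du x).
      by near: x; exact: pd.
    have d2 : is_derive (x : R) (1 : R) (a i) (da i x) by near: x; exact: ad.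
    have d3 : is_derive (x : R) (1 : R) (w j) (dw j x) by near: x; exact: (dwP j).1.
    have := is_deriveM (is_deriveM d1 d2) d3.
    move=> h; apply: (is_derive_eq h); rewrite ?fctE /GRing.scale /=; ring.
  - near=> x.
    rewrite (_ : (fun x => _) = \sum_l (fun x => (A' i j l).[u x] * w l x)); last first.
      by apply/funext => y; rewrite fct_sumE.
    apply: is_derive_sum => l.
    have d1 : is_derive (x : R) (1 : R) (fun x => (A' i j l).[u x]) ((deriv (A' i j l)).[u x] * du x).
      by move: l; near: x; apply: filter_forall => l; exact: pd.
    have d3 : is_derive (x : R) (1 : R) (w l) (dw l x).
      by move: l {d1}; near: x; apply: filter_forall => l; exact: (dwP l).1.
    have := is_deriveM d1 d3.
    by move=> h; apply: (is_derive_eq h); rewrite /GRing.scale /=; ring.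
(* The two expressions for the derivative of [a i] times [W] give the matrix identity of
   [trace_log_deriv]. *)
have main i : \tr (V i) * (\det (A i) * q i) =
    r * ((deriv (\det (A i))) * q i - (\det (A i) * deriv (q i)) *+ d).
  apply: (trace_log_deriv s0 (Gm := Gm)); apply: wM.
  near=> x.
  have dux : du x != 0 by near: x.
  have ax : a i x != 0 by near: x; exact: a0.
  have qx : (q i).[u x] != 0 by near: x; exact: nz.
  have evAx : ev x (A i) *m W x = ((q i).[u x] * a i x) *: W x by near: x; exact: evA.
  have evVx : ev x (V i) *m W x = (r.[u x] * (da i x / (a i x * du x))) *: W x.
    by near: x; apply: filterS evV => y; exact.
  have GmPx : ev x Gm *m W x = (s.[u x] / du x) *: dW x by near: x.
  have dAx : (((deriv (q i)).[u x] * du x) * a i x + (q i).[u x] * da i x) *: W x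
      + ((q i).[u x] * a i x) *: dW x =
    du x *: (ev x (map_mx deriv (A i)) *m W x) + ev x (A i) *m dW x by near: x; exact: dA.
  rewrite !evD !evZ !evM !mulmxDl -!scalemxAl -!mulmxA.
  rewrite evVx GmPx -!scalemxAr evAx -scalemxAr GmPx !scalerA !hornerM.
  move: dAx; move: (ev x (map_mx deriv (A i)) *m W x) (ev x (A i) *m dW x) => P1 P2.
  move: (W x) (dW x) => W1 dW1 dAx; apply/colP => j; have /colP/(_ j) := dAx.
  rewrite !mxE => E.
  have -> : P2 j 0 = ((deriv (q i)).[u x] * du x * a i x + (q i).[u x] * da i x) * W1 j 0
      + (q i).[u x] * a i x * dW1 j 0 - du x * P1 j 0.
    by rewrite E addrAC subrr add0r.
  by field; rewrite ?ax ?dux.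
(* A row [z] killed by [A i] gives [q_i(u) a_i \sum_j z_j w_j = 0], and independence forces
   [z = 0]. *)
have D0 i : \det (A i) != 0.
  apply/negP => /det0P[z z0 zA]; move/negP: z0; apply; apply/eqP/rowP => j; rewrite mxE.
  move: j; apply: wI (fun j => z 0 j) _; near=> x.
  have ax : a i x != 0 by near: x; exact: a0.
  have qx : (q i).[u x] != 0.
    by near: x; apply: nz.
  apply: (mulfI (mulf_neq0 qx ax)); rewrite mulr0 mulr_sumr.
  transitivity (\sum_j \sum_l (z 0 j * A' i j l).[u x] * w l x).
    apply: eq_bigr => j _; rewrite mulrCA.
    have -> : (q i).[u x] * a i x * w j x = \sum_l (A' i j l).[u x] * w l x.
      by move: j; near: x; exact: AP.
    by rewrite mulr_sumr; apply: eq_bigr => l _; rewrite hornerM mulrA.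
  rewrite exchange_big big1 // => l _ /=.
  rewrite -mulr_suml -horner_sum (_ : \sum_j _ = (z *m A i) 0 l).
    by rewrite zA mxE horner0 mul0r.
  by rewrite mxE; apply: eq_bigr => j _; rewrite mxE.
have [e eP] := residue_sum r0 D0 q0 main.
(* The trace is linear, so the real relation between the logarithmic derivatives passes to their
   integer residues. *)
have cx : \sum_i c i * (e i)%:~R = 0.
  apply: eP; rewrite scale0r.
  have -> : \sum_i c i *: \tr (V i) = \tr (\sum_i (c i)%:P *: V i).
    by rewrite raddf_sum; apply: eq_bigr => i _; rewrite /= mxtraceZ mul_polyC.
  suff -> : \sum_i (c i)%:P *: V i = 0 by rewrite mxtrace0 mulr0.
  apply: wM; near=> x; rewrite /ev map_mx0 mul0mx raddf_sum mulmx_suml /=.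
  under eq_bigr => i _.
    rewrite -/(ev x _) evZ -scalemxAl (_ : ev x (V i) *m W x = (r.[u x] * (da i x / (a i x * du x))) *: W x).
      rewrite scalerA hornerC; over.
    by move: i; near: x.
  rewrite -scaler_suml (_ : \sum_i _ = r.[u x] / du x * \sum_i c i * (da i x / a i x)).
    rewrite (_ : \sum_i c i * (da i x / a i x) = 0); last by near: x.
    by rewrite mulr0 scale0r.
  rewrite mulr_sumr; apply: eq_bigr => i _.
  have dux : du x != 0 by near: x.
  have ax : a i x != 0 by move: i; near: x; apply: filter_forall.
  by field; rewrite ax dux.
(* The combination with coefficients [n i] is multiplication by [1/u], whose trace [d/u] has residue
   [d]; by [cn] this must be zero, while [d] is positive. *)
have nx : \sum_i (n i)%:~R * (e i)%:~R = d%:R :> R.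
  apply: eP.
  have -> : \sum_i (n i)%:~R *: \tr (V i) = \tr (\sum_i ((n i)%:~R)%:P *: V i).
    by rewrite raddf_sum; apply: eq_bigr => i _; rewrite /= mxtraceZ mul_polyC.
  rewrite -mxtraceZ; suff -> : 'X *: (\sum_i ((n i)%:~R)%:P *: V i) = r%:M.
    by rewrite mxtrace_scalar scaler_nat.
  apply: wM; near=> x; rewrite {2}/ev map_scalar_mx mul_scalar_mx evZ -scalemxAl.
  rewrite {1}/ev raddf_sum mulmx_suml /=.
  under eq_bigr => i _.
    rewrite -/(ev x _) evZ -scalemxAl (_ : ev x (V i) *m W x = (r.[u x] * (da i x / (a i x * du x))) *: W x).
      rewrite scalerA hornerC; over.
    by move: i; near: x.
  rewrite -scaler_suml scalerA hornerX; congr (_ *: _).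
  have dux : du x != 0 by near: x.
  have ux : u x != 0 by near: x.
  rewrite (_ : \sum_i _ = r.[u x] / du x * \sum_i (n i)%:~R * (da i x / a i x)).
    rewrite (_ : \sum_i (n i)%:~R * (da i x / a i x) = du x / u x); last by near: x.
    by rewrite /horner_eval; field; rewrite dux ux.
  rewrite mulr_sumr; apply: eq_bigr => i _.
  have ax : a i x != 0 by move: i; near: x; apply: filter_forall.
  by field; rewrite ax dux.
have := cn _ cx; move/(congr1 (fun z : int => z%:~R : R)).
rewrite rmorph_sum /=; under eq_bigr => i _ do rewrite intrM.
by rewrite nx => /eqP; rewrite mulr0z pnatr_eq0 -leqn0 leqNgt d0.
Unshelve. all: by end_near. Qed.
End LogDerivatives.

Section GermRelation.
Context {R : realType} (t : R).
Notation F := (t^'+).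
Notation der f df := (\forall x \near F, is_derive (x : R) (1 : R) f (df x)).

Lemma continuous_bigsum (I : Type) (r : seq I) (f : I -> R -> R) (x : R) :
  (forall i, {for x, continuous (f i)}) ->
  {for x, continuous (fun y => \sum_(i <- r) f i y)}.
Proof.
move=> fc; elim: r => [|i r IH].
  by rewrite (_ : (fun y => _) = cst 0); [exact: cvg_cst|apply/funext => y; rewrite big_nil].
rewrite (_ : (fun y => _) = (fun y => f i y + \sum_(i <- r) f i y)); last first.
  by apply/funext => y; rewrite big_cons.
by apply: cvgD; [exact: fc|exact: IH].
Qed.

(** If the sum is not identically zero, it vanishes nowhere on the right of [t]. Then [u], the
    product of the [a i ^ n i], has a nonvanishing derivative and is transcendental, and all
    functions involved are algebraic over it; [residue_contradiction] excludes this. *)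
Lemma germ_log_derivative (k : nat) (a da : 'I_k -> R -> R)
  (P : 'I_k -> {poly {poly R}}) (c : 'I_k -> R) (n : 'I_k -> int) :
  (forall i, P i != 0) -> (forall i, der (a i) (da i)) ->
  (forall i, \forall x \near F, a i x != 0) ->
  (forall i, \forall x \near F, (P i).[(a i x)%:P].[x] = 0) ->
  (\forall x \near F, \sum_i c i * (da i x / a i x) = 0) ->
  (forall x : 'I_k -> int, \sum_i c i * (x i)%:~R = 0 -> \sum_i n i * x i = 0) ->
  \forall x \near F, \sum_i (n i)%:~R * (da i x / a i x) = 0.
Proof.
move=> P0 ad a0 aP cP cn.
have /fin_all_exists[Q QP] := fun i => separable_relation (P0 i) (ad i) (aP i).
have nz := @near_right_nonroot R t.
have lQ i : \forall x \near F, (lead_coef (Q i)).[x] != 0.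
  by apply: nz; rewrite lead_coef_eq0; have [] := QP i.
have Qa i : \forall x \near F, (Q i).[(a i x)%:P].[x] = 0 by have [] := QP i.
have Q'a i : \forall x \near F, (deriv (Q i)).[(a i x)%:P].[x] != 0 by have [] := QP i.
have one (b : R -> R) : exists i : unit, \forall x \near F, (fun (_ : unit) (_ : R) => 1 : R) i x = 1.
  by exists tt; apply: nearW.
have [I [G [i1 aG _ _]]] := stab_adjoin_relations _ nz (one id) (stab_id _ _) lQ Qa.
(* Implicit differentiation of the separable relation. This expression agrees with [da i] near [t],
   and its continuity and its compatibility with [stab] can be read off. *)
pose e i x := - (map_poly deriv (Q i)).[(a i x)%:P].[x] / (deriv (Q i)).[(a i x)%:P].[x].
have dae : \forall x \near F, forall i, da i x = e i x.
  apply: filter_forall => i.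
  have h : der (fun x => (Q i).[(a i x)%:P].[x]) (fun x =>
      (map_poly deriv (Q i)).[(a i x)%:P].[x] + (deriv (Q i)).[(a i x)%:P].[x] * da i x).
    by apply: filterS (ad i) => x; exact: is_derive_biv.
  have h0 : der (cst 0 : R -> R) (fun=> 0) by apply: nearW => x; exact: is_derive_cst.
  apply: filterS2 (near_derive_eq (Qa i) h h0) (Q'a i) => x E Q0.
  apply: (mulfI Q0); move/eqP: E; rewrite addrC addr_eq0 => /eqP ->.
  by rewrite /e mulrC divfK.
have cont_id (x : R) : {for x, continuous (@id R)} by exact: cvg_id.
have ac i : \forall x \near F, {for x, continuous (a i)}.
  by apply: filterS (ad i) => x; exact: is_derive_continuous.
have ec i : \forall x \near F, {for x, continuous (e i)}.
  apply: filterS2 (ac i) (Q'a i) => x axc Q0; apply: cvgM; last apply: cvgV => //.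
    by apply: cvgN; have := @continuous_biv R (map_poly deriv (Q i)) (a i) id x axc; apply.
  by have := @continuous_biv R (deriv (Q i)) (a i) id x axc; apply.
pose v x := \sum_i (n i)%:~R * (e i x / a i x).
pose u x := \prod_i a i x ^ n i.
have ane (I' : finType) (G' : I' -> R -> R) : (exists i, \forall x \near F, G' i x = 1) ->
    \forall x \near F, exists i, G' i x != 0.
  by move=> [i h]; apply: filterS h => x E; exists i; rewrite E oner_neq0.
have stab_exprz (b : R -> R) (I' : finType) (G' : I' -> R -> R) (f : R -> R) (m : int) :
    (forall q : {poly R}, q != 0 -> \forall x \near F, q.[b x] != 0) ->
    (exists i, \forall x \near F, G' i x = 1) -> (\forall x \near F, f x != 0) ->
    stab F b G' f -> stab F b G' (fun x => f x ^ m).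
  move=> nzb G1 f0 fP; case: m => m; first exact: stabX.
  apply: stabV => //; [exact: stabX | exact: ane |].
  by apply: filterS f0 => x; exact: expf_neq0.
have eS (b : R -> R) (I' : finType) (G' : I' -> R -> R) i :
    (forall q : {poly R}, q != 0 -> \forall x \near F, q.[b x] != 0) ->
    (exists i, \forall x \near F, G' i x = 1) -> stab F b G' id ->
    stab F b G' (a i) -> stab F b G' (e i).
  move=> nzb G1 idP aiP; apply: stabM; first exact/stabN/stab_biv.
  by apply: stabV => //; [exact: stab_biv | exact: ane].
have vS (b : R -> R) (I' : finType) (G' : I' -> R -> R) :
    (forall q : {poly R}, q != 0 -> \forall x \near F, q.[b x] != 0) ->
    (exists i, \forall x \near F, G' i x = 1) -> stab F b G' id ->
    (forall i, stab F b G' (a i)) -> stab F b G' v.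
  move=> nzb G1 idP aiP; apply: stab_sum => i _; apply: stabM; first exact: stabC.
  apply: stabM; first exact: eS.
  by apply: stabV => //; exact: ane.
have uS (b : R -> R) (I' : finType) (G' : I' -> R -> R) :
    (forall q : {poly R}, q != 0 -> \forall x \near F, q.[b x] != 0) ->
    (exists i, \forall x \near F, G' i x = 1) ->
    (forall i, stab F b G' (a i)) -> stab F b G' u.
  by move=> nzb G1 aiP; apply: stab_prod => i _; exact: stab_exprz.
have vc : \forall x \near F, {for x, continuous v}.
  apply: filterS3 (filter_forall _ a0) (filter_forall _ ec) (filter_forall _ ac) => x ax0 ecx acx.
  apply: continuous_bigsum => i; apply: cvgM; first exact: cvg_cst.
  by apply: cvgM; [exact: ecx|apply: cvgV => //; exact: acx].
have [v0|v0] := stab_germ_alternative i1 (vS _ _ _ nz i1 (stab_id _ _) aG) vc.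
  apply: filterS2 dae v0 => x E v0; rewrite -[RHS]v0.
  by apply: eq_bigr => i _; rewrite E.
exfalso.
have u0 : \forall x \near F, u x != 0.
  by apply: filterS (filter_forall _ a0) => x ax0; apply/prodf_neq0 => i _; exact: expfz_neq0.
have ud : der u (fun x => u x * v x).
  apply: filterS3 (filter_forall _ a0) (filter_forall _ ad) dae => x ax0 adx dax.
  by apply: is_derive_prod => i; rewrite -dax; exact: is_derive_exprz.
have uc : \forall x \near F, {for x, continuous u}.
  by apply: filterS ud => x; exact: is_derive_continuous.
(* Transcendence of [u]: if [q(u)] were identically zero, then so would be [q'(u) u'], hence
   [q'(u)], with [q'] nonzero of lower degree. *)
have nzu (q : {poly R}) : q != 0 -> \forall x \near F, q.[u x] != 0.
  have [m] := ubnP (size q); elim: m q => // m IH q sq q0.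
  have qu : stab F id G (fun x => q.[u x]).
    have : stab F id G (fun x => (map_poly polyC q).[(u x)%:P].[u x]).
      by apply: stab_biv; exact: uS.
    by apply: stab_near; apply: nearW => x; rewrite (horner_map polyC) hornerC.
  have quc : \forall x \near F, {for x, continuous (fun y => q.[u y])}.
    by apply: filterS uc => x ux; apply: (continuous_comp ux); exact: continuous_horner.
  have [qu0|//] := stab_germ_alternative i1 qu quc.
  have dqu : der (fun x => q.[u x]) (fun x => (deriv q).[u x] * (u x * v x)).
    apply: filterS ud => x udx.
    exact: (@is_derive1_comp R (horner q) u x _ _ (is_derive_poly q (u x)) udx).
  have d0 : der (cst 0 : R -> R) (fun=> 0) by apply: nearW => x; exact: is_derive_cst.
  have q'0 : \forall x \near F, (deriv q).[u x] = 0.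
    near=> x; have ux : u x != 0 by near: x.
    have vx : v x != 0 by near: x.
    have /eqP : (deriv q).[u x] * (u x * v x) = 0 by near: x; exact: near_derive_eq qu0 dqu d0.
    by rewrite mulf_eq0 (negPf (mulf_neq0 ux vx)) orbF => /eqP.
  have q'n0 : deriv q != 0.
    apply/eqP => qd; have qC : q = (q`_0)%:P.
      apply/polyP => -[|i]; rewrite coefC //=.
      have /polyP/(_ i) := qd.
      by rewrite coef_deriv coef0 => /eqP; rewrite mulrn_eq0 /= => /eqP.
    have [x /eqP] := near_ex qu0.
    rewrite qC hornerC; apply/negP; apply: contraNneq q0 => E.
    by rewrite qC E.
  have h := IH _ (leq_trans (lt_size_deriv q0) sq) q'n0.
  by have [x [/eqP]] := near_ex (filterI h q'0).
(* The relation making [u] algebraic over [x] is read with its variables exchanged and makes [x]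
   algebraic over [u]; by [nzu] its new leading coefficient does not vanish. *)
have [U U0 UP] := stab_algebraic (uS _ _ _ nz i1 aG) (ane _ _ i1).
pose U' := swapXY U.
have U'0 : U' != 0 by rewrite swapXY_eq0.
have uS1 : stab F u (fun (_ : unit) (_ : R) => 1) u.
  have : stab F u (fun (_ : unit) (_ : R) => 1) (fun x => 'X.[u x]) by exact: stab_poly.
  by apply: stab_near; apply: nearW => x; rewrite hornerX.
have lU : \forall x \near F, (lead_coef U').[u x] != 0.
  by apply: nzu; rewrite lead_coef_eq0.
have U'P : \forall x \near F, U'.[(id x)%:P].[u x] = 0.
  by apply: filterS UP => x; rewrite /U' horner2_swapXY.
have [I1 [G1 [i11 idG1 _ CG1]]] := stab_adjoin_relation _ nzu (one u) uS1 lU U'P.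
have [I2 [G2 [i12 aG2 GG2 CG2]]] := stab_adjoin_relations _ nzu i11 idG1 lQ Qa.
have idG2 : stab F u G2 id by exact: GG2.
(* The functions preserving the span together with some derivative. The class is multiplicative and
   contains [x] and the [a i], hence every generator of the second tower; this makes [D] act on the
   span. *)
pose C f := stab F u G2 f /\ exists df, der f df /\ stab F u G2 df.
have dC f g : C f -> C g -> C (fun x => f x * g x).
  move=> [fS [df [fd dfS]]] [gS [dg [gd dgS]]]; split; first exact: stabM.
  exists (fun x => f x * dg x + g x * df x); split; last by apply: stabD; exact: stabM.
  by apply: filterS2 fd gd => x fx gx; apply: is_derive_eq.
have C1 : C (fun=> 1).
  split; first exact: stabC.
  by exists (fun=> 0); split; [apply: nearW => x; exact: is_derive_cst | exact: stabC].
have Cid : C id.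
  split => //; exists (fun=> 1); split; last exact: stabC.
  by apply: nearW => x; exact: is_derive_id.
have daS i : stab F u G2 (da i).
  apply: stab_near (eS u I2 G2 i nzu i12 idG2 (aG2 i)).
  by apply: filterS dae => x ->.
have Ca i : C (a i) by split => //; exists (da i).
have CG i : C (G2 i) by apply: CG2 => // j; exact: CG1.
have uvS : stab F u G2 (fun x => u x * v x) by apply: stabM; [exact: uS | exact: vS].
apply: (@residue_contradiction R t u (fun x => u x * v x) I2 G2 k a da c n) => //.
- by apply: filterS2 u0 v0 => x; exact: mulf_neq0.
- by move=> i; have [_] := CG i.
- apply: filterS2 dae u0 => x E ux; rewrite mulrC mulKf //.
  by apply: eq_bigr => i _; rewrite E.
Unshelve. all: by end_near. Qed.
End GermRelation.

Section IntervalRelation.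
Context {R : realType}.

Lemma derive_right_cst (f : R -> R) (x d : R) :
  is_derive (x : R) (1 : R) f d -> (\forall y \near x^'+, f y = f x) -> d = 0.
Proof.
move=> /is_derive1_caratheodory[g [gE gc gx]] fx.
apply: contrapT => /eqP d0; rewrite -gx in d0.
have gr : \forall y \near x^'+, g y != 0.
  by apply: cvg_within; move: gc d0 => /cvgr_neq0; apply.
have [y [[E gy0] xy]] := near_ex (filterI (filterI fx gr) (nbhs_right_gt x)).
have := gE y; rewrite E subrr => /esym/eqP.
by rewrite mulf_eq0 (negPf gy0) subr_eq0 gt_eqF.
Qed.

Lemma derive_cst (f df : R -> R) (x y : R) : x <= y ->
  (forall z, x <= z <= y -> is_derive (z : R) (1 : R) f (df z)) ->
  (forall z, x < z < y -> df z = 0) -> f x = f y.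
Proof.
rewrite le_eqVlt => /predU1P[-> //|xy] fd df0.
have [||c] := @MVT R f df x y xy.
- by move=> z; rewrite in_itv /= => /andP[xz zy]; apply: fd; rewrite !ltW.
- apply: continuous_in_subspaceT => z; rewrite inE /= in_itv /= => zxy.
  exact: is_derive_continuous (fd z zxy).
rewrite in_itv /= => cxy; rewrite df0 // mul0r => /eqP.
by rewrite subr_eq0 => /eqP.
Qed.

(** At each point [x] the germ statement makes the derivative [v] vanish only on the right of [x].
    The sum of logarithms is then constant to the right of [x], and its differentiability at [x]
    gives [v x = 0] at the point itself. *)
Lemma multiplicative_relation (al be : R) (k : nat) (a da : 'I_k -> R -> R)
  (P : 'I_k -> {poly {poly R}}) (c : 'I_k -> R) (n : 'I_k -> int) :
  (forall i, P i != 0) ->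
  (forall i x, al < x < be -> is_derive (x : R) (1 : R) (a i) (da i x)) ->
  (forall i x, al < x < be -> 0 < a i x) ->
  (forall i x, al < x < be -> (P i).[(a i x)%:P].[x] = 0) ->
  (forall x, al < x < be -> \sum_i c i * ln (a i x) = 0) ->
  (forall x : 'I_k -> int, \sum_i c i * (x i)%:~R = 0 -> \sum_i n i * x i = 0) ->
  forall x y, al < x < be -> al < y < be ->
    \sum_i (n i)%:~R * ln (a i x) = \sum_i (n i)%:~R * ln (a i y).
Proof.
move=> P0 ad a0 aP cP cn.
have Ld (w : 'I_k -> R) x : al < x < be -> is_derive (x : R) (1 : R)
    (fun z => \sum_i w i * ln (a i z)) (\sum_i w i * (da i x / a i x)).
  move=> xab.
  rewrite (_ : (fun z => _) = \sum_i (fun z => w i * ln (a i z))); last first.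
    by apply/funext => z; rewrite fct_sumE.
  apply: is_derive_sum => i.
  have lnd : is_derive (x : R) (1 : R) (fun z => ln (a i z)) ((a i x)^-1 * da i x).
    have lna := is_derive1_ln (a0 i x xab); have adx := ad i x xab.
    exact: is_derive1_comp.
  have cd : is_derive (x : R) (1 : R) (cst (w i) : R -> R) 0 by exact: is_derive_cst.
  have h := is_deriveM cd lnd.
  apply: (is_derive_eq h); rewrite ?fctE /GRing.scale /=.
  by rewrite mulr0 addr0 [X in _ * X]mulrC.
pose v x := \sum_i (n i)%:~R * (da i x / a i x).
have near_itv x : al < x < be -> \forall y \near x^'+, al < y < be.
  move=> /andP[ax xb]; apply: filterS2 (nbhs_right_gt x) (nbhs_right_lt xb) => y xy ->.
  by rewrite (lt_trans ax xy).
have v0 x : al < x < be -> v x = 0.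
  move=> xab; have xn := near_itv x xab.
  have c0 z : al < z < be -> \sum_i c i * (da i z / a i z) = 0.
    move=> zab; apply: (derive_right_cst (Ld c z zab)).
    by apply: filterS (near_itv z zab) => y yab; rewrite !cP.
  have : \forall y \near x^'+, v y = 0.
    apply: (germ_log_derivative (P := P) (c := c)) => //.
    - by move=> i; apply: filterS xn => z; exact: ad.
    - by move=> i; apply: filterS xn => z zab; rewrite gt_eqF // a0.
    - by move=> i; apply: filterS xn => z; exact: aP.
    - by apply: filterS xn => z; exact: c0.
  move=> /(filterI xn)/near_rightP[e e0 eP].
  apply: (derive_right_cst (Ld (fun i => (n i)%:~R) x xab)).
  apply/near_rightP; exists e => // y yx; have [yab _] := eP y yx.
  have zP z : x <= z <= y -> al < z < be.
    move: xab yab => /andP[ax xb] /andP[ay yb] /andP[xz zy].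
    by rewrite (lt_le_trans ax xz) (le_lt_trans zy yb).
  apply/esym; apply: (@derive_cst (fun z => \sum_i (n i)%:~R * ln (a i z)) v).
  - by move: yx => /andP[/ltW].
  - by move=> z /zP; exact: Ld.
  - move=> z /andP[xz zy]; have [|//] := eP z.
    by move: yx => /andP[_ ye]; rewrite xz (lt_trans zy ye).
have H x y : al < x < be -> al < y < be -> x <= y ->
    \sum_i (n i)%:~R * ln (a i x) = \sum_i (n i)%:~R * ln (a i y).
  move=> /andP[ax xb] /andP[ay yb] xy.
  apply: (@derive_cst (fun z => \sum_i (n i)%:~R * ln (a i z)) v) => // z /andP[xz zy].
    by apply: Ld; rewrite (lt_le_trans ax xz) (le_lt_trans zy yb).
  by apply: v0; rewrite (lt_trans ax xz) (lt_trans zy yb).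
move=> x y xab yab; have [xy|yx] := leP x y; first exact: H.
by apply/esym/H => //; exact: ltW.
Qed.
End IntervalRelation.

(** * Complex functions along real lines *)

Section Lines.
Context {R : realType}.
Local Notation C := R[i].
Local Notation K := (C : numFieldType).

Definition cderivable (f : R -> C) (s : R) : Prop :=
  (exists d, is_derive (s : R) (1 : R) (fun x => complex.Re (f x)) d) /\
  (exists d, is_derive (s : R) (1 : R) (fun x => complex.Im (f x)) d).

Lemma complex_pos (e : C) : 0 < e -> exists2 d : R, 0 < d & e = d%:C%C.
Proof.
case: e => x y; rewrite ltcE /= => /andP[/eqP -> x0]; by exists x.
Qed.

(** The complex difference quotient in the direction [a] is restricted to real increments and
    projected by [Re] and [Im], which are real-linear and bounded by the modulus. Holomorphy enters
    the proof in this form. *)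
Lemma holomorphic_line (n N : nat) (U : set 'rV[C]_n) (F : 'rV[C]_n -> 'rV[C]_N)
  (p a : 'rV[C]_n) (s : R) (k : 'I_N) :
  holomorphic_on U F -> U (p + s%:C%C *: a) ->
  cderivable (fun x => F (p + x%:C%C *: a) ord0 k) s.
Proof.
move=> Fhol Us; set z := p + s%:C%C *: a.
have := Fhol z Us => /(@diff_derivable _ _ _ _ _ a).
rewrite /derivable => /cvg_ex[/= l Fl].
have Fk : (fun h : K => (h^-1 * (F (h *: a + z) ord0 k - F z ord0 k)) : K) @ (0 : K)^' --> (l ord0 k : K).
  have := @cvg_comp _ _ _ _ (fun M : 'rV[K]_N => M ord0 k) _ _ _ Fl (@coord_continuous _ _ _ ord0 k l).
  rewrite /comp /=; under eq_fun => h do rewrite !mxE.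
  by [].
have key : forall e : R, 0 < e -> exists2 d : R, 0 < d & forall h : R, `|h| < d -> h != 0 ->
    `|l ord0 k - (h%:C%C)^-1 * (F (p + (h + s)%:C%C *: a) ord0 k - F z ord0 k)| < e%:C%C.
  move=> e e0; have ec0 : 0 < e%:C%C :> C by rewrite ltcR.
  move/cvgrPdist_lt: Fk => /(_ _ ec0); rewrite near_withinE => /nbhs_ballP[d /= /complex_pos[d' d0 ->] dP].
  exists d' => // h hd h0.
  have := dP (h%:C%C); rewrite /ball /= sub0r normrN normc_def /= expr0n addr0 sqrtr_sqr ltcR => /(_ hd).
  have hc0 : h%:C%C != 0 :> C by rewrite (inj_eq (@complexI R)).
  move=> /(_ hc0); rewrite /z (_ : _ *: a + _ = p + (h + s)%:C%C *: a) //.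
  by rewrite rmorphD scalerDl addrCA.
have proj (pr : C -> R) : (forall x y, pr (x - y) = pr x - pr y) ->
    (forall (x : R) y, pr (x%:C%C * y) = x * pr y) ->
    (forall x, (`|pr x|)%:C%C <= `|x| :> C) ->
    exists d, is_derive (s : R) (1 : R) (fun x : R => pr (F (p + x%:C%C *: a) ord0 k)) d.
  move=> prB prZ prn; exists (pr (l ord0 k)).
  have cv : (fun h : R => h^-1 *: (pr (F (p + (h *: 1 + s)%:C%C *: a) ord0 k) - pr (F z ord0 k)))
      @ (0 : R)^' --> (pr (l ord0 k) : R).
    apply/cvgrPdist_lt => e /key[d d0 dP]; rewrite near_withinE; apply/nbhs_ballP.
    exists d => // h; rewrite /ball /= sub0r normrN => hd h0.
    rewrite -ltcR; apply: le_lt_trans (dP h hd h0).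
    rewrite -prB /GRing.scale /= mulr1 -prZ -prB fmorphV; exact: prn.
  apply: DeriveDef; first by apply/cvg_ex; exists (pr (l ord0 k)); exact: cv.
  by apply/cvg_lim => //; exact: cv.
split; apply: proj.
- by move=> [x1 x2] [y1 y2].
- by move=> x [y1 y2] /=; rewrite mul0r subr0.
- exact: normc_ge_Re.
- by move=> [x1 x2] [y1 y2].
- by move=> x [y1 y2] /=; rewrite mul0r addr0.
- by move=> x; rewrite normc_def lecR -sqrtr_sqr ler_wsqrtr // lerDr sqr_ge0.
Qed.
End Lines.

(** * Polynomials along lines and the geometry of the ball *)

Section MpolyEval.
Variable K : fieldType.

Lemma poly_nonroot (q : {poly K}) (f : nat -> K) : injective f -> q != 0 ->
  exists k, q.[f k] != 0.
Proof.
move=> finj q0; apply: contrapT => /forallNP h.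
have := max_poly_roots (rs := [seq f k | k <- iota 0 (size q)]) q0.
rewrite map_inj_uniq ?iota_uniq // size_map size_iota ltnn => /(_ _ isT) H.
suff : false by []. apply: H.
by apply/allP => _ /mapP[k _ ->]; apply/negPn/negP; exact: h.
Qed.

Lemma meval_muni n (p : mpoly.mpoly n.+1 K) (v : 'I_n.+1 -> K) :
  mpoly.meval v p =
  (map_poly (mpoly.meval (fun i => v (widen_ord (leqnSn n) i))) (mpoly.muni p)).[v ord_max].
Proof.
set v' := fun i => _.
elim/mpoly_ring_ind: p => [c|i|p q IHp IHq|p q IHp IHq].
- by rewrite mpoly.mevalC mpoly.muniC map_polyC /= hornerC mpoly.mevalC.
- rewrite mpoly.mevalXU; have [j ->|->] := unliftP ord_max i.
    have -> : lift ord_max j = widen_ord (leqnSn n) j.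
      by apply/val_inj; rewrite /= /bump leqNgt ltn_ord.
    by rewrite -mpoly.mnmwiden1 -mpoly.mwidenX muni_widen map_polyC /= hornerC mpoly.mevalXU.
  by rewrite muni_max map_polyX hornerX.
- rewrite mpoly.mevalD mpoly.muniD rmorphD hornerD; congr (_ + _); [exact: IHp|exact: IHq].
- rewrite mpoly.mevalM mpoly.muniM rmorphM hornerM; congr (_ * _); [exact: IHp|exact: IHq].
Qed.

Lemma mpoly_line (k : nat) (p : mpoly.mpoly k K) (u w : 'I_k -> K) :
  exists q : {poly K}, forall t, mpoly.meval (fun i => u i + t * w i) p = q.[t].
Proof.
elim/mpoly_ring_ind: p => [c|i|p q [P IHp] [Q IHq]|p q [P IHp] [Q IHq]].
- by exists c%:P => t; rewrite mpoly.mevalC hornerC.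
- by exists ((u i)%:P + (w i)%:P * 'X) => t; rewrite mpoly.mevalXU !hornerE /= mulrC.
- by exists (P + Q) => t; rewrite mpoly.mevalD hornerD IHp IHq.
- by exists (P * Q) => t; rewrite mpoly.mevalM hornerM IHp IHq.
Qed.

Lemma evalzw_line (n : nat) (P : mpoly.mpoly n.+1 K) (p a : 'rV[K]_n) :
  exists Q : {poly {poly K}}, forall t w, evalzw P (p + t *: a) w = Q.[w%:P].[t].
Proof.
elim/mpoly_ring_ind: P => [c|i|P Q [P' IHp] [Q' IHq]|P Q [P' IHp] [Q' IHq]].
- by exists (c%:P)%:P => t w; rewrite /evalzw mpoly.mevalC !hornerC.
- have [j E|E] := unliftP ord_max i.
    exists ((p ord0 j)%:P + (a ord0 j)%:P * 'X)%:P => t w.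
    rewrite /evalzw mpoly.mevalXU E liftK hornerC !mxE !hornerE; ring.
  by exists 'X => t w; rewrite /evalzw mpoly.mevalXU E unlift_none hornerX hornerC.
- exists (P' + Q') => t w; rewrite /evalzw mpoly.mevalD !hornerD -IHp -IHq //.
- exists (P' * Q') => t w; rewrite /evalzw mpoly.mevalM !hornerM -IHp -IHq //.
Qed.
End MpolyEval.

Lemma mpoly_nonzero_point (K : numFieldType) n (p : mpoly.mpoly n K) : p != 0 ->
  exists v, mpoly.meval v p != 0.
Proof.
elim: n p => [|n IH] p p0.
  exists (fun=> 0); move: p0; rewrite (mpoly.nvar0_mpolyC p) mpoly.mevalC.
  by apply: contraNneq => ->; rewrite mpoly.mpolyC0.
have : mpoly.muni p != 0.
  apply: contraNneq p0 => h; apply/eqP/(can_inj (@muniK K n)).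
  by rewrite mpoly.muni0.
move=> q0; have /IH[v' lv] : lead_coef (mpoly.muni p) != 0 by rewrite lead_coef_eq0.
have h0 : map_poly (mpoly.meval v') (mpoly.muni p) != 0.
  apply/eqP => /polyP/(_ (size (mpoly.muni p)).-1).
  by rewrite coef_map coef0 => /eqP; apply/negP.
have [|k hk] := poly_nonroot (f := fun k => k%:R) _ h0; first exact: mulrIn (oner_neq0 _).
exists (fun i => if unlift ord_max i is Some j then v' j else k%:R).
rewrite meval_muni unlift_none.
rewrite (_ : map_poly _ _ = map_poly (mpoly.meval v') (mpoly.muni p)) //.
apply: eq_map_poly => r /=; apply: mpoly.meval_eq => j.
have -> : widen_ord (leqnSn n) j = lift ord_max j.
  by apply/val_inj; rewrite /= /bump leqNgt ltn_ord.
by rewrite liftK.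
Qed.

Section Ball.
Context {R : realType}.
Local Notation C := R[i].

Lemma sqnormE (N : nat) (v : 'rV[C]_N) :
  sqnorm v = \sum_(k < N) (complex.Re (v ord0 k) ^+ 2 + complex.Im (v ord0 k) ^+ 2).
Proof.
rewrite /sqnorm raddf_sum; apply: eq_bigr => k _.
by rewrite normc_def -rmorphXn /= sqr_sqrtr // addr_ge0 // sqr_ge0.
Qed.

Lemma sqnorm_line (N : nat) (p a : 'rV[C]_N) :
  exists q : {poly R}, forall s, sqnorm (p + s%:C%C *: a) = q.[s].
Proof.
exists (\sum_(k < N) (((complex.Re (p ord0 k))%:P + (complex.Re (a ord0 k))%:P * 'X) ^+ 2
  + ((complex.Im (p ord0 k))%:P + (complex.Im (a ord0 k))%:P * 'X) ^+ 2)) => s.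
rewrite sqnormE horner_sum; apply: eq_bigr => k _.
rewrite !mxE !hornerE; case: (p ord0 k) (a ord0 k) => [x1 x2] [y1 y2] /=.
by rewrite !mul0r subr0 addr0 !(mulrC s).
Qed.

Lemma cball0 n (rho : R) : 0 < rho -> cball n rho 0.
Proof.
move=> r0; rewrite /cball /= sqnormE big1 ?exprn_gt0 // => k _.
by rewrite mxE /= expr0n addr0.
Qed.

Lemma cball_conj n (rho : R) (z : 'rV[C]_n) : cball n rho z -> cball n rho (vconj z).
Proof.
rewrite /cball /= !sqnormE; congr (_ < _); apply: eq_bigr => k _.
by rewrite mxE; case: (z ord0 k) => x y /=; rewrite sqrrN.
Qed.

Lemma vconjK n (z : 'rV[C]_n) : vconj (vconj z) = z.
Proof. by apply/rowP => k; rewrite !mxE conjCK. Qed.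

Lemma cball_convex n (rho : R) (p q : 'rV[C]_n) (s : R) : 0 <= s <= 1 ->
  cball n rho p -> cball n rho q -> cball n rho (p + s%:C%C *: (q - p)).
Proof.
move=> /andP[s0 s1]; rewrite /cball /= => pB qB.
have h : sqnorm (p + s%:C%C *: (q - p)) <= (1 - s) * sqnorm p + s * sqnorm q.
  rewrite !sqnormE !mulr_sumr -big_split; apply: ler_sum => k _ /=.
  rewrite !mxE; case: (p ord0 k) (q ord0 k) => [x1 x2] [y1 y2] /=.
  rewrite !mul0r subr0 addr0 -subr_ge0.
  have -> : (1 - s) * (x1 ^+ 2 + x2 ^+ 2) + s * (y1 ^+ 2 + y2 ^+ 2) -
    ((x1 + s * (y1 - x1)) ^+ 2 + (x2 + s * (y2 - x2)) ^+ 2) =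
    s * (1 - s) * ((y1 - x1) ^+ 2 + (y2 - x2) ^+ 2) by ring.
  by rewrite mulr_ge0 ?mulr_ge0 ?subr_ge0 ?addr_ge0 ?sqr_ge0.
apply: le_lt_trans h _.
have [->|sn0] := eqVneq s 0; first by rewrite subr0 mul1r mul0r addr0.
have sp : 0 < s by rewrite lt_def sn0.
have -> : rho ^+ 2 = (1 - s) * rho ^+ 2 + s * rho ^+ 2 by ring.
by apply: ler_ltD; rewrite ?ltr_pM2l // ler_wpM2l ?subr_ge0 // ltW.
Qed.

Lemma cball_line_near n (rho : R) (p a : 'rV[C]_n) (s : R) :
  cball n rho (p + s%:C%C *: a) -> \forall x \near s, cball n rho (p + x%:C%C *: a).
Proof.
have [q qE] := sqnorm_line p a.
rewrite /cball /= qE => qs; near=> x; rewrite qE; near: x.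
have := @continuous_horner R q s => /cvgr_lt; exact.
Unshelve. all: by end_near. Qed.

Lemma horner_real (q : {poly C}) (s : R) :
  q.[s%:C%C] = Complex (map_poly (@complex.Re R) q).[s] (map_poly (@complex.Im R) q).[s].
Proof.
elim/poly_ind: q => [|q c IH].
  by rewrite !raddf0 !horner0.
have reE (f : {additive C -> R}) : map_poly f (q * 'X + c%:P) = map_poly f q * 'X + (f c)%:P.
  apply/polyP => i; rewrite coef_map !coefD !coefMX !coefC coef_map raddfD /=.
  by case: i => [|i] /=; rewrite ?raddf0.
rewrite !hornerE IH (reE (@complex.Re R)) (reE (@complex.Im R)) !hornerE /=.
case: c {reE} => x y; apply/eqP; rewrite eq_complex /=.
by apply/andP; split; apply/eqP; ring.
Qed.

Lemma near_right_complex_nonroot (t : R) (q : {poly C}) : q != 0 ->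
  \forall s \near t^'+, q.[s%:C%C] != 0.
Proof.
move=> q0; have [h|h] := eqVneq (map_poly (@complex.Re R) q) 0; last first.
  apply: filterS (near_right_nonroot t h) => s; apply: contraNneq.
  by rewrite horner_real => -[-> _].
have h' : map_poly (@complex.Im R) q != 0.
  apply: contraNneq q0 => h'; apply/eqP/polyP => i; rewrite coef0.
  have := congr1 (fun r : {poly R} => r`_i) h; have := congr1 (fun r : {poly R} => r`_i) h'.
  rewrite !coef_map !coef0 /=.
  by case: (q`_i) => x y /= -> ->.
apply: filterS (near_right_nonroot t h') => s; apply: contraNneq.
by rewrite horner_real => -[_ ->].
Qed.
End Ball.

(** * Polarization *)

Lemma roots_seq (K : fieldType) (q : {poly K}) : q != 0 ->
  exists s : seq K, forall x, q.[x] = 0 -> x \in s.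
Proof.
have [n] := ubnP (size q); elim: n q => // n IH q sq q0.
have [[x /eqP/factor_theorem[r rE]]|nroot] := pselect (exists x, q.[x] = 0); last first.
  by exists [::] => x qx; case: nroot; exists x.
have r0 : r != 0 by apply: contraNneq q0 => r0; rewrite rE r0 mul0r.
have [|s sP] := IH r _ r0.
  by rewrite -ltnS (leq_trans _ sq) // ltnS rE size_Mmonic ?monicXsubC // size_XsubC addn2.
exists (x :: s) => y; rewrite rE hornerM hornerXsubC inE => /eqP.
by rewrite mulf_eq0 subr_eq0 => /orP[/eqP/sP -> //|->]; rewrite ?orbT.
Qed.

(** The filter on which the module calculus runs over a complex parameter: properties hold on [D] up
    to finitely many points, so a nonzero polynomial is eventually nonzero. *)
Definition cofinite_in (T : eqType) (D : set T) : set_system T :=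
  [set A | exists s : seq T, forall x, D x -> x \notin s -> A x].

Lemma cofinite_in_filter (T : eqType) (D : set T) : Filter (cofinite_in D).
Proof.
split.
- by exists [::].
- move=> A B [s sP] [r rP]; exists (s ++ r) => x Dx; rewrite mem_cat => /norP[xs xr].
  by split; [exact: sP|exact: rP].
- by move=> A B AB [s sP]; exists s => x Dx xs; apply: AB; exact: sP.
Qed.

Lemma cofinite_in_proper (T : eqType) (D : set T) :
  (forall s : seq T, exists2 x, D x & x \notin s) -> ProperFilter (cofinite_in D).
Proof.
move=> Dinf; split; last exact: cofinite_in_filter.
by move=> [s sP]; have [x Dx xs] := Dinf s; exact: sP xs.
Qed.

Section ComplexContinuity.
Context {R : realType}.
Local Notation C := R[i].

Definition ccont (f : R -> C) (s : R) : Prop :=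
  {for s, continuous (fun x => complex.Re (f x))} /\
  {for s, continuous (fun x => complex.Im (f x))}.

Lemma ccont_cst (c : C) s : ccont (fun=> c) s.
Proof. by split; exact: cvg_cst. Qed.

Lemma ccontD f g s : ccont f s -> ccont g s -> ccont (fun x => f x + g x) s.
Proof.
move=> [f1 f2] [g1 g2]; split.
- rewrite (_ : (fun x => _) = (fun x => complex.Re (f x) + complex.Re (g x))); first exact: cvgD.
  by apply/funext => x; rewrite raddfD.
- rewrite (_ : (fun x => _) = (fun x => complex.Im (f x) + complex.Im (g x))); first exact: cvgD.
  by apply/funext => x; rewrite raddfD.
Qed.

Lemma ccontM f g s : ccont f s -> ccont g s -> ccont (fun x => f x * g x) s.
Proof.
move=> [f1 f2] [g1 g2]; split.
- rewrite (_ : (fun x => _) = (fun x => complex.Re (f x) * complex.Re (g x)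
     - complex.Im (f x) * complex.Im (g x))).
    by apply: cvgB; exact: cvgM.
  by apply/funext => x; case: (f x) (g x) => [? ?] [? ?].
- rewrite (_ : (fun x => _) = (fun x => complex.Re (f x) * complex.Im (g x)
     + complex.Im (f x) * complex.Re (g x))).
    by apply: cvgD; exact: cvgM.
  by apply/funext => x; case: (f x) (g x) => [? ?] [? ?].
Qed.

Lemma ccont_conj f s : ccont f s -> ccont (fun x => (f x)^*) s.
Proof.
move=> [f1 f2]; split.
- rewrite (_ : (fun x => _) = (fun x => complex.Re (f x))) //.
  by apply/funext => x; case: (f x).
- rewrite (_ : (fun x => _) = (fun x => - complex.Im (f x))); first exact: cvgN.
  by apply/funext => x; case: (f x).
Qed.

Lemma ccont_real s : ccont (fun x => x%:C%C) s.
Proof. by split; [exact: cvg_id|exact: cvg_cst]. Qed.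

Lemma ccont_poly (q : {poly C}) f s : ccont f s -> ccont (fun x => q.[f x]) s.
Proof.
move=> fc; elim/poly_ind: q => [|q c IH].
  rewrite (_ : (fun x => _) = (fun=> 0)); first exact: ccont_cst.
  by apply/funext => x; rewrite horner0.
rewrite (_ : (fun x => _) = (fun x => q.[f x] * f x + c)).
  by apply: ccontD; [exact: ccontM|exact: ccont_cst].
by apply/funext => x; rewrite hornerMXaddC.
Qed.

Lemma ccont_biv (P : {poly {poly C}}) f g s : ccont f s -> ccont g s ->
  ccont (fun x => P.[(f x)%:P].[g x]) s.
Proof.
move=> fc gc; elim/poly_ind: P => [|P c IH].
  rewrite (_ : (fun x => _) = (fun=> 0)); first exact: ccont_cst.
  by apply/funext => x; rewrite !horner0.
rewrite (_ : (fun x => _) = (fun x => P.[(f x)%:P].[g x] * f x + c.[g x])).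
  by apply: ccontD; [exact: ccontM|exact: ccont_poly].
by apply/funext => x; rewrite hornerMXaddC hornerD hornerM hornerC.
Qed.

Definition sqmod (c : C) : R := complex.Re c ^+ 2 + complex.Im c ^+ 2.

Lemma sqmod_ge0 c : 0 <= sqmod c.
Proof. by rewrite addr_ge0 ?sqr_ge0. Qed.

Lemma sqmod_eq0 c : (sqmod c == 0) = (c == 0).
Proof. by rewrite /sqmod paddr_eq0 ?sqr_ge0 // !sqrf_eq0 eq_complex. Qed.

Lemma ccont_sqmod f s : ccont f s -> {for s, continuous (fun x => sqmod (f x))}.
Proof.
move=> [f1 f2]; rewrite /sqmod.
rewrite (_ : (fun x => _) = (fun x => complex.Re (f x) * complex.Re (f x)
     + complex.Im (f x) * complex.Im (f x))).
  by apply: cvgD; exact: cvgM.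
by apply/funext => x; rewrite !expr2.
Qed.

Lemma ccont_right_zero f s : ccont f s -> (\forall x \near s^'+, f x = 0) -> f s = 0.
Proof.
move=> /ccont_sqmod fc f0; apply/eqP; rewrite -sqmod_eq0; apply/negP => /negP fs.
have h : \forall x \near s^'+, sqmod (f x) != 0.
  by apply: cvg_within; move: fc => /cvgr_neq0; apply.
have [x [fx]] := near_ex (filterI f0 h).
by rewrite fx sqmod_eq0 eqxx.
Qed.

(* Continuation of the zero of an algebraic function along a segment free of branch points. *)
Lemma algebraic_zero_segment (g tau : R -> C) (P : {poly {poly C}}) :
  (forall s, 0 <= s <= 1 -> ccont g s /\ ccont tau s) ->
  (forall s, 0 <= s < 1 -> g s = 0 \/ P.[(g s)%:P].[tau s] = 0) ->
  (forall s, 0 <= s < 1 -> (P`_0).[tau s] != 0) ->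
  g 0 = 0 -> g 1 = 0.
Proof.
move=> gt gP P0 g0.
have gb b : 0 <= b < 1 -> g b = 0.
  move=> /andP[b0 b1]; apply/eqP; rewrite -sqmod_eq0; apply/eqP.
  have [|||h _] := @segment_alternative R (fun s => sqmod (g s))
    (fun s => sqmod P.[(g s)%:P].[tau s]) 0 b b0.
  - move=> s /andP[s0 sb]; have s01 : 0 <= s <= 1 by rewrite s0 (le_trans sb (ltW b1)).
    have [gc tc] := gt s s01; split; first exact: ccont_sqmod.
    by apply: ccont_sqmod; exact: ccont_biv.
  - move=> s /andP[s0 sb]; have s01 : 0 <= s < 1 by rewrite s0 (le_lt_trans sb b1).
    by case: (gP s s01) => ->; [left|right]; apply/eqP; rewrite sqmod_eq0.
  - move=> s /andP[s0 sb]; have s01 : 0 <= s < 1 by rewrite s0 (le_lt_trans sb b1).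
    apply/eqP => /eqP; rewrite paddr_eq0 ?sqmod_ge0 // !sqmod_eq0 => /andP[/eqP gs].
    by rewrite gs polyC0 horner_coef0 (negPf (P0 s s01)).
  - by apply: h; rewrite g0; apply/eqP; rewrite sqmod_eq0.
(* The constant coefficient may vanish at the endpoint 1, where the value comes from continuity; the
   segment is reversed to work with a right neighbourhood of 0. *)
have g1c : ccont (fun s => g (1 - s)) 0.
  have [|[g1 g2] _] := gt 1; first by rewrite ler01 lexx.
  have c1 : {for 0, continuous (fun s : R => 1 - s)}.
    by apply: cvgB; [exact: cvg_cst|exact: cvg_id].
  split.
  - have h := @continuous_comp R R R (fun s : R => 1 - s) (fun x => complex.Re (g x)) 0 c1.
    by apply: h; rewrite subr0.
  - have h := @continuous_comp R R R (fun s : R => 1 - s) (fun x => complex.Im (g x)) 0 c1.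
    by apply: h; rewrite subr0.
suff : g (1 - 0) = 0 by rewrite subr0.
apply: (ccont_right_zero g1c); apply/near_rightP; exists 1 => // s /andP[s0 s1].
by apply: gb; apply/andP; split; lra.
Qed.

End ComplexContinuity.

Lemma injective_notin (T : eqType) (f : nat -> T) (s : seq T) : injective f ->
  exists k, f k \notin s.
Proof.
move=> finj; apply: contrapT => /forallNP h.
have : uniq [seq f k | k <- iota 0 (size s).+1] by rewrite map_inj_uniq ?iota_uniq.
move=> /uniq_leq_size H; have := H s; rewrite size_map size_iota ltnn => H'.
suff : false by []. apply: H' => _ /mapP[k _ ->]; exact/negPn/negP.
Qed.

Lemma inj_inv_nat (R : numFieldType) (e : R) : 0 < e -> injective (fun k => e / k.+2%:R).
Proof.
move=> e0 j k /(mulfI (lt0r_neq0 e0)) /invr_inj /eqP.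
by rewrite eqr_nat => /eqP [].
Qed.

Lemma small_notin (R : numFieldType) (s : seq R) (e : R) : 0 < e ->
  exists k, e / k.+2%:R \notin s.
Proof. by move=> e0; apply: (injective_notin s); exact: inj_inv_nat. Qed.

Lemma line_affine (K : comNzRingType) (n : nat) (p a : 'rV[K]_n) (t s u : K) :
  p + (t + s * (u - t)) *: a = (p + t *: a) + s *: ((p + u *: a) - (p + t *: a)).
Proof. by apply/rowP => j; rewrite !mxE; ring. Qed.

Section Polarization.
Context {R : realType} {n : nat} (rho : R) {I : finType}.
Local Notation C := R[i].
Variables (X : I -> 'rV[C]_n -> C) (P : I -> mpoly.mpoly n.+1 C).

(** The algebra generated by coordinates, the functions [X i] of [z] and their conjugates in [xi].
    It is given syntactically so that regularity along lines, algebraicity and polynomiality follow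
    by induction. *)
Inductive sesqui : ('rV[C]_n -> 'rV[C]_n -> C) -> Prop :=
| sesqui_cst c : sesqui (fun _ _ => c)
| sesqui_fst j : sesqui (fun z _ => z ord0 j)
| sesqui_snd j : sesqui (fun _ xi => xi ord0 j)
| sesqui_hol i : sesqui (fun z _ => X i z)
| sesqui_anti i : sesqui (fun _ xi => (X i (vconj xi))^*)
| sesqui_add f g : sesqui f -> sesqui g -> sesqui (fun z xi => f z xi + g z xi)
| sesqui_mul f g : sesqui f -> sesqui g -> sesqui (fun z xi => f z xi * g z xi).

Lemma sesqui_ext f g : (forall z xi, f z xi = g z xi) -> sesqui f -> sesqui g.
Proof. by move=> fg; rewrite (_ : f = g) //; apply/funext => z; apply/funext => xi. Qed.

Lemma sesqui_sum (J : Type) (r : seq J) (f : J -> 'rV[C]_n -> 'rV[C]_n -> C) :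
  (forall j, sesqui (f j)) -> sesqui (fun z xi => \sum_(j <- r) f j z xi).
Proof.
move=> fP; elim: r => [|j r IH].
  by apply: sesqui_ext (sesqui_cst 0) => z xi; rewrite big_nil.
by apply: sesqui_ext (sesqui_add (fP j) IH) => z xi; rewrite big_cons.
Qed.

Lemma sesqui_prod (J : Type) (r : seq J) (f : J -> 'rV[C]_n -> 'rV[C]_n -> C) :
  (forall j, sesqui (f j)) -> sesqui (fun z xi => \prod_(j <- r) f j z xi).
Proof.
move=> fP; elim: r => [|j r IH].
  by apply: sesqui_ext (sesqui_cst 1) => z xi; rewrite big_nil.
by apply: sesqui_ext (sesqui_mul (fP j) IH) => z xi; rewrite big_cons.
Qed.

Lemma sesqui_exp f k : sesqui f -> sesqui (fun z xi => f z xi ^+ k).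
Proof.
move=> fP; elim: k => [|k IH]; first by apply: sesqui_ext (sesqui_cst 1).
by apply: sesqui_ext (sesqui_mul fP IH) => z xi; rewrite exprS.
Qed.

Lemma sesqui_eval2 (h : mpoly.mpoly (n + n) C) : sesqui (eval2 h).
Proof.
rewrite /eval2; elim/mpoly_ring_ind: h => [c|i|p q IHp IHq|p q IHp IHq].
- by apply: sesqui_ext (sesqui_cst c) => z xi; rewrite mpoly.mevalC.
- case E : (fintype.split i) => [j|j].
    by apply: sesqui_ext (sesqui_fst j) => z xi; rewrite mpoly.mevalXU E.
  by apply: sesqui_ext (sesqui_snd j) => z xi; rewrite mpoly.mevalXU E.
- by apply: sesqui_ext (sesqui_add IHp IHq) => z xi; rewrite mpoly.mevalD.
- by apply: sesqui_ext (sesqui_mul IHp IHq) => z xi; rewrite mpoly.mevalM.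
Qed.

Lemma vconj_line (q b : 'rV[C]_n) (t : C) : vconj (q + t *: b) = vconj q + t^* *: vconj b.
Proof. by apply/rowP => k; rewrite !mxE rmorphD rmorphM. Qed.

Lemma conj_real (x : R) : (x%:C%C)^* = x%:C%C :> C.
Proof. by apply/eqP; rewrite eq_complex /= oppr0 !eqxx. Qed.

Hypothesis Xline : forall i p a s, cball n rho (p + s%:C%C *: a) ->
  ccont (fun x => X i (p + x%:C%C *: a)) s.
Hypothesis P0 : forall i, P i != 0.
Hypothesis PX : forall i z, cball n rho z -> evalzw (P i) z (X i z) = 0.

Lemma sesqui_ccont f : sesqui f -> forall p a q b s,
  cball n rho (p + s%:C%C *: a) -> cball n rho (vconj (q + s%:C%C *: b)) ->
  ccont (fun x => f (p + x%:C%C *: a) (q + x%:C%C *: b)) s.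
Proof.
move=> fP p a q b s pB qB.
have coord (u w : 'rV[C]_n) j : ccont (fun x => (u + x%:C%C *: w) ord0 j) s.
  rewrite (_ : (fun x => _) = (fun x => u ord0 j + x%:C%C * w ord0 j)).
    by apply: ccontD; [exact: ccont_cst|apply: ccontM; [exact: ccont_real|exact: ccont_cst]].
  by apply/funext => x; rewrite !mxE.
elim: fP => [c|j|j|i|i|g h _ IHg _ IHh|g h _ IHg _ IHh].
- exact: ccont_cst.
- exact: coord.
- exact: coord.
- exact: Xline.
- apply: ccont_conj; rewrite (_ : (fun x => _) = (fun x => X i (vconj q + x%:C%C *: vconj b))).
    by apply: Xline; move: qB; rewrite vconj_line conj_real.
  by apply/funext => x; rewrite vconj_line conj_real.
- exact: ccontD.
- exact: ccontM.
Qed.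

(** At such a point no relation [P i] degenerates, so its restriction to any line through the point
    is a nonzero polynomial. *)
Definition generic_point (z : 'rV[C]_n) : Prop := forall i, exists w, evalzw (P i) z w != 0.

Lemma near_generic (z : 'rV[C]_n) :
  exists z' : 'rV[C]_n, \forall s \near (0 : R)^'+, generic_point (z + s%:C%C *: (z' - z)).
Proof.
have Pi0 : \prod_i P i != 0 by apply/prodf_neq0.
have [v hv] := mpoly_nonzero_point Pi0.
pose z' : 'rV[C]_n := \row_j v (lift ord_max j); pose w := v ord_max.
have hz' i : evalzw (P i) z' w != 0.
  have -> : evalzw (P i) z' w = mpoly.meval v (P i).
    apply: mpoly.meval_eq => j.
    by have [k ->|->] := unliftP ord_max j; rewrite ?liftK ?unlift_none // mxE.
  by move: hv; rewrite (bigD1 i) //= mpoly.mevalM mulf_eq0 negb_or => /andP[].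
exists z'.
have /fin_all_exists[Q QP] := fun i => evalzw_line (P i) z (z' - z).
have h i : \forall s \near (0 : R)^'+, (Q i).[w%:P].[s%:C%C] != 0.
  apply: near_right_complex_nonroot; apply: contraNneq (hz' i) => E.
  have -> : z' = z + 1 *: (z' - z) by rewrite scale1r addrC subrK.
  by rewrite QP E horner0.
by apply: filterS (filter_forall _ h) => s hs i; exists w; rewrite QP.
Qed.

Lemma cofinite_roots (D : set C) (q : {poly C}) : q != 0 ->
  \forall x \near cofinite_in D, q.[x] != 0.
Proof.
move=> /roots_seq[s sP]; exists s => x _; apply: contraNneq; exact: sP.
Qed.

(** The second argument is the conjugate of [p + t^* *: a], so real [t] give diagonal points. Along
    the line, [X i] satisfies the restricted [P i] and the conjugated function satisfies the
    relation with conjugated coefficients; both are adjoined to one module, where every [sesqui]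
    expression is algebraic. *)
Lemma sesqui_algebraic f (t0 : C) (p a : 'rV[C]_n) : sesqui f -> generic_point (p + t0 *: a) ->
  cball n rho p ->
  exists2 Q : {poly {poly C}}, Q != 0 & forall t,
    cball n rho (p + t *: a) -> cball n rho (p + t^* *: a) ->
    Q.[(f (p + t *: a) (vconj p + t *: vconj a))%:P].[t] = 0.
Proof.
move=> fP gen pB.
pose D : set C := [set t | cball n rho (p + t *: a) /\ cball n rho (p + t^* *: a)].
have PF : ProperFilter (cofinite_in D).
  apply: cofinite_in_proper => s.
  have h0 : cball n rho (p + (0 : R)%:C%C *: a) by rewrite scale0r addr0.
  have /nbhs_ballP[e /= e0 eB] := cball_line_near h0.
  pose g (k : nat) : C := (e / k.+2%:R)%:C%C.
  have ginj : injective g by move=> j k /complexI; exact: inj_inv_nat.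
  have [k kP] := injective_notin s ginj.
  have gB : cball n rho (p + g k *: a).
    apply: eB; rewrite /ball /= sub0r normrN gtr0_norm ?divr_gt0 //.
    by rewrite ltr_pdivrMr // ltr_pMr // ltr1n.
  exists (g k); last exact: kP.
  by split; [exact: gB|rewrite conj_real; exact: gB].
have FF : Filter (cofinite_in D) := cofinite_in_filter D.
have nz := @cofinite_roots D.
have Dn : \forall t \near cofinite_in D, D t by exists [::] => x.
have /fin_all_exists[Q QP] := fun i => evalzw_line (P i) p a.
have Q0 i : Q i != 0.
  have [w] := gen i; rewrite QP; apply: contraNneq => ->.
  by rewrite !horner0.
pose Qc i : {poly {poly C}} := map_poly (map_poly Num.conj) (Q i).
have QcE i w t : (Qc i).[(w^*)%:P].[t^*] = ((Q i).[w%:P].[t])^*.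
  rewrite -(horner_map Num.conj) -(map_polyC Num.conj) /Qc.
  by rewrite -(horner_map (map_poly Num.conj)).
have Qc0 i : Qc i != 0.
  apply: contraNneq (Q0 i) => E; apply/eqP/polyP => j; apply/eqP.
  have := congr1 (fun r : {poly {poly C}} => r`_j) E.
  by rewrite coef_map !coef0 => /eqP; rewrite map_poly_eq0.
pose M := #|{: I + I}|.
pose a' (j : 'I_M) t := match enum_val j with
  inl i => X i (p + t *: a) | inr i => (X i (p + t^* *: a))^* end.
pose P' (j : 'I_M) := match enum_val j with inl i => Q i | inr i => Qc i end.
have one : exists i : unit, \forall x \near cofinite_in D, (fun (_ : unit) (_ : C) => 1 : C) i x = 1.
  by exists tt; apply: nearW.
have idS (J : finType) (G : J -> C -> C) : stab (cofinite_in D) id G id.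
  have : stab (cofinite_in D) id G (fun x => 'X.[id x]) by exact: stab_poly.
  by apply: stab_near; apply: nearW => x; rewrite hornerX.
have lP j : \forall t \near cofinite_in D, (lead_coef (P' j)).[t] != 0.
  by apply: nz; rewrite lead_coef_eq0 /P'; case: enum_val.
have aP j : \forall t \near cofinite_in D, (P' j).[(a' j t)%:P].[t] = 0.
  apply: filterS Dn => t [t1 t2]; rewrite /P' /a'; case: enum_val => i.
    by have := PX i t1; rewrite QP.
  have := QcE i (X i (p + t^* *: a)) t^*; rewrite conjCK => ->.
  by have := PX i t2; rewrite QP => ->; rewrite conjC0.
have [J [G [G1 aS _ _]]] := stab_adjoin_relations _ nz one (idS _ _) lP aP.
have XS i : stab (cofinite_in D) id G (fun t => X i (p + t *: a)).
  by have := aS (enum_rank (inl i)); rewrite /a' enum_rankK.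
have YS i : stab (cofinite_in D) id G (fun t => (X i (p + t^* *: a))^*).
  by have := aS (enum_rank (inr i)); rewrite /a' enum_rankK.
have coord (u w : 'rV[C]_n) j : stab (cofinite_in D) id G (fun t => (u + t *: w) ord0 j).
  apply: stab_near (stabD (stabC (u ord0 j)) (stabM (idS _ G) (stabC (w ord0 j)))).
  by apply: nearW => t; rewrite !mxE.
have fS : stab (cofinite_in D) id G (fun t => f (p + t *: a) (vconj p + t *: vconj a)).
  elim: fP => [c|j|j|i|i|g h _ IHg _ IHh|g h _ IHg _ IHh].
  - exact: stabC.
  - exact: coord.
  - exact: coord.
  - exact: XS.
  - apply: stab_near (YS i); apply: nearW => t.
    by rewrite vconj_line !vconjK.
  - exact: stabD.
  - exact: stabM.
have [|S S0 [s sP]] := stab_algebraic fS.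
  by have [i i1] := G1; apply: filterS i1 => x E; exists i; rewrite E oner_neq0.
(* The relation [S] may fail at the finitely many parameters in [s]; the factor [Z] vanishes
   there. *)
pose Z := \prod_(e <- s) ('X - e%:P).
have Z0 : Z != 0 by rewrite monic_neq0 // monic_prod_XsubC.
exists (Z%:P * S); first by rewrite mulf_neq0 ?polyC_eq0.
move=> t t1 t2; rewrite !hornerM hornerC.
have [ts|ts] := boolP (t \in s); last by rewrite sP ?mulr0.
by have /eqP -> : root Z t; rewrite ?mul0r // root_prod_XsubC.
Qed.

(** The point [p] is the midpoint of [z] and [y], and [a] is half their difference divided by [i].
    With [y = vconj xi], the parameter [i] gives the pair [(z, xi)] on a line whose real parameters
    are diagonal. *)
Lemma imaginary_line (z y : 'rV[C]_n) : cball n rho z -> cball n rho y ->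
  exists p a : 'rV[C]_n, [/\ cball n rho p, p + 'i%C *: a = z & p + 'i%C^* *: a = y].
Proof.
move=> zB yB; exists (z + ((2^-1 : R)%:C)%C *: (y - z)), ((2 * 'i%C)^-1 *: (z - y)).
have i0 : 'i%C != 0 :> C by rewrite eq_complex /= oner_eq0 andbF.
have ic : 'i%C^* = - 'i%C :> C by apply/eqP; rewrite eq_complex /= oppr0 !eqxx.
have half : ((2^-1 : R)%:C)%C = 2^-1 :> C by rewrite fmorphV rmorph_nat.
split.
- by apply: cball_convex => //; rewrite invr_ge0 ler0n invf_le1 // ler1n.
- by apply/rowP => k; rewrite !mxE half; field; rewrite i0.
- by apply/rowP => k; rewrite !mxE half ic; field; rewrite i0.
Qed.

(** On the line of [imaginary_line], the zero of [f] at a small real parameter is continued to the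
    parameter [i] along a segment that avoids the zeros of the constant coefficient of the
    relation. *)
Lemma sesqui_polarization_generic f (z xi : 'rV[C]_n) : sesqui f ->
  (forall z, cball n rho z -> f z (vconj z) = 0) ->
  generic_point z -> cball n rho z -> cball n rho xi -> f z xi = 0.
Proof.
move=> fP f0 gz zB xiB.
have [p [a [pB pia pmia]]] := imaginary_line zB (cball_conj xiB).
have [|Q Q0 QP] := @sesqui_algebraic f 'i%C p a fP _ pB; first by rewrite pia.
have [m [S S0 QE]] := multiplicity_XsubC Q 0.
have {}S0 : S`_0 != 0 by rewrite -horner_coef0; move: S0; rewrite Q0.
have [E EP] := roots_seq S0.
have h0 : cball n rho (p + (0 : R)%:C%C *: a) by rewrite scale0r addr0.
have /nbhs_ballP[e /= e0 eB] := cball_line_near h0.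
(* The segment from a real [t2] to [i] meets a point [w] with imaginary part other than 1 only if
   [t2 = Re w / (1 - Im w)]; a small [t2] outside this finite list is chosen. *)
have [k kE] := small_notin [seq complex.Re w / (1 - complex.Im w) | w <- E] e0.
set t2 := e / _ in kE.
pose tau (s : R) : C := t2%:C%C + s%:C%C * ('i%C - t2%:C%C).
pose p2 := p + t2%:C%C *: a.
have p2B : cball n rho p2.
  apply: eB; rewrite /ball /= sub0r normrN gtr0_norm ?divr_gt0 //.
  by rewrite ltr_pdivrMr // ltr_pMr // ltr1n.
have tauc s : (tau s)^* = t2%:C%C + s%:C%C * ('i%C^* - t2%:C%C).
  by apply/eqP; rewrite eq_complex /=; apply/andP; split; apply/eqP; ring.
have xiE : vconj p + 'i%C *: vconj a = xi.
  by have := vconj_line p a 'i%C^*; rewrite pmia vconjK conjCK.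
have p2c : vconj p2 = vconj p + t2%:C%C *: vconj a by rewrite vconj_line conj_real.
have l1 s : p + tau s *: a = p2 + s%:C%C *: (z - p2).
  by have := line_affine p a t2%:C%C s%:C%C 'i%C; rewrite pia.
have l2 s : p + (tau s)^* *: a = p2 + s%:C%C *: (vconj xi - p2).
  by rewrite tauc; have := line_affine p a t2%:C%C s%:C%C 'i%C^*; rewrite pmia.
have l3 s : vconj p + tau s *: vconj a = vconj p2 + s%:C%C *: (xi - vconj p2).
  by rewrite p2c; have := line_affine (vconj p) (vconj a) t2%:C%C s%:C%C 'i%C; rewrite xiE.
have tauB s : 0 <= s <= 1 -> cball n rho (p + tau s *: a) /\ cball n rho (p + (tau s)^* *: a).
  by move=> s01; rewrite l1 l2; split; apply: cball_convex => //; exact: cball_conj.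
pose g s := f (p + tau s *: a) (vconj p + tau s *: vconj a).
have g1 : g 1 = f z xi.
  by rewrite /g l1 l3 scale1r addrC subrK scale1r addrC subrK.
rewrite -g1; apply: (@algebraic_zero_segment R g tau S).
- move=> s s01; split.
    rewrite /g (_ : (fun s => _) = (fun s => f (p2 + s%:C%C *: (z - p2)) (vconj p2 + s%:C%C *: (xi - vconj p2)))).
      apply: sesqui_ccont => //; first by rewrite -l1; have [] := tauB s s01.
      by rewrite -l3 vconj_line !vconjK; have [] := tauB s s01.
    by apply/funext => s'; rewrite l1 l3.
  apply: ccontD; first exact: ccont_cst.
  by apply: ccontM; [exact: ccont_real|exact: ccont_cst].
- move=> s /andP[s0 s1]; have s01 : 0 <= s <= 1 by rewrite s0 ltW.
  have [t1 t3] := tauB s s01; have /eqP := QP _ t1 t3.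
  rewrite -/(g s) QE polyC0 subr0 hornerM hornerXn -polyC_exp hornerM hornerC mulf_eq0 expf_eq0.
  by move=> /orP[/eqP ->|/andP[_ /eqP ->]]; [right|left].
- move=> s /andP[s0 s1]; apply/eqP => /EP tE; move/negP: kE; apply.
  apply/mapP; exists (tau s) => //.
  have -> : complex.Re (tau s) = t2 * (1 - s) by rewrite /tau /=; ring.
  have -> : complex.Im (tau s) = s by rewrite /tau /=; ring.
  by rewrite mulfK // subr_eq0 eq_sym lt_eqF.
- rewrite /g (_ : tau 0 = t2%:C%C); last by rewrite /tau mul0r addr0.
  by have := f0 p2 p2B; rewrite /p2 vconj_line conj_real.
Qed.

(** Points close to [z] on a suitable segment are generic, and the value at [z] follows by
    continuity. *)
Lemma sesqui_polarization f : sesqui f ->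
  (forall z, cball n rho z -> f z (vconj z) = 0) ->
  forall z xi, cball n rho z -> cball n rho xi -> f z xi = 0.
Proof.
move=> fP f0 z xi zB xiB.
have [z' gz'] := near_generic z.
pose g (s : R) := f (z + s%:C%C *: (z' - z)) (xi + s%:C%C *: 0).
have zB0 : cball n rho (z + (0 : R)%:C%C *: (z' - z)) by rewrite scale0r addr0.
have gc : ccont g 0.
  by apply: sesqui_ccont => //; rewrite scaler0 addr0; exact: cball_conj.
suff : g 0 = 0 by rewrite /g scaler0 scale0r !addr0.
apply: (ccont_right_zero gc).
have zn : \forall s \near (0 : R)^'+, cball n rho (z + s%:C%C *: (z' - z)).
  exact: cvg_within (cball_line_near zB0).
apply: filterS2 gz' zn => s gs sB.
by rewrite /g scaler0 addr0; exact: sesqui_polarization_generic.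
Qed.

End Polarization.

(** * Integer relations on the ball *)

Section ComplexDerivatives.
Context {R : realType}.
Local Notation C := R[i].

Lemma cderivable_ccont (f : R -> C) s : cderivable f s -> ccont f s.
Proof. by move=> [[d fd] [d' fd']]; split; exact: is_derive_continuous. Qed.

Lemma cderivable_cst (c : C) s : cderivable (fun=> c) s.
Proof. by split; exists 0; exact: is_derive_cst. Qed.

Lemma cderivableD f g s : @cderivable R f s -> cderivable g s -> cderivable (fun x => f x + g x) s.
Proof.
move=> [[d1 f1] [d2 f2]] [[e1 g1] [e2 g2]]; split.
- exists (d1 + e1); rewrite (_ : (fun x => _) = (fun x => complex.Re (f x)) + (fun x => complex.Re (g x))).
    exact: is_deriveD.
  by apply/funext => x; rewrite raddfD.
- exists (d2 + e2); rewrite (_ : (fun x => _) = (fun x => complex.Im (f x)) + (fun x => complex.Im (g x))).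
    exact: is_deriveD.
  by apply/funext => x; rewrite raddfD.
Qed.

Lemma cderivableM f g s : @cderivable R f s -> cderivable g s -> cderivable (fun x => f x * g x) s.
Proof.
move=> [[d1 f1] [d2 f2]] [[e1 g1] [e2 g2]].
have h1 := is_deriveB (is_deriveM f1 g1) (is_deriveM f2 g2).
have h2 := is_deriveD (is_deriveM f1 g2) (is_deriveM f2 g1).
split; [eexists; apply: (is_derive_eq _ erefl)|eexists; apply: (is_derive_eq _ erefl)].
- rewrite (_ : (fun x => _) = (fun x => complex.Re (f x)) * (fun x => complex.Re (g x))
     - (fun x => complex.Im (f x)) * (fun x => complex.Im (g x))); first exact: h1.
  by apply/funext => x; rewrite !fctE; case: (f x) (g x) => [? ?] [? ?].
- rewrite (_ : (fun x => _) = (fun x => complex.Re (f x)) * (fun x => complex.Im (g x))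
     + (fun x => complex.Im (f x)) * (fun x => complex.Re (g x))); first exact: h2.
  by apply/funext => x; rewrite !fctE; case: (f x) (g x) => [? ?] [? ?].
Qed.

Lemma cderivable_conj f s : @cderivable R f s -> cderivable (fun x => (f x)^*) s.
Proof.
move=> [[d1 f1] [d2 f2]]; split.
- exists d1; rewrite (_ : (fun x => _) = (fun x => complex.Re (f x))) //.
  by apply/funext => x; case: (f x).
- exists (- d2); rewrite (_ : (fun x => _) = - (fun x => complex.Im (f x))); first exact: is_deriveN.
  by apply/funext => x; rewrite !fctE; case: (f x).
Qed.

Lemma cderivable_real s : @cderivable R (fun x => x%:C%C) s.
Proof. by split; [exists 1; exact: is_derive_id|exists 0; exact: is_derive_cst]. Qed.

Lemma horner2_real (Q : {poly {poly C}}) (r t : R) :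
  Q.[(r%:C%C)%:P].[t%:C%C] =
  Complex (map_poly (map_poly (@complex.Re R)) Q).[r%:P].[t]
          (map_poly (map_poly (@complex.Im R)) Q).[r%:P].[t].
Proof.
elim/poly_ind: Q => [|Q c IH].
  by rewrite !raddf0 !horner0.
have reE (f : {additive C -> R}) : map_poly (map_poly f) (Q * 'X + c%:P)
    = map_poly (map_poly f) Q * 'X + (map_poly f c)%:P.
  apply/polyP => i; rewrite coef_map /= !coefD !coefMX !coefC coef_map raddfD /=.
  by case: i => [|i] /=; rewrite ?raddf0.
rewrite (reE (@complex.Re R)) (reE (@complex.Im R)) {reE}.
rewrite !hornerMXaddC !hornerD !hornerM !hornerC IH (horner_real c).
apply/eqP; rewrite eq_complex /=.
by apply/andP; split; apply/eqP; ring.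
Qed.

(** At real arguments [Q] splits into the polynomials of real and of imaginary parts of its
    coefficients, and one of the two is nonzero. *)
Lemma real_relation (Q : {poly {poly C}}) : Q != 0 ->
  exists2 P : {poly {poly R}}, P != 0 & forall r t : R,
    Q.[(r%:C%C)%:P].[t%:C%C] = 0 -> P.[r%:P].[t] = 0.
Proof.
move=> Q0; have [h|h] := eqVneq (map_poly (map_poly (@complex.Re R)) Q) 0; last first.
  by exists (map_poly (map_poly (@complex.Re R)) Q) => // r t; rewrite horner2_real => -[].
exists (map_poly (map_poly (@complex.Im R)) Q); last by move=> r t; rewrite horner2_real => -[].
apply: contraNneq Q0 => h'; apply/eqP/polyP => i; apply/polyP => j; rewrite !coef0.
have := congr1 (fun r : {poly {poly R}} => r`_i`_j) h.
have := congr1 (fun r : {poly {poly R}} => r`_i`_j) h'.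
rewrite /= !coef_map /= ?coef_map !coef0 /=.
by case: (Q`_i`_j) => x y /= -> ->.
Qed.

End ComplexDerivatives.

Section BallRelation.
Context {R : realType} {n : nat} (rho : R) {I : finType}.
Local Notation C := R[i].
Variables (X : I -> 'rV[C]_n -> C) (P : I -> mpoly.mpoly n.+1 C).
Hypothesis rho0 : 0 < rho.
Hypothesis Xder : forall i p a s, cball n rho (p + s%:C%C *: a) ->
  cderivable (fun x => X i (p + x%:C%C *: a)) s.
Hypothesis P0 : forall i, P i != 0.
Hypothesis PX : forall i z, cball n rho z -> evalzw (P i) z (X i z) = 0.

Lemma sesqui_cderivable f : sesqui X f -> forall p a q b s,
  cball n rho (p + s%:C%C *: a) -> cball n rho (vconj (q + s%:C%C *: b)) ->
  cderivable (fun x => f (p + x%:C%C *: a) (q + x%:C%C *: b)) s.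
Proof.
move=> fP p a q b s pB qB.
have coord (u w : 'rV[C]_n) j : cderivable (fun x => (u + x%:C%C *: w) ord0 j) s.
  rewrite (_ : (fun x => _) = (fun x => u ord0 j + x%:C%C * w ord0 j)).
    by apply: cderivableD; [exact: cderivable_cst|apply: cderivableM; [exact: cderivable_real|exact: cderivable_cst]].
  by apply/funext => x; rewrite !mxE.
elim: fP => [c|j|j|i|i|g h _ IHg _ IHh|g h _ IHg _ IHh].
- exact: cderivable_cst.
- exact: coord.
- exact: coord.
- exact: Xder.
- apply: cderivable_conj; rewrite (_ : (fun x => _) = (fun x => X i (vconj q + x%:C%C *: vconj b))).
    by apply: Xder; move: qB; rewrite vconj_line conj_real.
  by apply/funext => x; rewrite vconj_line conj_real.
- exact: cderivableD.
- exact: cderivableM.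
Qed.

Variables (k : nat) (f : 'I_k -> 'rV[C]_n -> 'rV[C]_n -> C) (A : 'I_k -> 'rV[C]_n -> R).
Hypothesis fS : forall i, sesqui X (f i).
Hypothesis fA : forall i z, cball n rho z -> f i z (vconj z) = (A i z)%:C%C.
Hypothesis A0 : forall i z, cball n rho z -> 0 < A i z.
Variables (c : 'I_k -> R) (w : 'I_k -> int).
Hypothesis cA : forall z, cball n rho z -> \sum_i c i * ln (A i z) = 0.
Hypothesis cw : forall x : 'I_k -> int, \sum_i c i * (x i)%:~R = 0 -> \sum_i w i * x i = 0.

Lemma line_derivable i (p a : 'rV[C]_n) (s : R) : cball n rho (p + s%:C%C *: a) ->
  exists d, is_derive (s : R) (1 : R) (fun x => A i (p + x%:C%C *: a)) d.
Proof.
move=> sB.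
have := @sesqui_cderivable _ (fS i) p a (vconj p) (vconj a) s sB.
have E x : vconj p + x%:C%C *: vconj a = vconj (p + x%:C%C *: a).
  by rewrite vconj_line conj_real.
rewrite E vconjK => /(_ sB) [[d fd] _]; exists d.
apply: near_eq_is_derive fd; apply: filterS (cball_line_near sB) => x xB.
by rewrite E fA.
Qed.

Lemma generic_line_relation (z : 'rV[C]_n) : generic_point P z -> cball n rho z ->
  \sum_i (w i)%:~R * ln (A i z) = \sum_i (w i)%:~R * ln (A i 0).
Proof.
move=> gz zB; have B0 := cball0 n rho0.
have segB t : 0 <= t <= 1 -> cball n rho (0 + t%:C%C *: z).
  by move=> t01; have := cball_convex t01 B0 zB; rewrite subr0.
(* The open ball leaves a margin [e] at both ends, so that the parameters 0 and 1 are interior to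
   the interval of [multiplicative_relation]. *)
have [e e0 eB] : exists2 e : R, 0 < e & forall t, - e < t < 1 + e -> cball n rho (0 + t%:C%C *: z).
  have s0 : 0 <= (0 : R) <= 1 by rewrite lexx ler01.
  have s1 : 0 <= (1 : R) <= 1 by rewrite ler01 lexx.
  have /nbhs_ballP[e0 /= e00 eB0] := cball_line_near (segB 0 s0).
  have /nbhs_ballP[e1 /= e10 eB1] := cball_line_near (segB 1 s1).
  exists (Num.min e0 e1); first by rewrite lt_min e00.
  move=> t /andP[]; rewrite -ltrN2 opprK lt_min => /andP[te0 te1].
  rewrite -ltrBlDl lt_min => /andP[te2 te3].
  have [t0|t0] := ltP t 0.
    by apply: eB0; rewrite /ball /= sub0r normrN ltr0_norm.
  have [t1|t1] := leP t 1; first by apply: segB; rewrite t0.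
  by apply: eB1; rewrite /ball /= distrC gtr0_norm ?subr_gt0.
pose a i t := A i (0 + t%:C%C *: z).
have /choice[da daP] : forall it : 'I_k * R, exists d, - e < it.2 < 1 + e ->
    is_derive (it.2 : R) (1 : R) (a it.1) d.
  move=> [i t] /=; have [te|te] := boolP (- e < t < 1 + e); last by exists 0.
  by have [d dP] := line_derivable i (eB t te); exists d.
have gz' : generic_point P (0 + 1 *: z) by rewrite scale1r add0r.
have /fin_all_exists2[Q Q0 QP] : forall i, exists2 Q : {poly {poly R}}, Q != 0 &
    forall t, - e < t < 1 + e -> Q.[(a i t)%:P].[t] = 0.
  move=> i; have [S S0 SP] := sesqui_algebraic PX (fS i) gz' B0.
  have [Q Q0 QP] := real_relation S0; exists Q => // t /eB tB; apply: QP.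
  have := SP t%:C%C; rewrite conj_real => /(_ tB tB).
  have -> : vconj 0 + t%:C%C *: vconj z = vconj (0 + t%:C%C *: z).
    by rewrite vconj_line conj_real.
  by rewrite fA.
have := @multiplicative_relation R (- e) (1 + e) k a (fun i t => da (i, t)) Q c w Q0.
have h1 : - e < 1 < 1 + e by rewrite ltrDl e0 (lt_trans _ ltr01) // oppr_lt0.
have h0 : - e < 0 < 1 + e by rewrite oppr_lt0 e0 addr_gt0.
move=> /(_ _ _ QP _ cw 1 0 h1 h0); rewrite /a scale0r scale1r !add0r; apply.
- by move=> i t te; exact: (daP (i, t)).
- by move=> i t /eB; exact: A0.
- by move=> t /eB; exact: cA.
Qed.

Lemma ball_relation (z : 'rV[C]_n) : cball n rho z ->
  \sum_i (w i)%:~R * ln (A i z) = \sum_i (w i)%:~R * ln (A i 0).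
Proof.
move=> zB; have [z' gz'] := near_generic P0 z.
have zB0 : cball n rho (z + (0 : R)%:C%C *: (z' - z)) by rewrite scale0r addr0.
pose g (s : R) := \sum_i (w i)%:~R * ln (A i (z + s%:C%C *: (z' - z))) - \sum_i (w i)%:~R * ln (A i 0).
have gc : {for 0, continuous g}.
  apply: cvgB; last exact: cvg_cst.
  apply: continuous_bigsum => i; apply: cvgM; first exact: cvg_cst.
  have [d /is_derive_continuous dc] := line_derivable i zB0.
  by apply: (continuous_comp dc); apply: continuous_ln; apply: A0.
have : g 0 = 0; last by rewrite /g scale0r addr0 => /eqP; rewrite subr_eq0 => /eqP.
apply: contrapT => /eqP g0.
have gr : \forall s \near (0 : R)^'+, g s != 0.
  by apply: cvg_within; move: gc g0 => /cvgr_neq0; apply.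
have zn : \forall s \near (0 : R)^'+, cball n rho (z + s%:C%C *: (z' - z)).
  exact: cvg_within (cball_line_near zB0).
have [s [[gs sB]]] := near_ex (filterI (filterI gz' zn) gr).
by rewrite /g generic_line_relation // subrr eqxx.
Qed.

End BallRelation.

(** * Hermitian kernels *)

Section Kernels.
Context {R : realType} {T : Type}.
Local Notation C := R[i].

Lemma sum_normsq_eq0 (J : finType) (u : J -> C) :
  \sum_j u j * (u j)^* = 0 -> forall j, u j = 0.
Proof.
move=> /eqP; rewrite psumr_eq0 => [/allP h j|j _]; last exact: mul_conjC_ge0.
by have := h j (mem_index_enum j); rewrite mul_conjC_eq0 => /eqP.
Qed.

(** A row [w] killed by the Gram matrix satisfies [|w X|^2 = 0], and [X] has independent rows. *)
Lemma gram_unit r k (X : 'M[C]_(r, k)) : row_free X ->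
  X *m (map_mx Num.conj X)^T \in unitmx.
Proof.
move=> fX; rewrite -row_free_unit -kermx_eq0; apply/rowV0P => w /sub_kermxP wX.
apply/(row_free_inj fX); rewrite mul0mx; apply/rowP => j; rewrite !mxE.
have h : (w *m X) *m (map_mx Num.conj (w *m X))^T = 0.
  by rewrite map_mxM trmx_mul mulmxA -(mulmxA w) wX mul0mx.
move: h => /matrixP/(_ ord0 ord0); rewrite !mxE.
under eq_bigr do rewrite !mxE.
move=> h0; have := @sum_normsq_eq0 _ (fun l => \sum_j w ord0 j * X j l).
rewrite /=; apply.
by rewrite -[RHS]h0; apply: eq_bigr => l _.
Qed.

Lemma row_basis (D : set T) k (Phi : T -> 'rV[C]_k) :
  exists r (xi : 'I_r -> T), [/\ forall i, D (xi i),
    row_free (\matrix_i Phi (xi i)) & forall z, D z -> (Phi z <= \matrix_i Phi (xi i))%MS].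
Proof.
pose good r := exists2 xi : 'I_r -> T, forall i, D (xi i) & row_free (\matrix_i Phi (xi i)).
suff H d : forall r, (k - r <= d)%N -> good r -> exists r (xi : 'I_r -> T),
    [/\ forall i, D (xi i), row_free (\matrix_i Phi (xi i))
      & forall z, D z -> (Phi z <= \matrix_i Phi (xi i))%MS].
  apply: (H k 0); first by rewrite subn0.
  have f : 'I_0 -> T by case.
  by exists f; [case|rewrite -row_leq_rank].
elim: d => [|d IH] r rd [xi xiD xif].
  exists r, xi; split=> // z _; apply: submx_full.
  rewrite /row_full eqn_leq rank_leq_col (@leq_trans r) //.
    by rewrite -subn_eq0 -leqn0.
  by rewrite row_leq_rank.
have [h|] := pselect (forall z, D z -> (Phi z <= \matrix_i Phi (xi i))%MS); first by exists r, xi.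
move=> /existsNP[z /not_implyP[zD /negP zn]].
apply: (IH (r + 1)%N); first by rewrite addn1 subnS; case: (k - r)%N rd.
exists (fun i => match fintype.split i with inl i => xi i | inr _ => z end).
  by move=> i; case: fintype.split.
have -> : \matrix_i Phi (match fintype.split i with inl i => xi i | inr _ => z end) =
    col_mx (\matrix_i Phi (xi i)) (Phi z).
  apply/matrixP => i j; rewrite !mxE; case: fintype.split => i'; rewrite ?mxE //.
  by rewrite ord1.
rewrite -row_leq_rank -addsmxE.
have lt : (\matrix_i Phi (xi i) < \matrix_i Phi (xi i) + Phi z)%MS.
  rewrite ltmxE addsmxSl /=; apply: contra zn; apply: submx_trans; exact: addsmxSr.
by rewrite addn1; apply: leq_ltn_trans (rank_ltmx lt); rewrite row_leq_rank.
Qed.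

(** Points [xi i] are chosen so that the vectors of values at them span all the others. If
    [V z = w X], multiplying by the conjugate transpose of [X] produces kernel values at the [xi i],
    and the inverse Gram matrix recovers [w], hence [V z]. *)
Lemma kernel_span (D : set T) (J : finType) (Phi : J -> T -> C) :
  exists r (xi : 'I_r -> T) (a : J -> 'I_r -> C), (forall i, D (xi i)) /\
    forall z, D z -> forall j, Phi j z = \sum_i a j i * \sum_l Phi l z * (Phi l (xi i))^*.
Proof.
pose V z : 'rV[C]_#|J| := \row_l Phi (enum_val l) z.
have [r [xi [xiD xif xis]]] := row_basis D V.
set X := \matrix_i _ in xif xis.
pose Y := invmx (X *m (map_mx Num.conj X)^T) *m X.
exists r, xi, (fun j i => Y i (enum_rank j)); split => // z zD j.
have /submxP[w wE] := xis z zD.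
have E : V z = (V z *m (map_mx Num.conj X)^T) *m Y.
  by rewrite /Y wE mulmxA -(mulmxA w) mulmxK ?gram_unit.
have -> : Phi j z = V z ord0 (enum_rank j) by rewrite mxE enum_rankK.
rewrite E mxE; apply: eq_bigr => i _; rewrite mulrC; congr (_ * _).
rewrite mxE (reindex (@enum_rank J)) /=; last by apply: onW_bij; exact: enum_rank_bij.
by apply: eq_bigr => l _; rewrite !mxE enum_rankK.
Qed.

End Kernels.

Section SquareSums.
Context {R : realType} {n : nat}.
Local Notation C := R[i].

Definition square_sum (A : ('rV[C]_n -> C) -> Prop) (f : 'rV[C]_n -> 'rV[C]_n -> C) : Prop :=
  exists (J : finType) (Phi : J -> 'rV[C]_n -> C),
    [/\ forall z xi, f z xi = \sum_j Phi j z * (Phi j (vconj xi))^*,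
        exists j, Phi j = (fun=> 1) & forall g, A g -> exists j, Phi j = g].

Lemma square_sum1 : square_sum (fun=> False) (fun _ _ => 1).
Proof.
exists unit, (fun _ _ => 1); split=> [z xi||//]; last by exists tt.
by rewrite big_const card_unit /= conjC1 mulr1 addr0.
Qed.

(** Because each family contains 1, the family of products still contains every member of both. This
    keeps the components of the maps visible in the final kernel, and is why [square_sum_exp] asks
    for a positive exponent. *)
Lemma square_sumM A B f g : square_sum A f -> square_sum B g ->
  square_sum (fun u => A u \/ B u) (fun z xi => f z xi * g z xi).
Proof.
move=> [J [Phi [fE [j1 j1E] fA]]] [K [Psi [gE [k1 k1E] gB]]].
exists (J * K)%type, (fun jk z => Phi jk.1 z * Psi jk.2 z); split.
- move=> z xi; rewrite fE gE mulr_suml -(pair_bigA _ (fun j k =>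
    Phi j z * Psi k z * (Phi j (vconj xi) * Psi k (vconj xi))^*)) /=.
  apply: eq_bigr => j _; rewrite mulr_sumr; apply: eq_bigr => k _.
  by rewrite rmorphM mulrACA.
- by exists (j1, k1); apply/funext => z /=; rewrite j1E k1E mulr1.
- move=> u [/fA[j jE]|/gB[k kE]].
    by exists (j, k1); apply/funext => z /=; rewrite jE k1E mulr1.
  by exists (j1, k); apply/funext => z /=; rewrite j1E kE mul1r.
Qed.

Lemma square_sumS A B f : (forall u, B u -> A u) -> square_sum A f -> square_sum B f.
Proof. by move=> BA [J [Phi [fE f1 fA]]]; exists J, Phi; split=> // u /BA /fA. Qed.

Lemma square_sum_exp A f p : (0 < p)%N -> square_sum A f ->
  square_sum A (fun z xi => f z xi ^+ p).
Proof.
case: p => // p _ fA; elim: p => [|p IH]; first exact: fA.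
have -> : (fun z xi => f z xi ^+ p.+2) = (fun z xi => f z xi * f z xi ^+ p.+1).
  by apply/funext => z; apply/funext => xi; rewrite exprS.
by apply: square_sumS (square_sumM fA IH) => u; left.
Qed.

Lemma square_sum_prod (I : finType) (A : I -> ('rV[C]_n -> C) -> Prop) f :
  (forall i, square_sum (A i) (f i)) ->
  square_sum (fun u => exists i, A i u) (fun z xi => \prod_i f i z xi).
Proof.
move=> fA; suff H r : square_sum (fun u => exists2 i, i \in r & A i u)
    (fun z xi => \prod_(i <- r) f i z xi).
  by apply: square_sumS (H (index_enum I)) => u [i ui]; exists i => //; rewrite mem_index_enum.
elim: r => [|i r IH].
  have -> : (fun z xi => \prod_(i <- [::]) f i z xi) = (fun _ _ => 1).
    by apply/funext => z; apply/funext => xi; rewrite big_nil.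
  by apply: square_sumS square_sum1 => u [].
have -> : (fun z xi => \prod_(j <- i :: r) f j z xi) =
    (fun z xi => f i z xi * \prod_(j <- r) f j z xi).
  by apply/funext => z; apply/funext => xi; rewrite big_cons.
apply: square_sumS (square_sumM (fA i) IH) => u [j]; rewrite inE => /orP[/eqP ->|jr] Aj.
  by left.
by right; exists j.
Qed.

Lemma square_sum_polar N (F : 'rV[C]_n -> 'rV[C]_N) :
  square_sum (fun u => exists k, u = (fun z => F z ord0 k)) (fun z xi => 1 + polar F z xi).
Proof.
exists (unit + 'I_N)%type, (fun o z => if o is inr k then F z ord0 k else 1); split.
- by move=> z xi; rewrite big_sumType /= big_const card_unit /= conjC1 mulr1 addr0.
- by exists (inl tt).
- by move=> u [k ->]; exists (inr k).
Qed.

End SquareSums.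

(** * Kernels proportional to powers of a polynomial *)

Section PolynomialKernels.
Context {R : realType} {n : nat} (rho : R).
Local Notation C := R[i].
Hypothesis rho0 : 0 < rho.

Lemma sesqui_polynomial (I : finType) (X : I -> 'rV[C]_n -> C) (q : I -> mpoly.mpoly n C) f :
  (forall i z, X i z = evaln (q i) z) -> sesqui X f ->
  exists g : mpoly.mpoly (n + n) C, forall z xi, f z xi = eval2 g z xi.
Proof.
move=> Xq; elim=> [c|j|j|i|i|f' g' _ [F IHf] _ [G IHg]|f' g' _ [F IHf] _ [G IHg]].
- by exists (mpoly.mpolyC _ c) => z xi; rewrite /eval2 mpoly.mevalC.
- exists (mX (lshift n j)) => z xi; rewrite /eval2 mpoly.mevalXU.
  by have := unsplitK (inl j : 'I_n + 'I_n) => /= ->.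
- exists (mX (rshift n j)) => z xi; rewrite /eval2 mpoly.mevalXU.
  by have := unsplitK (inr j : 'I_n + 'I_n) => /= ->.
- suff [g gE] : exists g : mpoly.mpoly (n + n) C, forall z xi, evaln (q i) z = eval2 g z xi.
    by exists g => z xi; rewrite Xq.
  rewrite /evaln; elim/mpoly_ring_ind: (q i) => [c|j|F G [F' IHf] [G' IHg]|F G [F' IHf] [G' IHg]].
  + by exists (mpoly.mpolyC _ c) => z xi; rewrite /eval2 !mpoly.mevalC.
  + exists (mX (lshift n j)) => z xi; rewrite /eval2 !mpoly.mevalXU.
    by have := unsplitK (inl j : 'I_n + 'I_n) => /= ->.
  + by exists (F' + G') => z xi; rewrite mpoly.mevalD (IHf z xi) (IHg z xi) /eval2 mpoly.mevalD.
  + by exists (F' * G') => z xi; rewrite mpoly.mevalM (IHf z xi) (IHg z xi) /eval2 mpoly.mevalM.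
- suff [g gE] : exists g : mpoly.mpoly (n + n) C,
      forall z xi, (evaln (q i) (vconj xi))^* = eval2 g z xi.
    by exists g => z xi; rewrite Xq.
  rewrite /evaln; elim/mpoly_ring_ind: (q i) => [c|j|F G [F' IHf] [G' IHg]|F G [F' IHf] [G' IHg]].
  + by exists (mpoly.mpolyC _ c^*) => z xi; rewrite /eval2 !mpoly.mevalC.
  + exists (mX (rshift n j)) => z xi; rewrite /eval2 !mpoly.mevalXU.
    by have := unsplitK (inr j : 'I_n + 'I_n) => /= ->; rewrite mxE conjCK.
  + exists (F' + G') => z xi.
    by rewrite mpoly.mevalD rmorphD /= (IHf z xi) (IHg z xi) /eval2 mpoly.mevalD.
  + exists (F' * G') => z xi.
    by rewrite mpoly.mevalM rmorphM /= (IHf z xi) (IHg z xi) /eval2 mpoly.mevalM.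
- by exists (F + G) => z xi; rewrite IHf IHg /eval2 mpoly.mevalD.
- by exists (F * G) => z xi; rewrite IHf IHg /eval2 mpoly.mevalM.
Qed.

Lemma eval2_line (g : mpoly.mpoly (n + n) C) (p a q b : 'rV[C]_n) :
  exists Q : {poly C}, forall t, eval2 g (p + t *: a) (q + t *: b) = Q.[t].
Proof.
have [Q QE] := mpoly_line g
  (fun i => match fintype.split i with inl j => p ord0 j | inr j => q ord0 j end)
  (fun i => match fintype.split i with inl j => a ord0 j | inr j => b ord0 j end).
exists Q => t; rewrite -QE; apply: mpoly.meval_eq => i.
by case: fintype.split => j; rewrite !mxE.
Qed.

(** Polarization with the empty family [X] gives vanishing on pairs of points of the ball. On the
    line from the origin to a point where [g] is nonzero, small parameters lie in the ball and all
    but finitely many give a nonzero value. *)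
Lemma eval2_eq0 (g : mpoly.mpoly (n + n) C) :
  (forall z, cball n rho z -> eval2 g z (vconj z) = 0) -> g = 0.
Proof.
move=> g0.
pose X (i : void) (z : 'rV[C]_n) : C := match i with end.
pose P (i : void) : mpoly.mpoly n.+1 C := match i with end.
have gB : forall z xi, cball n rho z -> cball n rho xi -> eval2 g z xi = 0.
  apply: (@sesqui_polarization R n rho void X P); [by case|by case|by case| |by []].
  exact: sesqui_eval2.
apply: contrapT => /eqP /mpoly_nonzero_point[v vE].
pose a : 'rV[C]_n := \row_j v (lshift n j); pose b : 'rV[C]_n := \row_j v (rshift n j).
have [Q QE] := eval2_line g 0 a 0 b.
have Q0 : Q != 0.
  apply: contraNneq vE => Q0; have := QE 1; rewrite Q0 horner0 !scale1r !add0r => <-.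
  apply/eqP/mpoly.meval_eq => i; rewrite -{1}(splitK i).
  by case: fintype.split => j /=; rewrite mxE.
have B0 (c : 'rV[C]_n) : \forall s \near (0 : R)^'+, cball n rho (0 + s%:C%C *: c).
  apply: cvg_within; apply: cball_line_near; rewrite scale0r addr0; exact: cball0.
have [s [[aB bB]]] := near_ex (filterI (filterI (B0 a) (B0 b)) (near_right_complex_nonroot 0 Q0)).
by move=> /eqP; apply; rewrite -QE; exact: gB.
Qed.

Lemma eval2_const (h : mpoly.mpoly (n + n) C) (c : C) :
  (forall z, cball n rho z -> eval2 h z (vconj z) = c) -> mconst h.
Proof.
move=> hc; exists c; apply/eqP; rewrite -subr_eq0; apply/eqP/eval2_eq0 => z zB.
by rewrite /eval2 mpoly.mevalB mpoly.mevalC -/(eval2 h z _) hc ?subrr.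
Qed.

Lemma eval2_fst (h : mpoly.mpoly (n + n) C) (w : 'rV[C]_n) :
  exists q : mpoly.mpoly n C, forall z, eval2 h z w = evaln q z.
Proof.
rewrite /eval2 /evaln.
elim/mpoly_ring_ind: h => [c|i|F G [F' IHf] [G' IHg]|F G [F' IHf] [G' IHg]].
- by exists (mpoly.mpolyC _ c) => z; rewrite !mpoly.mevalC.
- case E : (fintype.split i) => [j|j].
    by exists (mX j) => z; rewrite !mpoly.mevalXU E.
  by exists (mpoly.mpolyC _ (w ord0 j)) => z; rewrite mpoly.mevalC mpoly.mevalXU E.
- by exists (F' + G') => z; rewrite !mpoly.mevalD IHf IHg.
- by exists (F' * G') => z; rewrite !mpoly.mevalM IHf IHg.
Qed.

Lemma polynomial_kernel (J : finType) (Phi : J -> 'rV[C]_n -> C)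
  (h : mpoly.mpoly (n + n) C) (c : C) (s : nat) :
  (forall z xi, cball n rho z -> cball n rho xi ->
    \sum_j Phi j z * (Phi j (vconj xi))^* = c * eval2 h z xi ^+ s) ->
  forall j, exists q : mpoly.mpoly n C, forall z, cball n rho z -> Phi j z = evaln q z.
Proof.
move=> hP j; have [r [xi [a [xiB E]]]] := kernel_span (cball n rho) Phi.
have /fin_all_exists[q qE] := fun i => eval2_fst h (vconj (xi i)).
exists (\sum_i mpoly.mpolyC _ (a j i) * (mpoly.mpolyC _ c * q i ^+ s)) => z zB.
rewrite E // /evaln raddf_sum; apply: eq_bigr => i _.
have := hP z (vconj (xi i)) zB (cball_conj (xiB i)); rewrite vconjK => ->.
by rewrite /= !mpoly.mevalM !mpoly.mevalC rmorphXn /= qE.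
Qed.

Lemma bounded_poly_const (Q : {poly R}) (S : {poly C}) (c : R) (s : nat) : (0 < s)%N ->
  S != 0 -> (forall t, 0 < Q.[t]) -> (forall t, S.[t%:C%C] != 0 -> Q.[t] ^+ s <= c) ->
  (size Q <= 1)%N.
Proof.
move=> s0 S0 Q0 Qc; rewrite leqNgt; apply/negP => Q1.
(* The even power makes the leading coefficient positive, whatever the sign of that of [Q], so [p]
   is positive at large parameters and contradicts the bound. *)
pose p := Q ^+ (s * 2) - (c ^+ 2)%:P.
have Qn0 : Q != 0 by rewrite -size_poly_gt0 ltnW.
have lp : lead_coef p = lead_coef Q ^+ (s * 2).
  rewrite /p lead_coefDl ?lead_coef_exp // size_polyN (leq_ltn_trans (size_polyC_leq1 _)) //.
  by rewrite -ltn_predRL size_exp muln_gt0 muln_gt0 s0 andbT -ltnS prednK // ltnW.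
have p0 : 0 < lead_coef p.
  by rewrite lp exprM exprn_even_gt0 //= expf_eq0 lead_coef_eq0 negb_and Qn0 orbT.
have [M MP] := poly_pinfty_gt_lc p0.
have [|k kP] := poly_nonroot (f := fun k => (M + k%:R)%:C%C) _ S0.
  by move=> i j /complexI /addrI /eqP; rewrite eqr_nat => /eqP.
have := lt_le_trans p0 (MP (M + k%:R) _); rewrite lerDl ler0n => /(_ isT).
rewrite /p hornerD hornerN hornerC horner_exp subr_gt0 exprM.
have := Qc _ kP; rewrite ltNge => h; apply/negP; rewrite negbK.
have h0 : 0 <= Q.[M + k%:R] ^+ s by rewrite exprn_ge0 ?ltW.
by rewrite ler_pXn2r // nnegrE (le_trans h0).
Qed.

(** By [kernel_span] each [Phi j] is rational, with denominator [S], a product of powers of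
    polynomials [h(., conj xi_i)]. Multiplied by [|S|^2], the identity is polynomial and holds on
    the whole space, where the member 1 of the family bounds [h] by a constant. *)
Lemma inverse_kernel_const (J : finType) (Phi : J -> 'rV[C]_n -> C)
  (h : mpoly.mpoly (n + n) C) (c : C) (s : nat) : (0 < s)%N ->
  (exists j, Phi j = (fun=> 1)) ->
  (forall z, 0 < eval2 h z (vconj z)) ->
  (forall z xi, cball n rho z -> cball n rho xi ->
    (\sum_j Phi j z * (Phi j (vconj xi))^*) * eval2 h z xi ^+ s = c) ->
  mconst h.
Proof.
move=> s0 [j1 j1E] h0 hP; have [r [xi [a [xiB E]]]] := kernel_span (cball n rho) Phi.
have B0 := cball0 n rho0.
have c0 : c != 0.
  rewrite -(hP 0 (vconj 0)) ?vconjK //; last exact: cball_conj.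
  rewrite mulf_neq0 ?expf_neq0 ?lt0r_neq0 // (bigD1 j1) //= j1E conjC1 mulr1.
  rewrite ltr_pwDl // sumr_ge0 // => j _; exact: mul_conjC_ge0.
pose t i z := eval2 h z (vconj (xi i)) ^+ s.
have tE i z : cball n rho z -> (\sum_l Phi l z * (Phi l (xi i))^*) * t i z = c.
  by move=> zB; have := hP z (vconj (xi i)) zB (cball_conj (xiB i)); rewrite vconjK.
pose S z := \prod_i t i z.
pose V j z := \sum_i a j i * (c * \prod_(k | k != i) t k z).
have VE j z : cball n rho z -> V j z = Phi j z * S z.
  move=> zB; rewrite (E z zB) mulr_suml; apply: eq_bigr => i _.
  have -> : S z = t i z * \prod_(k | k != i) t k z by rewrite /S (bigD1 i).
  by rewrite -(tE i z zB); ring.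
have /fin_all_exists[q qE] := fun i => eval2_fst h (vconj (xi i)).
pose Sq := \prod_i q i ^+ s.
have SE z : S z = evaln Sq z.
  rewrite /S /evaln rmorph_prod; apply: eq_bigr => i _.
  by rewrite /t rmorphXn /= qE.
pose Vq j := \sum_i mpoly.mpolyC n (a j i) * (mpoly.mpolyC _ c * \prod_(k | k != i) q k ^+ s).
have VqE j z : V j z = evaln (Vq j) z.
  rewrite /V /evaln raddf_sum; apply: eq_bigr => i _.
  rewrite /= !mpoly.mevalM !mpoly.mevalC rmorph_prod; congr (_ * (_ * _)).
  by apply: eq_bigr => k _; rewrite /t rmorphXn /= qE.
pose X (o : option J) z := if o is Some j then V j z else S z.
have XE o z : X o z = evaln (if o is Some j then Vq j else Sq) z by case: o => [j|] /=.
(* Both sides are polynomial in [z] and its conjugate and agree on the ball, so [eval2_eq0] extends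
   the equality to every [z]. *)
have bound z : (\sum_j V j z * (V j z)^*) * eval2 h z (vconj z) ^+ s = c * (S z * (S z)^*).
  pose f z xi := (\sum_j X (Some j) z * (X (Some j) (vconj xi))^*) * eval2 h z xi ^+ s
    + (- c) * (X None z * (X None (vconj xi))^*).
  have fS : sesqui X f.
    apply: sesqui_add; apply: sesqui_mul; [|apply: sesqui_exp; exact: sesqui_eval2|exact: sesqui_cst|].
      by apply: sesqui_sum => j; apply: sesqui_mul; [exact: sesqui_hol|exact: sesqui_anti].
    by apply: sesqui_mul; [exact: sesqui_hol|exact: sesqui_anti].
  have [g gE] := sesqui_polynomial XE fS.
  suff g0 : g = 0.
    have := gE z (vconj z); rewrite g0 /eval2 mpoly.meval0 /f !vconjK mulNr => /eqP.
    by rewrite subr_eq0 => /eqP.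
  apply: eval2_eq0 => {}z zB; rewrite -gE /f !vconjK /= mulNr.
  rewrite -(hP z (vconj z) zB (cball_conj zB)) vconjK; apply/eqP; rewrite subr_eq0; apply/eqP.
  rewrite mulrAC; congr (_ * _); rewrite mulr_suml; apply: eq_bigr => j _.
  by rewrite VE // rmorphM mulrACA.
have V1 z : V j1 z = S z.
  have fS : sesqui X (fun z xi => X (Some j1) z + (- 1) * X None z).
    apply: sesqui_add; first exact: (sesqui_hol X (Some j1)).
    by apply: sesqui_mul; [exact: sesqui_cst|exact: (sesqui_hol X None)].
  have [g gE] := sesqui_polynomial XE fS.
  suff g0 : g = 0.
    have := gE z 0; rewrite g0 /eval2 mpoly.meval0 mulN1r => /eqP.
    by rewrite subr_eq0 => /eqP.
  by apply: eval2_eq0 => {}z zB; rewrite -gE /= VE // j1E mul1r mulN1r subrr.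
(* The term [j1] alone contributes [|S z|^2] to the sum on the left of [bound]. *)
have hc z : S z != 0 -> eval2 h z (vconj z) ^+ s <= c.
  move=> Sz; have SS : 0 < S z * (S z)^* by rewrite mul_conjC_gt0.
  rewrite -(ler_pM2r SS) -bound mulrC ler_wpM2r //; first by rewrite exprn_ge0 // ltW.
  rewrite (bigD1 j1) //= V1 lerDl sumr_ge0 // => j _; exact: mul_conjC_ge0.
(* On the real line through 0 and [z], [h] is a positive polynomial bounded off the zeros of [T],
   hence constant; [T] is nonzero because [S] does not vanish at 0. *)
apply: (@eval2_const _ (eval2 h 0 (vconj 0))) => z _.
have [Q QE] := eval2_line h 0 z (vconj 0) (vconj z).
have lineE (x : R) : vconj 0 + x%:C%C *: vconj z = vconj (0 + x%:C%C *: z).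
  by rewrite vconj_line conj_real.
have [T TE] := mpoly_line Sq (fun=> 0) (fun i => z ord0 i).
have {}TE x : S (0 + x *: z) = T.[x].
  by rewrite SE -TE; apply: mpoly.meval_eq => i; rewrite !mxE.
have T0 : T != 0.
  apply: contraTneq isT => T0; have := TE 0; rewrite T0 horner0 scale0r addr0 => /eqP.
  rewrite prodf_seq_eq0 => /hasP[i _ /= /eqP ti].
  by have := tE i 0 B0; rewrite ti mulr0 => /eqP; rewrite eq_sym (negPf c0).
pose q' := map_poly (@complex.Re R) Q.
have q'E x : Q.[x%:C%C] = (q'.[x])%:C%C.
  have := h0 (0 + x%:C%C *: z); rewrite -lineE QE horner_real.
  by rewrite ltcE /= => /andP[/eqP -> _].
have q1 : (size q' <= 1)%N.
  apply: (@bounded_poly_const q' T (complex.Re c) s s0 T0) => x.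
    by have := h0 (0 + x%:C%C *: z); rewrite -lineE QE q'E ltcR.
  move=> Tx; have := hc (0 + x%:C%C *: z); rewrite -lineE QE q'E TE => /(_ Tx).
  by rewrite -rmorphXn lecE /= => /andP[].
have E0 := QE (0 : R)%:C%C; have E1 := QE (1 : R)%:C%C; move: E0 E1.
rewrite !q'E (size1_polyC q1) !hornerC !scale0r !scale1r !addr0 add0r => -> <-.
by congr eval2; apply/rowP => i; rewrite !mxE conjC0 add0r.
Qed.

End PolynomialKernels.

(** * The product identity *)

Lemma ln_prod (R : realType) (I : Type) (r : seq I) (u : I -> R) : (forall i, 0 < u i) ->
  ln (\prod_(i <- r) u i) = \sum_(i <- r) ln (u i).
Proof.
move=> u0; elim: r => [|i r IH]; first by rewrite !big_nil ln1.
by rewrite !big_cons lnM ?IH ?posrE ?u0 // prodr_gt0.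
Qed.

Lemma prod_of_logs (R : realType) (E : finType) (p : E -> nat) (u v : E -> R) (x y : R) (s : int) :
  (forall e, 0 < u e) -> (forall e, 0 < v e) -> 0 < x -> 0 < y ->
  \sum_e (p e)%:R * ln (u e) + s%:~R * ln x = \sum_e (p e)%:R * ln (v e) + s%:~R * ln y ->
  match s with
  | Posz k => \prod_e u e ^+ p e * x ^+ k = \prod_e v e ^+ p e * y ^+ k
  | Negz k => \prod_e u e ^+ p e = \prod_e v e ^+ p e / y ^+ k.+1 * x ^+ k.+1
  end.
Proof.
move=> u0 v0 x0 y0.
have lnL (u' : E -> R) : (forall e, 0 < u' e) ->
    \sum_e (p e)%:R * ln (u' e) = ln (\prod_e u' e ^+ p e).
  move=> u'0; rewrite ln_prod => [|e]; last exact: exprn_gt0.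
  by apply: eq_bigr => e _; rewrite lnXn // mulr_natl.
rewrite !lnL //.
have : 0 < \prod_e u e ^+ p e by apply: prodr_gt0 => e _; exact: exprn_gt0.
have : 0 < \prod_e v e ^+ p e by apply: prodr_gt0 => e _; exact: exprn_gt0.
move: (\prod_e u e ^+ p e) (\prod_e v e ^+ p e) => a b b0 a0.
case: s => k E1; apply: ln_inj; rewrite ?posrE ?mulr_gt0 ?invr_gt0 ?exprn_gt0 //.
  by rewrite !lnM ?posrE ?exprn_gt0 // !lnXn // -(mulr_natl (ln x)) -(mulr_natl (ln y)).
rewrite lnM ?posrE ?divr_gt0 ?exprn_gt0 // ln_div ?posrE ?exprn_gt0 // !lnXn //.
move: E1; rewrite NegzE !mulrNz -pmulrn -(mulr_natl (ln x)) -(mulr_natl (ln y)) !mulNr => /eqP.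
by rewrite subr_eq => /eqP ->; ring.
Qed.

Lemma positive_integer_functional_fin (R : numFieldType) (E : finType) (c : E -> R) (c0 : R) :
  (forall b : E -> rat, (forall e, 0 <= b e) ->
     \sum_e ratr (b e) * c e = 0 -> forall e, b e = 0) ->
  exists (p : E -> nat) (s : int), (forall e, (0 < p e)%N) /\
    forall (x : E -> int) (x0 : int),
      \sum_e (x e)%:~R * c e + x0%:~R * c0 = 0 ->
      \sum_e x e * (p e)%:Z + x0 * s = 0.
Proof.
move=> cE; have eb : {on [pred i | predT i], bijective (@enum_val E predT)}.
  by apply: onW_bij; exact: enum_val_bij.
have [|p [s [p0 ps]]] := @positive_integer_functional R #|E| (fun i => c (enum_val i)) c0.
  move=> b b0 bc i; rewrite -(enum_valK i).
  apply: (cE (fun e => b (enum_rank e))) => [e|]; first exact: b0.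
  by rewrite (reindex _ eb) /= -[RHS]bc; apply: eq_bigr => j _; rewrite enum_valK.
exists (fun e => p (enum_rank e)), s; split => [e|x x0 xc]; first exact: p0.
have := ps (fun i => x (enum_val i)) x0; rewrite (reindex _ eb) /= in xc => /(_ xc) x0E; rewrite -[RHS]x0E.
congr (_ + _); rewrite (reindex _ eb) /=.
by apply: eq_bigr => j _; rewrite enum_valK.
Qed.

Lemma ball_relation_fin (R : realType) (n : nat) (rho : R) (I : finType)
    (X : I -> 'rV[R[i]]_n -> R[i]) (P : I -> mpoly.mpoly n.+1 R[i]) :
  0 < rho ->
  (forall i p a s, cball n rho (p + s%:C%C *: a) ->
     cderivable (fun x => X i (p + x%:C%C *: a)) s) ->
  (forall i, P i != 0) ->
  (forall i z, cball n rho z -> evalzw (P i) z (X i z) = 0) ->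
  forall (K : finType) (f : K -> 'rV[R[i]]_n -> 'rV[R[i]]_n -> R[i]) (A : K -> 'rV[R[i]]_n -> R),
  (forall e, sesqui X (f e)) ->
  (forall e z, cball n rho z -> f e z (vconj z) = (A e z)%:C%C) ->
  (forall e z, cball n rho z -> 0 < A e z) ->
  forall (c : K -> R) (w : K -> int),
  (forall z, cball n rho z -> \sum_e c e * ln (A e z) = 0) ->
  (forall x : K -> int, \sum_e c e * (x e)%:~R = 0 -> \sum_e w e * x e = 0) ->
  forall z, cball n rho z ->
    \sum_e (w e)%:~R * ln (A e z) = \sum_e (w e)%:~R * ln (A e 0).
Proof.
move=> rho0 Xder P0 PX K f A fS fA A0 c w cA cw z zB.
have eb : {on [pred i | predT i], bijective (@enum_val K predT)}.
  by apply: onW_bij; exact: enum_val_bij.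
rewrite !(reindex _ eb) /=.
apply: (@ball_relation R n rho I X P rho0 Xder P0 PX #|K| (fun i => f (enum_val i))
  (fun i => A (enum_val i)) _ _ _ (fun i => c (enum_val i)) (fun i => w (enum_val i))) => //.
- by move=> i; exact: fA.
- by move=> i; exact: A0.
- by move=> y /cA; rewrite (reindex _ eb).
- move=> x xc; have := cw (fun e => x (enum_rank e)).
  rewrite !(reindex _ eb) /=.
  under eq_bigr do rewrite enum_valK.
  by move=> /(_ xc) x0E; rewrite -[RHS]x0E; apply: eq_bigr => i _; rewrite enum_valK.
Qed.

(** * The merged family of maps, its integer relation and the powers of [h] *)

Section Rigidity.
Context {R : realType} {n : nat} (rho : R).
Local Notation C := R[i].

Lemma polar_diag N (F : 'rV[C]_n -> 'rV[C]_N) z : polar F z (vconj z) = (sqnorm (F z))%:C%C.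
Proof.
rewrite /polar vconjK sqnormE rmorph_sum; apply: eq_bigr => k _.
case: (F z ord0 k) => x y; apply/eqP; rewrite eq_complex /=.
by apply/andP; split; apply/eqP; ring.
Qed.

Lemma sqnorm_ge0 N (u : 'rV[C]_N) : 0 <= sqnorm u.
Proof. by rewrite sqnormE sumr_ge0 // => k _; rewrite addr_ge0 ?sqr_ge0. Qed.

(** Expanding [|F z - F w|^2] gives four values of [polar], two of each sign. *)
Lemma polar_const N (F : 'rV[C]_n -> 'rV[C]_N) (c : C) :
  (forall z xi, cball n rho z -> cball n rho xi -> polar F z xi = c) ->
  forall z w, cball n rho z -> cball n rho w -> F z = F w.
Proof.
move=> Fc z w zB wB; apply/rowP => k; apply/eqP; rewrite -subr_eq0; apply/eqP.
apply: (@sum_normsq_eq0 _ _ (fun k => F z ord0 k - F w ord0 k)).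
have d u y : cball n rho u -> cball n rho y -> \sum_k F u ord0 k * (F y ord0 k)^* = c.
  by move=> uB yB; rewrite -(Fc u (vconj y) uB (cball_conj yB)) /polar vconjK.
transitivity (c - c - (c - c)); last by rewrite subrr.
rewrite -{1}(d z z) // -{1}(d z w) // -{1}(d w z) // -{1}(d w w) // -!sumrB.
by apply: eq_bigr => j _; rewrite rmorphB; ring.
Qed.

Lemma real_mul_exp (a b : R) k : (a * b ^+ k)%:C%C = a%:C%C * b%:C%C ^+ k :> C.
Proof. by rewrite rmorphM rmorphXn. Qed.

Hypothesis rho0 : 0 < rho.
Variables (E : finType) (M : E -> nat) (Phi : forall e, 'rV[C]_n -> 'rV[C]_(M e)).
Hypothesis Phi_hol : forall e, holomorphic_on (cball n rho) (Phi e).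
Hypothesis Phi_alg : forall e, algebraic_on (cball n rho) (Phi e).
Hypothesis Phi_nc : forall e, nonconstant_on (cball n rho) (Phi e).
Variable h : mpoly.mpoly (n + n) C.
Hypothesis h_irr : mirreducible h.
Hypothesis h_pos : forall z : 'rV[C]_n, 0 < eval2 h z (vconj z).
Variables (r : R) (c : E -> R).
Hypothesis c_indep : forall b : E -> rat, (forall e, 0 <= b e) ->
  \sum_e ratr (b e) * c e = 0 -> forall e, b e = 0.
Hypothesis identity : forall z, cball n rho z ->
  complex.Re (eval2 h z (vconj z)) `^ r = \prod_e (1 + sqnorm (Phi e z)) `^ c e.

Let I := {e : E & 'I_(M e)}.
Let X (i : I) z := Phi (tag i) z ord0 (tagged i).
Let hr z := complex.Re (eval2 h z (vconj z)).
Let f e z := 1 + sqnorm (Phi e z).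

Let hrE z : eval2 h z (vconj z) = (hr z)%:C%C.
Proof.
have := h_pos z; rewrite /hr; case: (eval2 _ _ _) => x y.
by rewrite ltcE /= => /andP[/eqP -> _].
Qed.

Let hr0 z : 0 < hr z.
Proof. by have := h_pos z; rewrite hrE ltcR. Qed.

Let f0 e z : 0 < f e z.
Proof. by rewrite ltr_wpDr ?sqnorm_ge0. Qed.

Let fE e z : 1 + polar (Phi e) z (vconj z) = (f e z)%:C%C.
Proof. by rewrite polar_diag /f rmorphD. Qed.

Let logs z : cball n rho z -> \sum_e c e * ln (f e z) = r * ln (hr z).
Proof.
move=> zB; rewrite -ln_powR /hr identity // ln_prod => [|e].
  by apply: eq_bigr => e _; rewrite ln_powR.
by rewrite powR_gt0 // f0.
Qed.

Let polarS e : sesqui X (fun z xi => 1 + polar (Phi e) z xi).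
Proof.
apply: sesqui_add; first exact: sesqui_cst.
apply: (@sesqui_sum R n I X 'I_(M e) _ (fun k z xi => Phi e z ord0 k * (Phi e (vconj xi) ord0 k)^*)) => k.
by apply: sesqui_mul;
  [exact: (sesqui_hol X (Tagged (fun e => 'I_(M e)) k))
  |exact: (sesqui_anti X (Tagged (fun e => 'I_(M e)) k))].
Qed.

Let Xder i p a s : cball n rho (p + s%:C%C *: a) ->
  cderivable (fun x => X i (p + x%:C%C *: a)) s.
Proof. exact: holomorphic_line. Qed.

Let algebraic_family : exists P : I -> mpoly.mpoly n.+1 C, (forall i, P i != 0) /\
  forall i z, cball n rho z -> evalzw (P i) z (X i z) = 0.
Proof.
have /fin_all_exists[P PP] : forall i : I, exists P : mpoly.mpoly n.+1 C,
    P != 0 /\ forall z, cball n rho z -> evalzw P z (X i z) = 0.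
  by move=> i; exact: Phi_alg.
by exists P; split => i; case: (PP i).
Qed.

Let polarization g : sesqui X g -> (forall z, cball n rho z -> g z (vconj z) = 0) ->
  forall z xi, cball n rho z -> cball n rho xi -> g z xi = 0.
Proof.
have [P [P0 PX]] := algebraic_family.
by apply: (sesqui_polarization _ P0 PX) => i p a s /Xder /cderivable_ccont.
Qed.

Let kernel (p : E -> nat) z xi := \prod_e (1 + polar (Phi e) z xi) ^+ p e.

(** Here [s] stands on the side of the kernel: [Negz k] is the case of a polynomial kernel, and
    [Posz k] with [k > 0] is the case to be excluded later. *)
Lemma integer_relation : exists (p : E -> nat) (s : int) (d : R),
  [/\ forall e, (0 < p e)%N, 0 < d & forall z xi, cball n rho z -> cball n rho xi ->
     match s with
     | Posz k => kernel p z xi * eval2 h z xi ^+ k = d%:C%C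
     | Negz k => kernel p z xi = d%:C%C * eval2 h z xi ^+ k.+1
     end].
Proof.
have [p [s [p0 ps]]] := positive_integer_functional_fin (- r) c_indep.
have [P [P0 PX]] := algebraic_family.
(* The extra index carries [h] with exponent [- r]. Its weight [s] is imposed by the functional,
   whose sign is controlled only on the [c e]. *)
pose K := (E + unit)%type.
pose fK (e : K) := if e is inl e then (fun z xi => 1 + polar (Phi e) z xi) else eval2 h.
pose A (e : K) := if e is inl e then f e else hr.
pose w (e : K) : int := if e is inl e then (p e)%:Z else s.
pose cK (e : K) := if e is inl e then c e else - r.
have sumK (V : zmodType) (g : K -> V) : \sum_e g e = \sum_e g (inl e) + g (inr tt).
  by rewrite big_sumType /= (bigD1 tt) //= [X in _ + (_ + X)]big1 ?addr0 // => -[].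
have fKS e : sesqui X (fK e) by case: e => [e|u]; [exact: polarS|exact: sesqui_eval2].
have fKA e z : cball n rho z -> fK e z (vconj z) = (A e z)%:C%C.
  by move=> _; case: e => [e|u]; [exact: fE|exact: hrE].
have A0 e z : cball n rho z -> 0 < A e z by move=> _; case: e => [e|u]; [exact: f0|exact: hr0].
have cA z : cball n rho z -> \sum_e cK e * ln (A e z) = 0.
  move=> zB; rewrite sumK; have -> : \sum_e cK (inl e) * ln (A (inl e) z) = r * ln (hr z).
    exact: logs.
  by rewrite /cK /A mulNr subrr.
have cw (x : K -> int) : \sum_e cK e * (x e)%:~R = 0 -> \sum_e w e * x e = 0.
  rewrite !sumK /= => xc; have := ps (fun e => x (inl e)) (x (inr tt)).
  rewrite (mulrC s) => h1; under eq_bigr do rewrite mulrC.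
  apply: h1; rewrite -[RHS]xc (mulrC (- r)); congr (_ + _).
  by apply: eq_bigr => e _; rewrite mulrC.
have rel z : cball n rho z -> \sum_e (p e)%:R * ln (f e z) + s%:~R * ln (hr z) =
    \sum_e (p e)%:R * ln (f e 0) + s%:~R * ln (hr 0).
  move=> zB; have := ball_relation_fin rho0 Xder P0 PX fKS fKA A0 cA cw zB.
  by rewrite !sumK.
pose L z := \prod_e f e z ^+ p e.
have kernelE z : kernel p z (vconj z) = (L z)%:C%C.
  rewrite /kernel /L rmorph_prod; apply: eq_bigr => e _.
  by rewrite fE rmorphXn.
have kS : sesqui X (kernel p).
  by apply: sesqui_prod => e; apply: sesqui_exp; exact: polarS.
have L0 : 0 < L 0 by apply: prodr_gt0 => e _; exact: exprn_gt0.
have Lh z : cball n rho z -> match s with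
    | Posz k => L z * hr z ^+ k = L 0 * hr 0 ^+ k
    | Negz k => L z = L 0 / hr 0 ^+ k.+1 * hr z ^+ k.+1
    end.
  by move=> zB; apply: (prod_of_logs (fun e => f0 e z) (fun e => f0 e 0)) (rel z zB).
case: s Lh {ps w fKS fKA A0 cA cw rel} => k Lh.
  exists p, (Posz k), (L 0 * hr 0 ^+ k); split=> //; first by rewrite mulr_gt0 // exprn_gt0.
  move=> z xi zB xB; apply/eqP; rewrite -subr_eq0; apply/eqP.
  apply: (polarization (g := fun z xi => kernel p z xi * eval2 h z xi ^+ k + - _)) zB xB.
    apply: sesqui_add; last exact: sesqui_cst.
    by apply: sesqui_mul => //; apply: sesqui_exp; exact: sesqui_eval2.
  move=> {z xi}z zB; apply/eqP; rewrite subr_eq0; apply/eqP.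
  by rewrite kernelE hrE -(Lh z zB) real_mul_exp.
exists p, (Negz k), (L 0 / hr 0 ^+ k.+1); split=> //; first by rewrite divr_gt0 // exprn_gt0.
move=> z xi zB xB; apply/eqP; rewrite -subr_eq0; apply/eqP; rewrite -mulNr.
apply: (polarization (g := fun z xi => kernel p z xi + - _ * eval2 h z xi ^+ k.+1)) zB xB.
  apply: sesqui_add => //.
  by apply: sesqui_mul; [exact: sesqui_cst|apply: sesqui_exp; exact: sesqui_eval2].
move=> {z xi}z zB; apply/eqP; rewrite mulNr subr_eq0; apply/eqP.
by rewrite kernelE hrE (Lh z zB) real_mul_exp.
Qed.

(** The kernel is a sum of squares over a family containing 1 and every component, because all
    exponents [p e] are positive. [inverse_kernel_const] excludes a positive power of [h] on its
    side, and [polynomial_kernel] treats what remains. *)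
Let polynomial_components : exists q : I -> mpoly.mpoly n C,
  forall i z, cball n rho z -> X i z = evaln (q i) z.
Proof.
suff H i : exists q : mpoly.mpoly n C, forall z, cball n rho z -> X i z = evaln q z.
  by have /fin_all_exists[q qE] := H; exists q.
have [p [s [d [p0 d0 pd]]]] := integer_relation.
have := square_sum_prod (fun e => square_sum_exp (p0 e) (square_sum_polar (Phi e))).
move=> [J [V [VE V1 VX]]].
have [j jE] : exists j, V j = X i by apply: VX; exists (tag i), (tagged i).
suff [t [b tE]] : exists t b, forall z xi, cball n rho z -> cball n rho xi ->
    kernel p z xi = b * eval2 h z xi ^+ t.
  rewrite -jE; apply: (@polynomial_kernel R n rho J V h b t) => z xi zB xB.
  by rewrite -VE; exact: tE.
case: s pd => k pd; last by exists k.+1, d%:C%C.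
case: k pd => [|k] pd.
  by exists 0%N, d%:C%C => z xi zB xB; have := pd z xi zB xB; rewrite !expr0 !mulr1.
exfalso; apply: (proj1 h_irr).
apply: (@inverse_kernel_const R n rho rho0 J V h d%:C%C k.+1 isT V1 h_pos) => z xi zB xB.
by rewrite -VE; exact: pd.
Qed.

Let h_unit : h \isn't a GRing.unit.
Proof.
apply/negP => /andP[/eqP hE _]; apply: (proj1 h_irr); eexists; exact: hE.
Qed.

Let mconst_unit (a : mpoly.mpoly (n + n) C) : a != 0 -> mconst a -> a \is a GRing.unit.
Proof.
by move=> a0 [b bE]; rewrite bE unit_mpolyC //; apply: contraNneq a0 => b0; rewrite bE b0 mpoly.mpolyC0.
Qed.

Let h_neq0 : h != 0.
Proof. by apply/eqP => hE; apply: (proj1 h_irr); exists 0; rewrite hE mpoly.mpolyC0. Qed.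

Let polar_power e : exists (a : C) (k : nat), forall z xi, cball n rho z -> cball n rho xi ->
  1 + polar (Phi e) z xi = a * eval2 h z xi ^+ k.
Proof.
have [q qE] := polynomial_components.
pose Y i z := evaln (q i) z.
have /fin_all_exists[g gE] : forall e, exists g : mpoly.mpoly (n + n) C,
    forall z xi, cball n rho z -> cball n rho xi -> 1 + polar (Phi e) z xi = eval2 g z xi.
  move=> e'; have YS : sesqui Y (fun z xi => 1 + \sum_(k < M e')
      Y (Tagged (fun e => 'I_(M e)) k) z * (Y (Tagged (fun e => 'I_(M e)) k) (vconj xi))^*).
    apply: sesqui_add; first exact: sesqui_cst.
    apply: (@sesqui_sum R n I Y 'I_(M e') _ (fun k z xi => Y (Tagged (fun e => 'I_(M e)) k) z
      * (Y (Tagged (fun e => 'I_(M e)) k) (vconj xi))^*)) => k.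
    by apply: sesqui_mul; [exact: sesqui_hol|exact: sesqui_anti].
  have [g gE] := sesqui_polynomial (fun i z => erefl (Y i z)) YS.
  exists g => z xi zB xB; rewrite -gE; congr (_ + _); apply: eq_bigr => k _.
  by rewrite /Y -!qE //; exact: cball_conj.
have [p [s [d [p0 d0 pd]]]] := integer_relation.
have h0 (d' : C) k : d' != 0 -> forall g', g e * g' = mpoly.mpolyC _ d' * h ^+ k ->
    exists (a : C) (k : nat), g e = mpoly.mpolyC _ a * h ^+ k.
  move=> d'0 g' E1.
  have E2 : g e * (g' * mpoly.mpolyC _ d'^-1) = h ^+ k.
    by rewrite mulrA E1 mulrAC -mpoly.mpolyCM mulfV // mul1r.
  have hirr a b : h = a * b -> a \is a GRing.unit \/ b \is a GRing.unit.
    move=> hab; have := h_neq0; rewrite {1}hab mulf_eq0 negb_or => /andP[a0 b0].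
    by case: (proj2 h_irr a b hab) => /mconst_unit H; [left|right]; exact: H.
  have [u [k' [uU ->]]] := irreducible_power_divisor (@factorial_mpoly C _) h_neq0 h_unit hirr E2.
  by have /andP[/eqP -> _] := uU; eexists _, k'.
suff [a [k gh]] : exists (a : C) (k : nat), g e = mpoly.mpolyC _ a * h ^+ k.
  exists a, k => z xi zB xB; rewrite gE // gh /eval2 mpoly.mevalM mpoly.mevalC rmorphXn //.
have kernel_poly : forall z xi, cball n rho z -> cball n rho xi ->
    kernel p z xi = eval2 (\prod_e g e ^+ p e) z xi.
  move=> z xi zB xB; rewrite /eval2 rmorph_prod; apply: eq_bigr => e' _.
  by rewrite /= rmorphXn /= gE.
(* Positivity of [p e] is what makes [g e] a divisor of the product. *)
have gsplit : \prod_e g e ^+ p e = g e * (g e ^+ (p e).-1 * \prod_(e' | e' != e) g e' ^+ p e').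
  by rewrite (bigD1 e) //= mulrA -exprS prednK.
have dC : d%:C%C != 0 :> C by rewrite eq_complex /= gt_eqF.
case: s pd => k pd.
  (* Here the product of [g e] with its cofactor and [h ^+ k] is the constant [d], so the power of
     [h] to be divided is the zeroth. *)
  apply: (h0 d%:C%C 0%N dC (g e ^+ (p e).-1 * \prod_(e' | e' != e) g e' ^+ p e' * h ^+ k)).
  rewrite mulrA -gsplit expr0 mulr1; apply/eqP; rewrite -subr_eq0; apply/eqP.
  apply: (eval2_eq0 rho0) => z zB.
  have := pd z (vconj z) zB (cball_conj zB); rewrite kernel_poly //; last exact: cball_conj.
  by rewrite /eval2 mpoly.mevalB mpoly.mevalM mpoly.mevalC rmorphXn => ->; rewrite subrr.
apply: (h0 d%:C%C k.+1 dC (g e ^+ (p e).-1 * \prod_(e' | e' != e) g e' ^+ p e')).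
rewrite -gsplit; apply/eqP; rewrite -subr_eq0; apply/eqP.
apply: (eval2_eq0 rho0) => z zB.
have := pd z (vconj z) zB (cball_conj zB); rewrite kernel_poly //; last exact: cball_conj.
by rewrite /eval2 mpoly.mevalB mpoly.mevalM mpoly.mevalC rmorphXn => ->; rewrite subrr.
Qed.

Lemma rigidity : (forall e, polynomial_map_on (cball n rho) (Phi e)) /\
  exists (k : E -> nat) (A : E -> R), [/\ forall e, (0 < k e)%N, forall e, 0 < A e,
    forall e z xi, cball n rho z -> cball n rho xi ->
       1 + polar (Phi e) z xi = (A e)%:C%C * eval2 h z xi ^+ k e &
    r = \sum_e (k e)%:R * c e].
Proof.
split.
  move=> e i; have [q qE] := polynomial_components.
  by exists (q (Tagged (fun e => 'I_(M e)) i)) => z; exact: (qE (Tagged (fun e => 'I_(M e)) i)).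
have /fin_all_exists[a] := polar_power.
move=> /fin_all_exists[k ak].
have B0 := cball0 n rho0.
(* Evaluating the identity at the origin forces this constant and shows that it is real and
   positive. *)
pose A e := f e 0 / hr 0 ^+ k e.
have A0 e : 0 < A e by rewrite divr_gt0 ?exprn_gt0.
have aA e : a e = (A e)%:C%C.
  have := ak e 0 (vconj 0) B0 (cball_conj B0); rewrite fE hrE.
  have -> : f e 0 = A e * hr 0 ^+ k e by rewrite /A divfK // expf_neq0 // gt_eqF.
  rewrite real_mul_exp => /mulIf ->//; apply: expf_neq0.
  by rewrite -hrE lt0r_neq0.
have {}ak e z xi : cball n rho z -> cball n rho xi ->
    1 + polar (Phi e) z xi = (A e)%:C%C * eval2 h z xi ^+ k e by rewrite -aA; exact: ak.
exists k, A; split=> //.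
  (* With [k e = 0], [polar (Phi e)] would be constant, and so would [Phi e]. *)
  move=> e; rewrite lt0n; apply/eqP => ke.
  have [z1 [z2 [z1B [z2B]]]] := Phi_nc e; apply.
  apply: (@polar_const _ _ ((A e)%:C%C - 1)) z1B z2B => z xi zB xB.
  by have := ak e z xi zB xB; rewrite ke expr0 mulr1 => <-; rewrite addrC addKr.
(* Substituting the powers of [h] into the identity leaves [x * ln h] constant on the diagonal of
   the ball; a nonzero [x] would make [h] constant. *)
apply/eqP; rewrite -subr_eq0; apply/eqP; set x := r - _.
have fA e z : cball n rho z -> f e z = A e * hr z ^+ k e.
  move=> zB; apply: complexI; rewrite -fE ak ?hrE //; last exact: cball_conj.
  by rewrite real_mul_exp.
have xE z : cball n rho z -> x * ln (hr z) = \sum_e c e * ln (A e).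
  move=> zB; rewrite /x mulrBl -logs // mulr_suml -sumrB; apply: eq_bigr => e _.
  by rewrite fA // lnM ?posrE ?exprn_gt0 // lnXn // -mulr_natl; ring.
apply: contrapT => /eqP x0; apply: (proj1 h_irr).
apply: (eval2_const rho0 (c := (hr 0)%:C%C)) => z zB.
suff E0 : hr z = hr 0 by rewrite hrE E0.
apply: ln_inj; first exact: hr0.
  exact: hr0.
exact: (mulfI x0 (etrans (xE z zB) (esym (xE 0 B0)))).
Qed.

End Rigidity.

Local Close Scope classical_set_scope.

Theorem theorem4p1 (R : realType) (n : nat) (hn : (1 <= n)%N)
  (h : mpoly.mpoly (n + n) R[i])
  (h_irr : mirreducible h)
  (h_pos : forall z : 'rV[R[i]]_n, 0 < eval2 h z (vconj z))
  (rho : R) (rho_pos : 0 < rho)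
  (m v : nat) (N : 'I_m -> nat) (N' : 'I_v -> nat)
  (F : forall l : 'I_m, 'rV[R[i]]_n -> 'rV[R[i]]_(N l))
  (G : forall j : 'I_v, 'rV[R[i]]_n -> 'rV[R[i]]_(N' j))
  (F_hol : forall l, holomorphic_on (cball n rho) (F l))
  (G_hol : forall j, holomorphic_on (cball n rho) (G j))
  (F_alg : forall l, algebraic_on (cball n rho) (F l))
  (G_alg : forall j, algebraic_on (cball n rho) (G j))
  (F_nc : forall l, nonconstant_on (cball n rho) (F l))
  (G_nc : forall j, nonconstant_on (cball n rho) (G j))
  (r : R) (r_neq0 : r != 0)
  (mu : 'I_m -> R) (lambda : 'I_v -> R)
  (mu_pos : forall l, 0 < mu l) (lambda_pos : forall j, 0 < lambda j)
  (span_cond : forall (a : 'I_v -> rat) (b : 'I_m -> rat),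
      (forall j, 0 <= a j) -> (forall l, 0 <= b l) ->
      \sum_(j < v) ratr (a j) * lambda j = \sum_(l < m) ratr (b l) * mu l ->
      \sum_(j < v) ratr (a j) * lambda j = 0)
  (identity : forall z, cball n rho z ->
      complex.Re (eval2 h z (vconj z)) `^ r =
      \prod_(l < m) (1 + sqnorm (F l z)) `^ (mu l) *
      \prod_(j < v) (1 + sqnorm (G j z)) `^ (- lambda j)) :
  (forall l, polynomial_map_on (cball n rho) (F l)) /\
  (forall j, polynomial_map_on (cball n rho) (G j)) /\
  exists (ml : 'I_m -> nat) (nj : 'I_v -> nat) (A : 'I_m -> R) (B : 'I_v -> R),
    (forall l, (0 < ml l)%N) /\ (forall j, (0 < nj j)%N) /\
    (forall l, 0 < A l) /\ (forall j, 0 < B j) /\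
    (forall l z xi, cball n rho z -> cball n rho xi ->
       1 + polar (F l) z xi = (A l)%:C%C * eval2 h z xi ^+ ml l) /\
    (forall j z xi, cball n rho z -> cball n rho xi ->
       1 + polar (G j) z xi = (B j)%:C%C * eval2 h z xi ^+ nj j) /\
    r = \sum_(l < m) (ml l)%:R * mu l - \sum_(j < v) lambda j * (nj j)%:R.

Proof.
pose E := ('I_m + 'I_v)%type.
pose M (e : E) := match e with inl l => N l | inr j => N' j end.
pose Phi (e : E) : 'rV[R[i]]_n -> 'rV[R[i]]_(M e) :=
  match e with inl l => F l | inr j => G j end.
pose c (e : E) := match e with inl l => mu l | inr j => - lambda j end.
have Phi_hol e : holomorphic_on (cball n rho) (Phi e) by case: e => e; [exact: F_hol|exact: G_hol].
have Phi_alg e : algebraic_on (cball n rho) (Phi e) by case: e => e; [exact: F_alg|exact: G_alg].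
have Phi_nc e : nonconstant_on (cball n rho) (Phi e) by case: e => e; [exact: F_nc|exact: G_nc].
(* A nonnegative relation equates a combination of the [lambda j] with one of the [mu l]. By
   [span_cond] both are zero, and positivity of [lambda] and [mu] kills every coefficient. *)
have c_indep (b : E -> rat) : (forall e, 0 <= b e) ->
    \sum_e ratr (b e) * c e = 0 -> forall e, b e = 0.
  move=> b0; rewrite big_sumType /=; under [X in _ + X]eq_bigr do rewrite mulrN.
  rewrite sumrN => /eqP; rewrite subr_eq0 => /eqP bE.
  have lam0 : \sum_(j < v) ratr (b (inr j)) * lambda j = 0.
    by apply: (span_cond (fun j => b (inr j)) (fun l => b (inl l))).
  have zero (k : nat) (x : 'I_k -> rat) (y : 'I_k -> R) : (forall i, 0 <= x i) ->
      (forall i, 0 < y i) -> \sum_i ratr (x i) * y i = 0 -> forall i, x i = 0.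
    move=> x0 y0 /eqP; rewrite psumr_eq0 => [/allP xy i|i _]; last first.
      by rewrite mulr_ge0 ?ler0q // ltW.
    have := xy i (mem_index_enum i); rewrite mulf_eq0 (gt_eqF (y0 i)) orbF fmorph_eq0.
    by move/eqP.
  case=> [l|j].
    by apply: (zero _ (fun l => b (inl l)) mu) => //; rewrite bE.
  exact: (zero _ (fun j => b (inr j)) lambda).
have id z : cball n rho z -> complex.Re (eval2 h z (vconj z)) `^ r =
    \prod_e (1 + sqnorm (Phi e z)) `^ c e.
  by move=> zB; rewrite big_sumType identity.
have [poly [k [A [k0 A0 kA rE]]]] :=
  rigidity rho_pos Phi_hol Phi_alg Phi_nc h_irr h_pos c_indep id.
split; first by move=> l; exact: (poly (inl l)).
split; first by move=> j; exact: (poly (inr j)).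
exists (fun l => k (inl l)), (fun j => k (inr j)), (fun l => A (inl l)), (fun j => A (inr j)).
do 4![split; first by move=> ?].
split; first by move=> l; exact: (kA (inl l)).
split; first by move=> j; exact: (kA (inr j)).
rewrite rE big_sumType /= -sumrN; congr (_ + _).
by apply: eq_bigr => j _; rewrite mulrN mulrC.
Qed.
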